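(* Let $r\ge0$ and let $\lambda\in X_{p^r\ell}$. Then the restriction of $L_\zeta(\lambda)$ to $U_\zeta(G_r)$ is a simple $U_\zeta(G_r)$-module.
   Context: Quantum groups. Let $\Phi$ be a finite indecomposable root system with simple roots $\Pi$, positive roots $\Phi^+$, Weyl group $W$, and $W$-invariant inner product $(\cdot,\cdot)$ normalized so that $(\alpha,\alpha)=2$ for short roots $\alpha$. Put $\alpha^\vee=2\alpha/(\alpha,\alpha)$; let $X=\{\lambda:(\lambda,\alpha^\vee)\in\mathbb{Z}\ \forall\alpha\in\Phi\}$ be the weight lattice and $X^+=\{\lambda\in X:(\lambda,\alpha^\vee)\ge0\ \forall\alpha\in\Phi^+\}$. Let $q$ be an indeterminate, $\mathsf{A}=\mathbb{Z}[q,q^{-1}]$, $q_\alpha=q^{(\alpha,\alpha)/2}$, $[n]_\alpha=\frac{q_\alpha^n-q_\alpha^{-n}}{q_\alpha-q_\alpha^{-1}}$, $[n]_\alpha^!=[n]_\alpha\cdots[1]_\alpha$. Let $\mathbb{U}_q$ be the quantized enveloping algebra over $\mathbb{Q}(q)$ with generators $E_\alpha,F_\alpha,K_\alpha^{\pm1}$ ($\alpha\in\Pi$) and relations: $K_\alpha K_\alpha^{-1}=1$, $K_\alpha K_\beta=K_\beta K_\alpha$, $K_\alpha E_\beta K_\alpha^{-1}=q^{(\alpha,\beta)}E_\beta$, $K_\alpha F_\beta K_\alpha^{-1}=q^{-(\alpha,\beta)}F_\beta$, $E_\alpha F_\beta-F_\beta E_\alpha=\delta_{\alpha\beta}\frac{K_\alpha-K_\alpha^{-1}}{q_\alpha-q_\alpha^{-1}}$,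 and the quantum Serre relations. Let $U_{\mathsf{A}}$ be the $\mathsf{A}$-subalgebra generated by all $K_\alpha^{\pm1}$ and divided powers $E_\alpha^{(n)}=E_\alpha^n/[n]_\alpha^!$, $F_\alpha^{(n)}=F_\alpha^n/[n]_\alpha^!$ ($n\ge0$). It contains the elements $\left[{K_\alpha;0\atop n}\right]=\prod_{s=1}^n\frac{K_\alpha q_\alpha^{1-s}-K_\alpha^{-1}q_\alpha^{s-1}}{q_\alpha^s-q_\alpha^{-s}}$. Let $k$ be a field of characteristic $p\neq2$, with $p\ne3$ if $\Phi$ has type $G_2$. Let $\ell$ be an odd positive integer, coprime to $p$ (if $p>0$), and coprime to $3$ if $\Phi$ has type $G_2$. Let $\zeta\in k$ be a primitive $\ell$-th root of unity, and regard $k$ as an $\mathsf{A}$-module via $q\mapsto\zeta$. $U_\zeta$ is the quotient of $U_{\mathsf{A}}\otimes_{\mathsf{A}}k$ by the two-sided ideal generated by all $K_\alpha^\ell-1$. For $r\ge0$ (where $p>0$ is required if $r\geq1$), the Frobenius--Lusztig kernel $U_\zeta(G_r)$ is the subalgebra of $U_\zeta$ generated by $\{E_\alpha,E_\alpha^{(p^i\ell)},F_\alpha,F_\alpha^{(p^i\ell)},K_\alpha:\alpha\in\Pi,\ 0\le i\le r-1\}$. Modules. A vector $v$ in a $U_\zeta$-module has weight $\mu\in X$ if for all $\alpha\in\Pi$ and $n\ge 0$, $K_\alpha v=\zeta^{(\mu,\alpha)}v$ and $\left[{K_\alpha;0\atop n}\right]v=cv$, where $c$ is the image in $k$ of the Gaussian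 binomial coefficient $\prod_{s=1}^n\frac{q_\alpha^{m-s+1}-q_\alpha^{-(m-s+1)}}{q_\alpha^s-q_\alpha^{-s}}$ with $m=(\mu,\alpha^\vee)$. A $U_\zeta$-module is integrable if it is the direct sum of its weight spaces and each vector is killed by $E_\alpha^{(n)}$ and $F_\alpha^{(n)}$ for all $n\gg0$ (equivalently, it is a sum of weight spaces and locally finite). The simple integrable $U_\zeta$-modules are parametrized by their highest weights in $X^+$; $L_\zeta(\lambda)$ denotes the one of highest weight $\lambda\in X^+$. $X_{p^r\ell}=\{\mu\in X^+:0\le(\mu,\alpha^\vee)<p^r\ell\ \ \forall\alpha\in\Pi\}$. *)

(* Defs.v *)
From HB Require Import structures.
From mathcomp Require Import all_boot all_order all_algebra fraction archimedean.
From mathcomp Require Import boolp.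
From mathcomp Require Import monalg.

Set Implicit Arguments.
Unset Strict Implicit.
Unset Printing Implicit Defensive.

Import Order.TTheory GRing.Theory Num.Theory.
Local Open Scope ring_scope.
Local Open Scope quotient_scope.

(* Rings are possibly trivial (pzRingType): nothing prevents a quotient by a
   two-sided ideal from being zero. *)
Inductive ideal_gen (A : pzRingType) (S : A -> Prop) : A -> Prop :=
| ideal_gen_base x : S x -> ideal_gen S x
| ideal_gen_zero : ideal_gen S 0
| ideal_gen_sub x y : ideal_gen S x -> ideal_gen S y -> ideal_gen S (x - y)
| ideal_gen_mull a x : ideal_gen S x -> ideal_gen S (a * x)
| ideal_gen_mulr a x : ideal_gen S x -> ideal_gen S (x * a).

Section Quotient.
Variables (A : pzRingType) (S : A -> Prop).

Definition ideal_pred : {pred A} := fun x => `[< ideal_gen S x >].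

Fact ideal_pred_zmod : zmod_closed ideal_pred.
Proof.
split; first by apply/asboolP; exact: ideal_gen_zero.
by move=> x y /asboolP Ix /asboolP Iy; apply/asboolP; exact: ideal_gen_sub.
Qed.
HB.instance Definition _ := GRing.isZmodClosed.Build A ideal_pred ideal_pred_zmod.

Definition quot_ring : Type := Quotient.quot ideal_pred.
HB.instance Definition _ := GRing.Zmodule.on quot_ring.
HB.instance Definition _ := EqQuotient.on quot_ring.

Definition quot_proj (x : A) : quot_ring := \pi_quot_ring x.
Definition quot_repr (u : quot_ring) : A := repr u.

Fact quot_projP x y : reflect (ideal_gen S (x - y)) (quot_proj x == quot_proj y).
Proof.
rewrite /quot_proj -[_ == _]/(\pi_(Quotient.quot ideal_pred) x == \pi y).
by rewrite -Quotient.idealrBE; exact: asboolP.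
Qed.

Fact quot_reprK : cancel quot_repr quot_proj.
Proof. exact: reprK. Qed.

Definition quot_one : quot_ring := quot_proj 1.
Definition quot_mul (u v : quot_ring) : quot_ring :=
  quot_proj (quot_repr u * quot_repr v).

Fact quot_projD x y : quot_proj (x + y) = quot_proj x + quot_proj y.
Proof. exact: (@Quotient.pi_add A ideal_pred). Qed.

Fact quot_projN x : quot_proj (- x) = - quot_proj x.
Proof. exact: (@Quotient.pi_opp A ideal_pred). Qed.

Fact quot_projM x y : quot_proj (x * y) = quot_mul (quot_proj x) (quot_proj y).
Proof.
rewrite /quot_mul; set x' := quot_repr _; set y' := quot_repr _.
have Ix : ideal_gen S (x - x') by apply/quot_projP; rewrite quot_reprK.
have Iy : ideal_gen S (y - y') by apply/quot_projP; rewrite quot_reprK.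
apply/eqP/quot_projP.
have -> : x * y - x' * y' = (x - x') * y - x' * (y' - y).
  by rewrite mulrBl mulrBr opprB addrA subrK.
apply: ideal_gen_sub; first exact: ideal_gen_mulr.
apply: ideal_gen_mull; rewrite -opprB -sub0r.
by apply: ideal_gen_sub => //; exact: ideal_gen_zero.
Qed.

Fact quot_mulA : associative quot_mul.
Proof.
move=> u v w; rewrite -(quot_reprK u) -(quot_reprK v) -(quot_reprK w).
by rewrite -!quot_projM mulrA.
Qed.
Fact quot_mul1 : left_id quot_one quot_mul.
Proof. by move=> u; rewrite -(quot_reprK u) -quot_projM mul1r. Qed.
Fact quot_mulr1 : right_id quot_one quot_mul.
Proof. by move=> u; rewrite -(quot_reprK u) -quot_projM mulr1. Qed.
Fact quot_mulDl : left_distributive quot_mul +%R.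
Proof.
move=> u v w; rewrite -(quot_reprK u) -(quot_reprK v) -(quot_reprK w).
by rewrite -quot_projD -!quot_projM mulrDl quot_projD.
Qed.
Fact quot_mulDr : right_distributive quot_mul +%R.
Proof.
move=> u v w; rewrite -(quot_reprK u) -(quot_reprK v) -(quot_reprK w).
by rewrite -quot_projD -!quot_projM mulrDr quot_projD.
Qed.
HB.instance Definition _ := GRing.Zmodule_isPzRing.Build quot_ring
  quot_mulA quot_mul1 quot_mulr1 quot_mulDl quot_mulDr.

Fact quot_proj_zmod : zmod_morphism quot_proj.
Proof. by move=> x y; rewrite quot_projD quot_projN. Qed.
HB.instance Definition _ :=
  GRing.isZmodMorphism.Build A quot_ring quot_proj quot_proj_zmod.
Fact quot_proj_monoid : monoid_morphism quot_proj.
Proof. by split=> // x y; exact: quot_projM. Qed.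
HB.instance Definition _ :=
  GRing.isMonoidMorphism.Build A quot_ring quot_proj quot_proj_monoid.

End Quotient.

(* The unital subring of A generated by S.  The subalgebra generated by S over
   a ring of scalars C is obtained by putting the multiples C * 1 into S. *)
Inductive subring_gen (A : pzRingType) (S : A -> Prop) : A -> Prop :=
| subring_gen_base x : S x -> subring_gen S x
| subring_gen_one : subring_gen S 1
| subring_gen_sub x y : subring_gen S x -> subring_gen S y -> subring_gen S (x - y)
| subring_gen_mul x y : subring_gen S x -> subring_gen S y -> subring_gen S (x * y).

Section Subring.
Variables (A : pzRingType) (S : A -> Prop).

Definition subring_pred : {pred A} := fun x => `[< subring_gen S x >].

Fact subring_pred_closed : subring_closed subring_pred.
Proof.
split; first by apply/asboolP; exact: subring_gen_one.
- by move=> x y /asboolP Sx /asboolP Sy; apply/asboolP; exact: subring_gen_sub.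
- by move=> x y /asboolP Sx /asboolP Sy; apply/asboolP; exact: subring_gen_mul.
Qed.
HB.instance Definition _ :=
  GRing.isSubringClosed.Build A subring_pred subring_pred_closed.

Record subring := Subring { subring_val : A; subring_valP : subring_val \in subring_pred }.
HB.instance Definition _ := [isSub for subring_val].
HB.instance Definition _ := [Choice of subring by <:].
HB.instance Definition _ :=
  GRing.SubChoice_isSubPzRing.Build A subring_pred subring subring_pred_closed.

Definition subring_elt (x : A) (Sx : S x) : subring :=
  Subring (introT (asboolP _) (subring_gen_base Sx)).
End Subring.

(* E is the ambient Euclidean space, over an archimedean ordered field such as
   the real numbers; the archimedean property only serves Num.int/Num.floor. *)
Section RootSystem.
Variables (R : archiRealFieldType) (E : vectType R) (ip : E -> E -> R).

Definition inner_product : Prop :=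
  [/\ forall x y, ip x y = ip y x,
      forall a x y z, ip (a *: x + y) z = a * ip x z + ip y z &
      forall x, x != 0 -> 0 < ip x x].

(* (x, alpha^\vee) *)
Definition copairing (x alpha : E) : R := 2%:R * ip x alpha / ip alpha alpha.

Definition reflection (alpha x : E) : E := x - copairing x alpha *: alpha.

(* Reduced crystallographic root systems spanning E.  The inner product is
   automatically invariant under the Weyl group, which is generated by the
   reflections. *)
Definition root_system (Phi : seq E) : Prop :=
  [/\ 0 \notin Phi, <<Phi>>%VS = fullv,
      forall alpha beta, alpha \in Phi -> beta \in Phi ->
        reflection alpha beta \in Phi,
      forall alpha beta, alpha \in Phi -> beta \in Phi ->
        copairing beta alpha \is a Num.int &
      forall alpha (c : R), alpha \in Phi -> c *: alpha \in Phi ->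
        c = 1 \/ c = -1].

Definition indecomposable (Phi : seq E) : Prop :=
  Phi <> [::] /\
  forall P : pred E,
    (forall alpha beta, alpha \in Phi -> beta \in Phi ->
       P alpha -> ~~ P beta -> ip alpha beta = 0) ->
    all P Phi \/ all (predC P) Phi.

Definition positive_root (Phi : seq E) n (Pi : n.-tuple E) (alpha : E) : Prop :=
  alpha \in Phi /\ forall i, 0 <= coord Pi i alpha.

Definition simple_roots (Phi : seq E) n (Pi : n.-tuple E) : Prop :=
  [/\ basis_of fullv Pi, {subset Pi <= Phi},
      forall alpha i, alpha \in Phi -> coord Pi i alpha \is a Num.int &
      forall alpha, alpha \in Phi ->
        (forall i, 0 <= coord Pi i alpha) \/ (forall i, coord Pi i alpha <= 0)].

(* If all roots have the same length, they are all short. *)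
Definition short_root (Phi : seq E) (alpha : E) : Prop :=
  alpha \in Phi /\ forall beta, beta \in Phi -> ip alpha alpha <= ip beta beta.

Definition normalized (Phi : seq E) : Prop :=
  forall alpha, short_root Phi alpha -> ip alpha alpha = 2%:R.

(* The Cartan matrix is the one of type G_2. *)
Definition type_G2 n (Pi : n.-tuple E) : Prop :=
  n = 2%N /\ exists i j : 'I_n,
    copairing (tnth Pi i) (tnth Pi j) = -1 /\
    copairing (tnth Pi j) (tnth Pi i) = -3%:R.

Definition weight_lattice (Phi : seq E) (mu : E) : Prop :=
  forall alpha, alpha \in Phi -> copairing mu alpha \is a Num.int.

Definition dominant (Phi : seq E) n (Pi : n.-tuple E) (mu : E) : Prop :=
  weight_lattice Phi mu /\
  forall alpha, positive_root Phi Pi alpha -> 0 <= copairing mu alpha.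

Definition restricted (Phi : seq E) n (Pi : n.-tuple E) (N : nat) (mu : E) : Prop :=
  dominant Phi Pi mu /\
  forall i : 'I_n, 0 <= copairing mu (tnth Pi i) < N%:R.

(* The integers (mu, alpha) and (mu, alpha^\vee), for mu a weight and alpha a
   root; Num.floor is only used as the inverse of the embedding of int. *)
Definition int_ip (mu alpha : E) : int := Num.floor (ip mu alpha).
Definition int_copairing (mu alpha : E) : int := Num.floor (copairing mu alpha).

Definition gram n (Pi : n.-tuple E) : 'M[int]_n :=
  \matrix_(i, j) int_ip (tnth Pi i) (tnth Pi j).

End RootSystem.

Notation Qq := {fraction {poly rat}}.
Definition q : Qq := FracField.tofrac 'X.

(* The Laurent polynomial q^-m P(q) evaluated at q := x. *)
Definition laurent (F : fieldType) (x : F) (m : nat) (P : {poly int}) : F :=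
  x ^- m * (map_poly intr P).[x].

Definition in_A (a : Qq) : Prop := exists m P, a = laurent q m P.

(* c is the image of a \in A under the ring morphism A -> F, q |-> zeta
   (for zeta != 0). *)
Definition specializes (F : fieldType) (zeta : F) (a : Qq) (c : F) : Prop :=
  exists m P, a = laurent q m P /\ c = laurent zeta m P.

(* With d = (alpha, alpha)/2, these are q_alpha^m - q_alpha^-m, [m]_alpha,
   [m]_alpha^! and the Gaussian binomial coefficient [m; t]_alpha. *)
Definition qdiff (d m : int) : Qq := q ^ (d * m) - q ^ (- (d * m)).
Definition qnum (d m : int) : Qq := qdiff d m / qdiff d 1.
Definition qfact (d : int) (m : nat) : Qq := \prod_(1 <= s < m.+1) qnum d s.
Definition qbinom (d m : int) (t : nat) : Qq :=
  \prod_(1 <= s < t.+1) (qdiff d (m - s%:Z + 1) / qdiff d s).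

(* Monoid algebra of the monoid of words over X. *)
Definition free_alg (F : fieldType) (X : choiceType) : nzRingType :=
  {malg F[{fmonom X}]}.
Definition free_gen (F : fieldType) (X : choiceType) (x : X) : free_alg F X :=
  mkmalgU (fmu x) 1.
Definition free_scalar (F : fieldType) (X : choiceType) (c : F) : free_alg F X :=
  mkmalgU (fmone X) c.

(* B is the matrix of the integers (alpha_i, alpha_j), indexed by simple roots. *)
Section Uq.
Variables (n : nat) (B : 'M[int]_n).

(* (alpha_i, alpha_i)/2 and (alpha_j, alpha_i^\vee); the divisions are exact *)
Definition half_norm (i : 'I_n) : int := (B i i %/ 2)%Z.
Definition cartan (i j : 'I_n) : int := ((2 * B i j) %/ B i i)%Z.

(* The four summands index the generators E_i, F_i, K_i, K_i^-1. *)
Definition Uq_index : choiceType := (('I_n + 'I_n) + ('I_n + 'I_n))%type.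
Definition FreeUq := free_alg Qq Uq_index.
Definition fE (i : 'I_n) : FreeUq := free_gen Qq (inl (inl i) : Uq_index).
Definition fF (i : 'I_n) : FreeUq := free_gen Qq (inl (inr i) : Uq_index).
Definition fK (i : 'I_n) : FreeUq := free_gen Qq (inr (inl i) : Uq_index).
Definition fKV (i : 'I_n) : FreeUq := free_gen Qq (inr (inr i) : Uq_index).
Definition fc (c : Qq) : FreeUq := free_scalar Uq_index c.

Definition serre (f : 'I_n -> FreeUq) (i j : 'I_n) : FreeUq :=
  let m := `|(1 - cartan i j)%R|%N in
  \sum_(0 <= s < m.+1)
    fc ((-1) ^+ s * qbinom (half_norm i) m s) *
      (f i ^+ (m - s) * f j * f i ^+ s).

(* An element x stands for the relation x = 0. *)
Inductive Uq_rel : FreeUq -> Prop :=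
| rel_KKV i : Uq_rel (fK i * fKV i - 1)
| rel_KVK i : Uq_rel (fKV i * fK i - 1)
| rel_KK i j : Uq_rel (fK i * fK j - fK j * fK i)
| rel_KE i j : Uq_rel (fK i * fE j * fKV i - fc (q ^ B i j) * fE j)
| rel_KF i j : Uq_rel (fK i * fF j * fKV i - fc (q ^ (- B i j)) * fF j)
| rel_EF i j : Uq_rel (fE i * fF j - fF j * fE i
    - (if i == j then fc (qdiff (half_norm i) 1)^-1 * (fK i - fKV i) else 0))
| rel_serreE i j : i != j -> Uq_rel (serre fE i j)
| rel_serreF i j : i != j -> Uq_rel (serre fF i j).

Definition Uq : pzRingType := quot_ring Uq_rel.
Definition Uq_proj (x : FreeUq) : Uq := quot_proj Uq_rel x.
Definition Uq_scalar (c : Qq) : Uq := Uq_proj (fc c).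
Definition qK (i : 'I_n) : Uq := Uq_proj (fK i).
Definition qKV (i : 'I_n) : Uq := Uq_proj (fKV i).
Definition qE (i : 'I_n) (m : nat) : Uq :=
  Uq_scalar (qfact (half_norm i) m)^-1 * Uq_proj (fE i) ^+ m.
Definition qF (i : 'I_n) (m : nat) : Uq :=
  Uq_scalar (qfact (half_norm i) m)^-1 * Uq_proj (fF i) ^+ m.

(* The q-binomial element usually written [K_i; 0 over t]. *)
Definition qKbinom (i : 'I_n) (t : nat) : Uq :=
  let d := half_norm i in
  \prod_(1 <= s < t.+1)
    (Uq_scalar (qdiff d s)^-1 *
      (qK i * Uq_scalar (q ^ (d * (1 - s%:Z)))
       - qKV i * Uq_scalar (q ^ (d * (s%:Z - 1))))).

Inductive UA_gen : Uq -> Prop :=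
| UA_gen_scalar a : in_A a -> UA_gen (Uq_scalar a)
| UA_gen_K i : UA_gen (qK i)
| UA_gen_KV i : UA_gen (qKV i)
| UA_gen_E i m : UA_gen (qE i m)
| UA_gen_F i m : UA_gen (qF i m).

Definition UA : pzRingType := subring UA_gen.
Definition UA_val (u : UA) : Uq := subring_val u.
Definition aK (i : 'I_n) : UA := subring_elt (UA_gen_K i).
Definition aE (i : 'I_n) (m : nat) : UA := subring_elt (UA_gen_E i m).
Definition aF (i : 'I_n) (m : nat) : UA := subring_elt (UA_gen_F i m).

Section Specialization.
Variables (k : fieldType) (l : nat) (zeta : k).

(* The k-algebra U_A \otimes_A k, where k is an A-algebra via q |-> zeta: it is
   generated by the symbols u \otimes 1 (u \in U_A), subject to
   (u + v) \otimes 1 = u \otimes 1 + v \otimes 1,  a u \otimes 1 = u \otimes a(zeta)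
   (a \in A), and to compatibility with products and units. *)
Notation FreeUk := (free_alg k UA).
Notation tens u := (free_gen k (u : UA)).
Inductive tensor_rel : FreeUk -> Prop :=
| tensor_add u v : tensor_rel (tens (u + v) - (tens u + tens v))
| tensor_scale a c u v :
    specializes zeta a c -> UA_val v = Uq_scalar a * UA_val u ->
    tensor_rel (tens v - free_scalar UA c * tens u)
| tensor_one : tensor_rel (tens 1 - 1)
| tensor_mul u v : tensor_rel (tens (u * v) - tens u * tens v).

Definition Uk : pzRingType := quot_ring tensor_rel.
Definition Uk_of (u : UA) : Uk := quot_proj tensor_rel (tens u).
Definition Uk_scalar (c : k) : Uk := quot_proj tensor_rel (free_scalar UA c).

Inductive Kl_rel : Uk -> Prop :=
| rel_Kl i : Kl_rel (Uk_of (aK i) ^+ l - 1).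

Definition Uzeta : pzRingType := quot_ring Kl_rel.
Definition Uzeta_of (u : UA) : Uzeta := quot_proj Kl_rel (Uk_of u).
Definition Uzeta_scalar (c : k) : Uzeta := quot_proj Kl_rel (Uk_scalar c).
Definition uK (i : 'I_n) : Uzeta := Uzeta_of (aK i).
Definition uE (i : 'I_n) (m : nat) : Uzeta := Uzeta_of (aE i m).
Definition uF (i : 'I_n) (m : nat) : Uzeta := Uzeta_of (aF i m).

(* The k-subalgebra U_zeta(G_r); uE i 1 is E_i itself. *)
Inductive FL_gen (p r : nat) : Uzeta -> Prop :=
| FL_gen_scalar c : FL_gen p r (Uzeta_scalar c)
| FL_gen_K i : FL_gen p r (uK i)
| FL_gen_E i : FL_gen p r (uE i 1)
| FL_gen_F i : FL_gen p r (uF i 1)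
| FL_gen_Ep i s : (s < r)%N -> FL_gen p r (uE i (p ^ s * l))
| FL_gen_Fp i s : (s < r)%N -> FL_gen p r (uF i (p ^ s * l)).

Definition FL_kernel (p r : nat) : Uzeta -> Prop := subring_gen (FL_gen p r).

End Specialization.
End Uq.

(* S is meant to be (the membership predicate of) a subring of U; stability
   under opposites then follows from -1 \in S. *)
Definition simple_over (U : pzRingType) (S : U -> Prop) (V : lmodType U) : Prop :=
  (exists v : V, v <> 0) /\
  forall W : V -> Prop,
    W 0 ->
    (forall v w, W v -> W w -> W (v + w)) ->
    (forall u v, S u -> W v -> W (u *: v)) ->
    (forall v, W v -> v = 0) \/ (forall v, W v).

Definition simple_module (U : pzRingType) (V : lmodType U) : Prop :=
  simple_over (fun _ : U => True) V.

Section Modules.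
Variables (R : archiRealFieldType) (E : vectType R) (ip : E -> E -> R).
Variables (Phi : seq E) (n : nat) (Pi : n.-tuple E).
Variables (k : fieldType) (l : nat) (zeta : k).
Notation B := (gram ip Pi).
Notation U := (Uzeta B l zeta).
Variable V : lmodType U.

Definition kscale (c : k) (v : V) : V := Uzeta_scalar B l zeta c *: v.

(* In the last clause u and c are uniquely determined: qKbinom B i t lies in
   the subring U_A of U_q, and the Gaussian binomial coefficient in A. *)
Definition weight_vector (mu : E) (v : V) : Prop :=
  [/\ weight_lattice ip Phi mu,
      forall i, uK B l zeta i *: v = kscale (zeta ^ int_ip ip mu (tnth Pi i)) v &
      forall i t (u : UA B) (c : k),
        UA_val u = qKbinom B i t ->
        specializes zeta
          (qbinom (half_norm B i) (int_copairing ip mu (tnth Pi i)) t) c ->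
        Uzeta_of l zeta u *: v = kscale c v].

Definition sum_of_weight_spaces : Prop :=
  forall v : V, exists (s : seq E) (w : E -> V),
    (forall mu, mu \in s -> weight_vector mu (w mu)) /\
    v = \sum_(mu <- s) w mu.

Definition weight_spaces_independent : Prop :=
  forall (s : seq E) (w : E -> V), uniq s ->
    (forall mu, mu \in s -> weight_vector mu (w mu)) ->
    \sum_(mu <- s) w mu = 0 -> forall mu, mu \in s -> w mu = 0.

Definition integrable : Prop :=
  [/\ sum_of_weight_spaces, weight_spaces_independent &
      forall (v : V) i, exists N : nat, forall m : nat, (N <= m)%N ->
        uE B l zeta i m *: v = 0 /\ uF B l zeta i m *: v = 0].

Definition has_highest_weight (lambda : E) : Prop :=
  exists v : V, [/\ v <> 0, weight_vector lambda v &
    forall i m, (0 < m)%N -> uE B l zeta i m *: v = 0].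

(* These properties characterize L_zeta(lambda) up to isomorphism. *)
Definition is_simple_highest_weight (lambda : E) : Prop :=
  [/\ simple_module V, integrable & has_highest_weight lambda].

End Modules.

Definition has_char (k : fieldType) (p : nat) : Prop :=
  if p is 0 then [pchar k] =i pred0 else p \in [pchar k].

(* Main.v *)
Require Import Defs.
From mathcomp Require Import all_boot all_order all_algebra fraction archimedean.
From mathcomp Require Import zify ring lra boolp.
From mathcomp Require Import monalg.
From HB Require Import structures.
Set Implicit Arguments.
Unset Strict Implicit.
Unset Printing Implicit Defensive.
Import Order.TTheory GRing.Theory Num.Theory.
Local Open Scope ring_scope.

(** Let N = p^r l, let v be a highest weight vector, and call a divided power
    small if its exponent is less than N. Two facts about exponents carry the
    proof. Firstly, the product of the divided powers of exponents a and n - a is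
    a Gaussian binomial times the one of exponent n, and for a = 1 or a = p^s l the
    Gaussian binomial can be made invertible at zeta (gauss1_neq0, gauss_lucas);
    so the Frobenius-Lusztig kernel contains all small divided powers
    (gen_degree_exists). Secondly, by the higher quantum Serre relations, moving
    a divided power E_i^(n) past E_j^(a) only creates brackets of order at most
    a |c_ij| (uE_commute, uF_commute), and this is less than N for each exponent a
    of a generator (gen_degree_small). The latter is where l and p must be odd,
    and prime to 3 in type G2: Cartan integers are at most 3 in absolute value,
    and 3 occurs in type G2 only (cartan_bound, triple_type_G2).

    Large divided powers are controlled at the top weight. Since lambda is
    restricted, F_i^(n) v = 0 for n >= N: otherwise it would generate a submodule
    that misses the top weight (f_v_big). Only multiples of F_i^(n) v could be
    raised to the top weight by E_i^(n), so the image of E_i^(n) misses it for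
    n >= N (e_low). Commuting large powers through words in the generators of the kernel, one obtains:

    - the words in the generators F applied to v span a subspace that is stable
      under all divided powers F_i^(n), hence span V (fspan_small_all);
    - the vectors all of whose images under words in the generators E miss the
      top weight form a subspace stable under all E_i^(n) (K_e), which is zero as
      V is simple (K_eq0).

    A nonzero submodule for the kernel therefore contains v, by applying a word
    of maximal length that reaches the top weight, and then it is V. This
    argument is restricted_simple, which only uses the commutation formulas;
    these are proved in the generic algebra and transported to the
    specialization, where the torus acts on weight vectors by specialized
    Gaussian binomials (Kbin_act, uEF_act). *)

(** * Quantum integers *)
Section QNumbers.
Variables (F : fieldType) (v : F).
Hypothesis v0 : v != 0.

Definition qbr (m : int) : F := v ^ m - v ^ (- m).
Definition qint (m : int) : F := qbr m / qbr 1.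
Definition qfac (n : nat) : F := \prod_(s < n) qint s.+1.
Definition qbin (m : int) (t : nat) : F :=
  \prod_(s < t) (qbr (m - s%:Z) / qbr s.+1).

Lemma qbrD a b : qbr (a + b) = v ^ a * qbr b + v ^ (- b) * qbr a.
Proof.
rewrite /qbr opprD !expfzDr // !mulrBr -!expfzDr //.
by rewrite [- b + a]addrC [- b - a]addrC subrKA.
Qed.

Lemma qintD a b : qint (a + b) = v ^ a * qint b + v ^ (- b) * qint a.
Proof. by rewrite /qint qbrD mulrDl !mulrA. Qed.

Lemma qint0 : qint 0 = 0.
Proof. by rewrite /qint /qbr oppr0 subrr mul0r. Qed.

Lemma qfacS n : qfac n.+1 = qfac n * qint n.+1.
Proof. by rewrite /qfac big_ord_recr. Qed.

Lemma qfac0 : qfac 0 = 1. Proof. by rewrite /qfac big_ord0. Qed.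

Hypothesis br_neq0 : forall n : nat, qbr n.+1 != 0.

Lemma qint_neq0 (n : nat) : qint n.+1 != 0.
Proof. by rewrite mulf_neq0 // invr_eq0 (br_neq0 0). Qed.

Lemma qint1 : qint 1 = 1. Proof. by rewrite /qint divff ?(br_neq0 0). Qed.

Lemma qfac_neq0 n : qfac n != 0.
Proof. by rewrite prodf_seq_neq0; apply/allP => i _; rewrite qint_neq0. Qed.

Lemma qbin_qfac a b : qbin (a + b)%N a = qfac (a + b) / (qfac a * qfac b).
Proof.
rewrite /qbin; elim: a => [|a IH] in b *.
  by rewrite big_ord0 qfac0 mul1r divff ?qfac_neq0.
rewrite big_ord_recr /= addSnnS IH.
have -> : ((a + b.+1)%N%:Z - a%:Z = b.+1%:Z) by lia.
have -> : qbr b.+1 / qbr a.+1 = qint b.+1 / qint a.+1.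
  by rewrite /qint invfM invrK mulrACA mulVf ?mulr1 ?(br_neq0 0).
rewrite !qfacS; field; rewrite ?qfac_neq0 ?qint_neq0 //.
Qed.

Lemma qbin_small (m t : nat) : (m < t)%N -> qbin m t = 0.
Proof.
move=> lt_mt; rewrite /qbin (bigD1 (Ordinal lt_mt)) //= subrr.
by rewrite /qbr oppr0 subrr !mul0r.
Qed.

End QNumbers.

(** * Divided powers, binomials of the torus and twisted brackets *)
Section QAlgebra.
Variables (F : fieldType) (v : F).
Hypothesis v0 : v != 0.
Hypothesis br_neq0 : forall n : nat, qbr v n.+1 != 0.
Variables (A : pzRingType) (sc : {rmorphism F -> A}).
Hypothesis scC : forall c x, x * sc c = sc c * x.

(** Locked, so that comparing two scalar multiples does not unfold products of
    the quotient algebras in which they are taken. *)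
Definition scm : F -> A -> A := locked (fun c x => sc c * x).
Local Notation "c ** x" := (scm c x) (at level 40, left associativity).
Local Notation "[ n ]" := (qint v n%:Z) (at level 0, format "[ n ]").

Lemma scmE c x : c ** x = sc c * x.
Proof. by rewrite /scm -lock. Qed.

Lemma scA c x y : x * (c ** y) = c ** (x * y).
Proof. by rewrite !scmE mulrA scC mulrA. Qed.
Lemma scE c d x : c ** (d ** x) = (c * d) ** x.
Proof. by rewrite !scmE rmorphM mulrA. Qed.
Lemma sc1 x : 1 ** x = x. Proof. by rewrite !scmE rmorph1 mul1r. Qed.
Lemma sc0 x : 0 ** x = 0. Proof. by rewrite !scmE rmorph0 mul0r. Qed.
Lemma scl c x y : (c ** x) * y = c ** (x * y). Proof. by rewrite !scmE mulrA. Qed.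
Lemma scD c d x : (c + d) ** x = c ** x + d ** x.
Proof. by rewrite !scmE rmorphD mulrDl. Qed.
Lemma scN c x : (- c) ** x = - (c ** x).
Proof. by rewrite !scmE rmorphN mulNr. Qed.
Lemma scDr c x y : c ** (x + y) = c ** x + c ** y. Proof. by rewrite !scmE mulrDr. Qed.
Lemma scBr c x y : c ** (x - y) = c ** x - c ** y. Proof. by rewrite !scmE mulrBr. Qed.
Lemma sc_sum c I (r : seq I) P (f : I -> A) :
  c ** (\sum_(i <- r | P i) f i) = \sum_(i <- r | P i) c ** f i.
Proof. by rewrite scmE mulr_sumr; apply: eq_bigr => i _; rewrite scmE. Qed.
Lemma sc_inj c x y : c != 0 -> c ** x = c ** y -> x = y.
Proof. by move=> c0 /(congr1 (fun z => c^-1 ** z)); rewrite !scE mulVf // !sc1. Qed.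

Lemma prod_sc t (a : 'I_t -> F) (x : 'I_t -> A) :
  \prod_(s < t) (a s ** x s) = (\prod_(s < t) a s) ** \prod_(s < t) x s.
Proof.
elim: t => [|t IH] in a x *; first by rewrite !big_ord0 sc1.
by rewrite !big_ord_recr /= IH scl scA scE.
Qed.

Definition divpow : A -> nat -> A :=
  locked (fun x n => (qfac v n)^-1 ** x ^+ n).

Lemma divpowE x n : divpow x n = (qfac v n)^-1 ** x ^+ n.
Proof. by rewrite /divpow -lock. Qed.

Lemma divpow0 x : divpow x 0 = 1.
Proof. by rewrite !divpowE qfac0 invr1 sc1 expr0. Qed.

Lemma divpow1 x : divpow x 1 = x.
Proof. by rewrite !divpowE qfacS qfac0 mul1r qint1 // invr1 sc1 expr1. Qed.

Lemma divpowSr x n : divpow x n * x = [n.+1] ** divpow x n.+1.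
Proof.
rewrite !divpowE scE scl -exprSr qfacS; congr (_ ** _).
by field; rewrite qfac_neq0 ?qint_neq0.
Qed.

Lemma divpowSl x n : x * divpow x n = [n.+1] ** divpow x n.+1.
Proof. by rewrite -divpowSr !divpowE scA scl -exprS -exprSr. Qed.

Lemma divpowD x a b :
  divpow x a * divpow x b = qbin v (a + b)%N a ** divpow x (a + b).
Proof.
rewrite !divpowE scl scA !scE -exprD qbin_qfac //; congr (_ ** _).
by field; rewrite !qfac_neq0.
Qed.

(** With Y^(n - t) = 0 for t > n, the sums below need no bound on t other than
    the degree in X. *)
Definition divpow_sub (x : A) (n t : nat) : A :=
  if (t <= n)%N then divpow x (n - t) else 0.

Lemma conj_shift (K KV X : A) (c : F) : c != 0 -> K * KV = 1 -> KV * K = 1 ->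
  K * X * KV = c ** X ->
  K * X = c ** (X * K) /\ KV * X = c^-1 ** (X * KV).
Proof.
move=> c0 KKV1 KVK h.
have KX : K * X = c ** (X * K) by rewrite -scl -h -!mulrA KVK mulr1.
split=> //; apply: (sc_inj c0); rewrite scE mulfV // sc1.
by rewrite -[X * KV]mul1r -KVK -mulrA [K * _]mulrA h scA.
Qed.

Section Torus.
Variables (K KV : A).
Hypothesis KKV : K * KV = KV * K.

(** Up to normalization, kq c is the quantum integer of v^c K, and kbin c t
    the corresponding Gaussian binomial, usually written [K; c over t]. *)
Definition kq (c : int) : A := v ^ c ** K - v ^ (- c) ** KV.
Definition kfall (c : int) (t : nat) : A := \prod_(s < t) kq (c - s%:Z).
Definition kbin (c : int) (t : nat) : A :=
  (\prod_(s < t) qbr v s.+1)^-1 ** kfall c t.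

Lemma kfallSr c t : kfall c t.+1 = kfall c t * kq (c - t%:Z).
Proof. by rewrite /kfall big_ord_recr. Qed.

Lemma kfallSl c t : kfall (c + 1) t.+1 = kq (c + 1) * kfall c t.
Proof.
rewrite /kfall big_ord_recl /= subr0; congr (_ * _).
by apply: eq_bigr => i _; rewrite /bump /= ; congr kq; lia.
Qed.

Lemma kq_comm c d : kq c * kq d = kq d * kq c.
Proof.
have cc a b x y : GRing.comm x y -> GRing.comm (a ** x) (b ** y).
  by rewrite /GRing.comm => xy; rewrite !scl !scA !scE xy mulrC.
apply: commrB; apply/commr_sym/commrB; apply: cc => //; exact: commr_refl || exact/commr_sym.
Qed.

Lemma kq_kfall c d t : kq c * kfall d t = kfall d t * kq c.
Proof.
elim: t => [|t IH]; first by rewrite /kfall big_ord0 mulr1 mul1r.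
by rewrite kfallSr mulrA IH -!mulrA kq_comm.
Qed.

Lemma KV_kfall d t : KV * kfall d t = kfall d t * KV.
Proof.
elim: t => [|t IH]; first by rewrite /kfall big_ord0 mulr1 mul1r.
rewrite kfallSr mulrA IH -!mulrA; congr (_ * _).
by rewrite /kq mulrBl mulrBr !scA !scl KKV.
Qed.

Lemma kbin0 c : kbin c 0 = 1.
Proof. by rewrite /kbin /kfall !big_ord0 invr1 sc1. Qed.

Lemma kbin_denS t : (\prod_(i < t) qbr v i.+1)^-1 =
   (\prod_(i < t.+1) qbr v i.+1)^-1 * qbr v t.+1.
Proof. by rewrite big_ord_recr /= invfM -mulrA mulVf ?mulr1 ?br_neq0. Qed.

(** The q-Pascal rule. Read in both directions, it changes the shift c by one at
    the price of a binomial of lower degree t. *)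
Lemma kbin_pascal c t :
  kbin (c + 1) t.+1 =
  v ^ t.+1 ** kbin c t.+1 + v ^ (t%:Z - c) ** (KV * kbin c t).
Proof.
rewrite /kbin !scA !scE kfallSl kfallSr KV_kfall kq_kfall (kbin_denS t).
set d := _^-1; rewrite [_ * (d * _)]mulrCA ![_ * d]mulrC -!scE -scDr.
congr (_ ** _); rewrite -!scA -mulrDr; congr (_ * _).
rewrite /kq scBr !scE -addrA; congr (_ ** _ + _).
  by rewrite -expfzDr //; congr (_ ^ _); lia.
rewrite -!scN -scD; congr (_ ** _).
rewrite /qbr mulrBr -!expfzDr //.
have -> : t%:Z - c + - t.+1%:Z = - (c + 1) by lia.
have -> : t%:Z - c + t.+1%:Z = t.+1%:Z - (c - t%:Z) by lia.
by rewrite addrA addNr add0r.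
Qed.

Lemma kq_shift (X : A) (e c : int) :
  K * X = v ^ e ** (X * K) -> KV * X = v ^ (- e) ** (X * KV) ->
  kq c * X = X * kq (c + e).
Proof.
move=> KX KVX.
by rewrite /kq mulrBl mulrBr !scA !scl KX KVX !scE -!expfzDr // opprD.
Qed.

Lemma kfall_shift (X : A) (e c : int) t :
  K * X = v ^ e ** (X * K) -> KV * X = v ^ (- e) ** (X * KV) ->
  kfall c t * X = X * kfall (c + e) t.
Proof.
move=> KX KVX; elim: t => [|t IH]; first by rewrite /kfall !big_ord0 mulr1 mul1r.
rewrite !kfallSr -mulrA (kq_shift _ KX KVX) mulrA IH -mulrA.
by congr (_ * (_ * kq _)); lia.
Qed.

Lemma kbin_shift (X : A) (e c : int) t :
  K * X = v ^ e ** (X * K) -> KV * X = v ^ (- e) ** (X * KV) ->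
  kbin c t * X = X * kbin (c + e) t.
Proof. by move=> KX KVX; rewrite /kbin scl (kfall_shift _ _ KX KVX) scA. Qed.

Lemma expr_shift (X Y : A) (e : int) n :
  Y * X = v ^ e ** (X * Y) -> Y * X ^+ n = v ^ (e * n%:Z) ** (X ^+ n * Y).
Proof.
move=> YX; elim: n => [|n IH]; first by rewrite mulr0 expr0z sc1 mulr1 mul1r.
rewrite exprS mulrA YX scl -mulrA IH scA scE -mulrA -expfzDr //.
by congr (v ^ _ ** _); lia.
Qed.

Lemma scm_expr_shift (X Y : A) (e : int) a n :
  Y * X = v ^ e ** (X * Y) ->
  Y * (a ** X ^+ n) = v ^ (e * n%:Z) ** (a ** X ^+ n * Y).
Proof. by move=> YX; rewrite scA (expr_shift _ YX) !scl !scE mulrC. Qed.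

Lemma kbin_prod c t : kbin c t = \prod_(s < t) ((qbr v s.+1)^-1 ** kq (c - s%:Z)).
Proof. by rewrite prod_sc prodfV. Qed.

Lemma kbin_pascal_down c t : kbin c t.+1 =
  v ^ (- t.+1%:Z) ** kbin (c + 1) t.+1 -
  (v ^ (- t.+1%:Z) * v ^ (t%:Z - c)) ** (KV * kbin c t).
Proof.
have vv : v ^ (- t.+1%:Z) * v ^ t.+1%:Z = 1 by rewrite -expfzDr // addNr expr0z.
by rewrite kbin_pascal scDr scE vv sc1 scE addrK.
Qed.

Lemma scm_expr_comm (X Y : A) a m b n :
  X * Y = Y * X -> (a ** X ^+ m) * (b ** Y ^+ n) = (b ** Y ^+ n) * (a ** X ^+ m).
Proof.
move=> XY; rewrite !scl !scA !scE mulrC; congr (_ ** _).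
by apply: commrX; apply/commr_sym/commrX/commr_sym.
Qed.

(** The torus part of the induction step of kac_formula: two neighbouring terms
    recombine into one with the shift moved by one. *)
Lemma kbin_kac (b c : int) t :
  qint v b ** kbin c t.+1 + (qbr v 1)^-1 ** kq (c + 1 + b) * kbin c t =
  qint v (b + t.+1%:Z) ** kbin (c + 1) t.+1.
Proof.
rewrite /kbin !scl !scA !scE kfallSl kfallSr !kq_kfall (kbin_denS t).
set d := _^-1; rewrite [_^-1 * (d * _)]mulrCA ![_ * d]mulrC -!scE -scDr.
congr (_ ** _); rewrite -!scA -mulrDr; congr (_ * _).
rewrite !scE ![_ / qbr v 1]mulrC -!scE -scDr; congr (_ ** _).
rewrite /kq !scBr !scE addrACA -opprD -!scD; congr (_ ** _ - _ ** _).
  rewrite (qbrD v0 b t.+1) [RHS]mulrDl addrC ![_ * qbr _ _ * _]mulrAC -!expfzDr // ![_ * qbr _ _]mulrC.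
  by congr (_ * v ^ _ + _ * v ^ _); lia.
rewrite [b + _]addrC (qbrD v0 t.+1 b) [RHS]mulrDl ![_ * qbr _ _ * _]mulrAC -!expfzDr // ![_ * qbr _ _]mulrC.
by congr (_ * v ^ _ + _ * v ^ _); lia.
Qed.

End Torus.

Lemma sum_shift (f g h : nat -> A) n :
  h 0 = f 0 -> f n.+1 = 0 -> (forall i, (i <= n)%N -> h i.+1 = f i.+1 + g i) ->
  \sum_(i < n.+1) f i + \sum_(i < n.+1) g i = \sum_(i < n.+2) h i.
Proof.
move=> h0 fn hS; rewrite [RHS]big_ord_recl /= h0.
rewrite [in RHS](eq_bigr (fun i : 'I_n.+1 => f i.+1 + g i)); last first.
  by move=> i _; apply: (hS i); rewrite -ltnS; apply: ltn_ord.
rewrite big_split addrA /=; congr (_ + _).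
have <- : \sum_(i < n.+2) f i = \sum_(i < n.+1) f i.
  by rewrite big_ord_recr /= fn addr0.
by rewrite big_ord_recl.
Qed.

Section Kac.
Variables (X Y K KV : A).
Hypothesis KKV : K * KV = KV * K.
Hypothesis KX : K * X = v ^ 2 ** (X * K).
Hypothesis KVX : KV * X = v ^ (- 2) ** (X * KV).
Hypothesis KY : K * Y = v ^ (- 2) ** (Y * K).
Hypothesis KVY : KV * Y = v ^ 2 ** (Y * KV).
Hypothesis XY : X * Y = Y * X + (qbr v 1)^-1 ** (K - KV).

Lemma mulX_divpow n :
  X * divpow Y n.+1 =
  divpow Y n.+1 * X + divpow Y n * ((qbr v 1)^-1 ** kq K KV (- n%:Z)).
Proof.
elim: n => [|n IH].
  by rewrite divpow1 divpow0 mul1r XY /kq oppr0 expr0z !sc1.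
apply: (sc_inj (qint_neq0 br_neq0 n.+1)).
have kq1 c : kbin K KV c 1 = (qbr v 1)^-1 ** kq K KV c.
  by rewrite /kbin /kfall !big_ord1 subr0.
rewrite -scA -divpowSr mulrA IH mulrDl -mulrA XY mulrDr mulrA divpowSr.
rewrite [RHS]scDr -scl -addrA; congr (_ + _).
rewrite -mulrA scl (@kq_shift K KV Y (-2)) // -scA [in LHS]mulrA divpowSr.
rewrite scl -!scA -mulrDr; congr (_ * _).
have := kbin_kac KKV n.+1 (- n%:Z - 2) 0.
rewrite !kq1 kbin0 mulr1 addrC.
have -> : - n%:Z - 2 + 1 + n.+1%:Z = 0 by lia.
have -> : n.+1%:Z + 1%:Z = n.+2 by lia.
have -> : - n%:Z - 2 + 1 = - n.+1%:Z by lia.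
by move <-; rewrite /kq oppr0 expr0z !sc1.
Qed.

Lemma mulX_divpow_sub n t :
  X * divpow_sub Y n t = divpow_sub Y n t * X +
    divpow_sub Y n t.+1 * ((qbr v 1)^-1 ** kq K KV (t%:Z - n%:Z + 1)).
Proof.
rewrite /divpow_sub; case: (ltngtP t n) => [lt_tn | gt_tn | <-].
- rewrite -(subnSK lt_tn) mulX_divpow; congr (_ + _ * (_ ** kq _ _ _)); lia.
- by rewrite mulr0 !mul0r addr0.
- by rewrite subnn divpow0 mulr1 !mul0r addr0 mul1r.
Qed.

(** Induction on m: multiplication by X on the left raises the degree of each
    term, and its commutator with a power of Y feeds the next term; both
    contributions are added by kbin_kac. *)
Lemma kac_formula m n :
  divpow X m * divpow Y n = \sum_(t < m.+1)
    divpow_sub Y n t * kbin K KV (2 * t%:Z - m%:Z - n%:Z) t * divpow X (m - t).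
Proof.
elim: m => [|m IH].
  by rewrite big_ord1 divpow0 mul1r mulr1 kbin0 mulr1 /divpow_sub subn0.
apply: (sc_inj (qint_neq0 br_neq0 m)).
rewrite -scl -divpowSl -mulrA IH mulr_sumr sc_sum.
pose f t := [m.+1 - t]%N ** (divpow_sub Y n t *
  kbin K KV (2 * t%:Z - m%:Z - n%:Z - 2) t * divpow X (m.+1 - t)).
pose g t := divpow_sub Y n t.+1 * ((qbr v 1)^-1 ** kq K KV (t%:Z - n%:Z + 1)) *
  kbin K KV (2 * t%:Z - m%:Z - n%:Z) t * divpow X (m - t).
pose h t := [m.+1] ** (divpow_sub Y n t *
  kbin K KV (2 * t%:Z - m.+1%:Z - n%:Z) t * divpow X (m.+1 - t)).
rewrite -(@sum_shift f g h) /f /g /h.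
- rewrite -big_split; apply: eq_bigr => t _ /=.
  rewrite !mulrA mulX_divpow_sub [(_ + _) * kbin _ _ _ _]mulrDl.
  rewrite [(_ + _) * divpow _ _]mulrDl; congr (_ + _).
  rewrite subSn -1?ltnS // -[RHS]scA -divpowSl -!mulrA; congr (_ * _); rewrite !mulrA.
  congr (_ * _); rewrite (kbin_shift _ _ KX KVX).
  by congr (_ * kbin _ _ _ _); lia.
- by rewrite !kbin0.
- by rewrite subnn qint0 sc0.
move=> t le_tm; rewrite subSS -!mulrA -!scA -mulrDr; congr (_ * _).
rewrite !scA -!scl mulrA -mulrDl; congr (_ * _).
have := kbin_kac KKV (m - t)%N%:Z (2 * t%:Z - m%:Z - n%:Z) t.
have -> : 2 * t%:Z - m%:Z - n%:Z + 1 + (m - t)%N%:Z = t%:Z - n%:Z + 1 by lia.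
have -> : (m - t)%N%:Z + t.+1 = m.+1 by lia.
have -> : 2 * t.+1%:Z - m%:Z - n%:Z - 2 = 2 * t%:Z - m%:Z - n%:Z by lia.
have -> : 2 * t%:Z - m%:Z - n%:Z + 1 = 2 * t.+1%:Z - m.+1%:Z - n%:Z by lia.
by move <-.
Qed.

(** The last term of kac_formula for m = n = t is [K; 0 over t], which is thereby
    expressed through divided powers and binomials of lower degree; this is
    why it is integral. *)
Lemma kbin0_kac t : kbin K KV 0 t = divpow X t * divpow Y t -
  \sum_(s < t) divpow Y (t - s) * kbin K KV (2 * s%:Z - t%:Z - t%:Z) s *
    divpow X (t - s).
Proof.
rewrite kac_formula big_ord_recr /= /divpow_sub leqnn subnn !divpow0 mul1r mulr1.
have -> : 2 * t%:Z - t%:Z - t%:Z = 0 by lia.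
apply/eqP; rewrite eq_sym subr_eq [eqbLHS]addrC; apply/eqP; congr (_ + _).
by apply: eq_bigr => s _; rewrite ltnW.
Qed.

End Kac.

Section Adjoint.
Variable x : A.

Definition qad1 (e : int) (z : A) : A := x * z - v ^ e ** (z * x).

(** The twist grows by 2 at each step since x has weight 2 under its own torus. *)
Fixpoint qad (m : nat) (e : int) (z : A) : A :=
  if m is m'.+1 then qad m' (e + 2) (qad1 e z) else z.

Lemma qad_sc m e c z : qad m e (c ** z) = c ** qad m e z.
Proof.
elim: m => //= m IH in e z *; rewrite -IH; congr qad.
by rewrite /qad1 scA scl scBr !scE mulrC.
Qed.

Lemma qadD m e z w : qad m e (z + w) = qad m e z + qad m e w.
Proof.
elim: m => //= m IH in e z w *; rewrite -IH; congr qad.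
by rewrite /qad1 mulrDr mulrDl scDr opprD addrACA.
Qed.

Lemma qad_0 m e : qad m e 0 = 0.
Proof. by have := qad_sc m e 0 0; rewrite !sc0. Qed.

Lemma qadSr m e z : qad m.+1 e z = qad1 (e + 2 * m%:Z) (qad m e z).
Proof.
elim: m => [|m IH] in e z *; first by rewrite /= addr0.
by rewrite -[qad m.+2 e z]/(qad m.+1 (e + 2) (qad1 e z)) IH /=; congr qad1; lia.
Qed.

Lemma qad_vanish m d e z : qad m e z = 0 -> (m <= d)%N -> qad d e z = 0.
Proof.
move=> z0 /subnK <-; elim: (d - m)%N => // i IH.
by rewrite addSn qadSr IH /qad1 mulr0 mul0r scmE mulr0 subr0.
Qed.

Lemma qad1M e f z w :
  qad1 (e + f) (z * w) = qad1 e z * w + v ^ e ** (z * qad1 f w).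
Proof.
rewrite /qad1 mulrBl mulrBr scBr !mulrA scA scE -expfzDr // scl.
by rewrite -!mulrA addrA subrK.
Qed.

(** As qad1 is a twisted derivation, nilpotency orders add up by the Leibniz
    rule. *)
Lemma qad_mul m a b e f z w : (a + b <= m.+1)%N ->
  qad a e z = 0 -> qad b f w = 0 -> qad m (e + f) (z * w) = 0.
Proof.
elim: m a b e f z w => [|m IH] [|a] [|b] e f z w.
- by move=> _ /= ->; rewrite mul0r.
- by move=> _ /= ->; rewrite mul0r.
- by move=> _ _ /= ->; rewrite mulr0.
- by rewrite addSn addnS.
- by move=> _ z0 _; rewrite (z0 : z = 0) mul0r qad_0.
- by move=> _ z0 _; rewrite (z0 : z = 0) mul0r qad_0.
- by move=> _ _ w0; rewrite (w0 : w = 0) mulr0 qad_0.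
move=> le_m z0 w0; rewrite /= qad1M qadD qad_sc.
have -> : e + f + 2 = e + 2 + f by lia.
rewrite (IH a b.+1) // add0r.
have -> : e + 2 + f = e + (f + 2) by lia.
by rewrite (IH a.+1 b) // ?scmE ?mulr0 //; lia.
Qed.

Lemma qad_expr D e y a :
  qad D.+1 e y = 0 -> qad (a * D).+1 (e * a%:Z) (y ^+ a) = 0.
Proof.
move=> y0; elim: a => [|a IH].
  by rewrite mulr0 /= /qad1 expr0z mulr1 mul1r sc1 subrr.
have -> : e * a.+1%:Z = e + e * a%:Z by lia.
by rewrite exprS; apply: (qad_mul _ y0 IH); rewrite mulSn; lia.
Qed.

(** The iterated bracket divided by the quantum factorial of i, see qad_qadd; this
    form survives at roots of unity. *)
Definition qadd (e : int) (i : nat) (z : A) : A :=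
  \sum_(s < i.+1)
    ((-1) ^+ s * v ^ (s%:Z * (e + i%:Z - 1))) ** (divpow x (i - s) * z * divpow x s).

Lemma qadd0 e z : qadd e 0 z = z.
Proof. by rewrite /qadd big_ord1 mul0r expr0z expr0 mulr1 sc1 divpow0 mul1r mulr1. Qed.

Lemma qad1_qadd e i z :
  qad1 (e + 2 * i%:Z) (qadd e i z) = [i.+1] ** qadd e i.+1 z.
Proof.
pose w a b := divpow x a * z * divpow x b.
pose f s := ((-1) ^+ s * v ^ (s%:Z * (e + i%:Z - 1)) * [i.+1 - s]%N) ** w (i.+1 - s)%N s.
pose g s := ((-1) ^+ s.+1 * v ^ (s%:Z * (e + i%:Z - 1)) *
  v ^ (e + 2 * i%:Z) * [s.+1])
               ** w (i - s)%N s.+1.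
pose h s := ([i.+1] * ((-1) ^+ s * v ^ (s%:Z * (e + i.+1%:Z - 1)))) ** w (i.+1 - s)%N s.
rewrite /qad1 /qadd sc_sum mulr_sumr mulr_suml sc_sum -sumrN.
transitivity (\sum_(s < i.+1) f s + \sum_(s < i.+1) g s).
  congr (_ + _); apply: eq_bigr => s _.
    rewrite scA !mulrA divpowSl scl scl scE /f /w subSn // -ltnS; exact: ltn_ord.
  rewrite scl -mulrA divpowSr scA !scE -scN /g /w; congr (_ ** _).
  rewrite exprS; ring.
rewrite (@sum_shift f g h) /f /g /h.
- by apply: eq_bigr => s _; rewrite scE.
- by rewrite !mul0r expr0z expr0 !mulr1 !mul1r subn0.
- by rewrite subnn qint0 mulr0 sc0.
move=> s le_si; rewrite subSS -scD; congr (_ ** _).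
have -> : i.+1%:Z = (i - s)%N%:Z + s.+1%:Z by lia.
rewrite qintD //; set X := _ ^+ _; set P := qint v _; set Q := qint v _.
have -> : e + ((i - s)%N%:Z + s.+1%:Z) - 1 = e + i%:Z by lia.
have -> : s.+1%:Z * (e + i%:Z - 1) = s.+1%:Z * (e + i%:Z) - s.+1%:Z by ring.
have vE : v ^ (s%:Z * (e + i%:Z - 1)) * v ^ (e + 2 * i%:Z) =
    v ^ (s.+1%:Z * (e + i%:Z)) * v ^ (i - s)%N%:Z.
  by rewrite -!expfzDr //; congr (v ^ _); rewrite -subzn //; ring.
rewrite -[X * v ^ _ * v ^ _]mulrA vE expfzDr //; ring.
Qed.

(** With its mirror image qadd_divpow: a divided power of x moves to the other
    side of z, leaving brackets behind. *)
Lemma divpow_qadd e n z :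
  divpow x n * z = \sum_(i < n.+1)
    v ^ ((e + i%:Z) * (n%:Z - i%:Z)) ** (qadd e i z * divpow x (n - i)).
Proof.
elim: n => [|n IH].
  by rewrite big_ord1 qadd0 subr0 mulr0 expr0z sc1 divpow0 mulr1 mul1r.
apply: (sc_inj (qint_neq0 br_neq0 n)); rewrite -scl -divpowSl -mulrA IH.
rewrite mulr_sumr sc_sum.
pose f i := (v ^ ((e + i%:Z) * (n%:Z - i%:Z)) * v ^ (e + 2 * i%:Z) * [n.+1 - i]%N)
  ** (qadd e i z * divpow x (n.+1 - i)).
pose g i := (v ^ ((e + i%:Z) * (n%:Z - i%:Z)) * [i.+1])
  ** (qadd e i.+1 z * divpow x (n - i)).
pose h i := ([n.+1] * v ^ ((e + i%:Z) * (n.+1%:Z - i%:Z)))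
  ** (qadd e i z * divpow x (n.+1 - i)).
have xqadd i : x * qadd e i z = v ^ (e + 2 * i%:Z) ** (qadd e i z * x) +
    [i.+1] ** qadd e i.+1 z.
  by rewrite -qad1_qadd /qad1 addrC subrK.
transitivity (\sum_(i < n.+1) f i + \sum_(i < n.+1) g i).
  rewrite -big_split; apply: eq_bigr => i _ /=.
  rewrite scA mulrA xqadd [(_ + _) * divpow _ _]mulrDl !scl scDr !scE.
  rewrite -mulrA divpowSl scA scE /f.
  by rewrite subSn // -ltnS ltn_ord.
rewrite (@sum_shift f g h) /f /g /h.
- by apply: eq_bigr => s _; rewrite scE.
- rewrite -[X in _ = X * _ ** _]expfzDr // subn0 mulrC.
  by congr (v ^ _ * _ ** _); rewrite intS; ring.
- by rewrite subnn qint0 mulr0 sc0.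
move=> i le_in; rewrite subSS -scD; congr (_ ** _).
have -> : n.+1%:Z = i.+1%:Z + (n - i)%N%:Z by lia.
rewrite qintD //.
have -> : (e + i.+1%:Z) * (i.+1%:Z + (n - i)%N%:Z - i.+1%:Z) =
  (e + i%:Z + 1) * (n - i)%N by lia.
have -> : n%:Z - i.+1%:Z = (n - i)%N%:Z - 1 by lia.
have -> : n%:Z - i%:Z = (n - i)%N%:Z by lia.
have vE : v ^ ((e + i.+1%:Z) * ((n - i)%N%:Z - 1)) * v ^ (e + 2 * i.+1%:Z) =
  v ^ ((e + i%:Z + 1) * (n - i)%N) * v ^ i.+1%:Z.
  by rewrite -!expfzDr //; congr (v ^ _); rewrite intS; ring.
rewrite vE.
have -> : (e + i%:Z + 1) * (n - i)%N%:Z = (e + i%:Z) * (n - i)%N%:Z + (n - i)%N%:Z.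
  by ring.
rewrite expfzDr // -invr_expz; field; exact: expfz_neq0.
Qed.

Lemma qadd_divpow e n z :
  z * divpow x n = \sum_(i < n.+1)
    ((-1) ^+ i * v ^ (- (n%:Z * e) - i%:Z * (n%:Z - 1))) **
      (divpow x (n - i) * qadd e i z).
Proof.
elim: n => [|n IH].
  rewrite big_ord1 qadd0 expr0 mul1r /= [X in v ^ X](_ : _ = 0); last by ring.
  by rewrite expr0z sc1 divpow0 mulr1 mul1r.
apply: (sc_inj (qint_neq0 br_neq0 n)); rewrite -scA -divpowSr mulrA IH.
rewrite mulr_suml sc_sum.
pose c i := (-1) ^+ i * v ^ (- (n%:Z * e) - i%:Z * (n%:Z - 1)).
pose f i := (c i * v ^ (- (e + 2 * i%:Z)) * [n.+1 - i]%N)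
  ** (divpow x (n.+1 - i) * qadd e i z).
pose g i := (- c i * v ^ (- (e + 2 * i%:Z)) * [i.+1])
  ** (divpow x (n - i) * qadd e i.+1 z).
pose h i := ([n.+1] * ((-1) ^+ i * v ^ (- (n.+1%:Z * e) - i%:Z * (n.+1%:Z - 1))))
  ** (divpow x (n.+1 - i) * qadd e i z).
have qaddx i : qadd e i z * x = v ^ (- (e + 2 * i%:Z)) ** (x * qadd e i z) -
    (v ^ (- (e + 2 * i%:Z)) * [i.+1]) ** qadd e i.+1 z.
  rewrite -scE -qad1_qadd /qad1 scBr !scE -expfzDr // addNr expr0z sc1.
  by rewrite opprB addrC subrK.
transitivity (\sum_(i < n.+1) f i + \sum_(i < n.+1) g i).
  rewrite -big_split; apply: eq_bigr => i _ /=.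
  rewrite scl -mulrA qaddx mulrBr !scA scBr !scE mulrA divpowSr scl scE -scN.
  rewrite -/(c i) /f /g subSn -1?ltnS ?ltn_ord //.
  by rewrite !mulNr !mulrA.
rewrite (@sum_shift f g h) /f /g /h.
- by apply: eq_bigr => s _; rewrite scE.
- rewrite /c !expr0 !mul1r subn0 mulrC -[X in _ = X * _ ** _]expfzDr //.
  by congr (v ^ _ * _ ** _); rewrite intS; ring.
- by rewrite subnn qint0 mulr0 sc0.
move=> i le_in; rewrite subSS -scD; congr (_ ** _).
rewrite /c; set P := v ^ (- (n.+1%:Z * e) - i.+1%:Z * (n.+1%:Z - 1)).
have E1 : v ^ (- (n%:Z * e) - i.+1%:Z * (n%:Z - 1)) * v ^ (- (e + 2 * i.+1%:Z)) =
    P * v ^ (- i.+1%:Z).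
  by rewrite -!expfzDr //; congr (v ^ _); rewrite (intS n); ring.
have E2 : v ^ (- (n%:Z * e) - i%:Z * (n%:Z - 1)) * v ^ (- (e + 2 * i%:Z)) =
    P * v ^ (n - i)%N%:Z.
  by rewrite -!expfzDr // -subzn //; congr (v ^ _); rewrite (intS n) (intS i); ring.
have -> : n.+1%:Z = (n - i)%N%:Z + i.+1%:Z by lia.
rewrite qintD // mulNr -[_ * _ * v ^ _ in RHS]mulrA E1.
rewrite -[_ * _ * v ^ _ in RHS]mulrA E2 exprS; ring.
Qed.

Lemma qad_qadd e i z : qad i e z = qfac v i ** qadd e i z.
Proof.
elim: i => [|i IH]; first by rewrite qadd0 qfac0 sc1.
rewrite qadSr IH /qad1 scA scl scE mulrC -scE -scBr -/(qad1 _ _) qad1_qadd scE.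
by rewrite -qfacS.
Qed.

(** By the Leibniz rule: if the bracket of order D + 1 kills y, the one of order
    a D + 1 kills y^a. *)
Lemma qadd_expr_eq0 D e y a c i :
  qadd e D.+1 y = 0 -> (a * D < i)%N -> qadd (e * a%:Z) i (c ** y ^+ a) = 0.
Proof.
move=> y0 lt_i; apply: (sc_inj (qfac_neq0 br_neq0 i)).
rewrite -qad_qadd qad_sc (@qad_vanish (a * D).+1) ?scmE ?mulr0 //.
by apply: qad_expr; rewrite qad_qadd y0 scmE mulr0.
Qed.

(** The bound t <= a D is what matters: it does not depend on n, so that moving a
    large power of x past a fixed power of y creates brackets of bounded order
    only. *)
Lemma divpow_commute_left D e y a c n (z := c ** y ^+ a) : qadd e D.+1 y = 0 ->
  divpow x n * z = \sum_(t < n.+1 | (t <= a * D)%N)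
    v ^ ((e * a%:Z + t%:Z) * (n%:Z - t%:Z)) **
      (qadd (e * a%:Z) t z * divpow x (n - t)).
Proof.
move=> y0; rewrite (divpow_qadd (e * a%:Z)) [RHS]big_mkcond.
apply: eq_bigr => t _ /=; case: leqP => // lt_t.
by rewrite (qadd_expr_eq0 _ y0) // mul0r scmE mulr0.
Qed.

Lemma divpow_commute_right D e y a c n (z := c ** y ^+ a) : qadd e D.+1 y = 0 ->
  z * divpow x n = \sum_(t < n.+1 | (t <= a * D)%N)
    ((-1) ^+ t * v ^ (- (n%:Z * (e * a%:Z)) - t%:Z * (n%:Z - 1))) **
      (divpow x (n - t) * qadd (e * a%:Z) t z).
Proof.
move=> y0; rewrite (qadd_divpow (e * a%:Z)) [RHS]big_mkcond.
apply: eq_bigr => t _ /=; case: leqP => // lt_t.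
by rewrite (qadd_expr_eq0 _ y0) // mulr0 scmE mulr0.
Qed.

(** For the exponent m = 1 - e the twist is trivial, and the quantum Serre sum is
    the bracket of order m up to a unit. *)
Lemma qadd_serre e m y : e + m%:Z - 1 = 0 ->
  \sum_(s < m.+1) ((-1) ^+ s * qbin v m s) ** (x ^+ (m - s) * y * x ^+ s) = 0 ->
  qadd e m y = 0.
Proof.
move=> em h; apply: (sc_inj (qfac_neq0 br_neq0 m)); rewrite scmE [in RHS]scmE mulr0 -h -scmE.
rewrite /qadd sc_sum; apply: eq_bigr => s _.
rewrite em mulr0 expr0z mulr1 !divpowE !scl !scA !scE.
congr (_ ** _); have le_sm : (s <= m)%N by rewrite -ltnS ltn_ord.
have := qbin_qfac v0 br_neq0 s (m - s); rewrite subnKC // => ->.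
by field; rewrite !qfac_neq0.
Qed.

End Adjoint.
End QAlgebra.

(** * Specialization of Laurent polynomials *)
Lemma q_neq0 : q != 0.
Proof. by rewrite /q tofrac_eq0 polyX_eq0. Qed.

Lemma q_expz_neq1 (m : int) : 0 < m -> q ^ m != 1.
Proof.
case: m => // -[//|n] _; rewrite -exprnP /q -tofracXn -tofrac1 tofrac_eq.
by apply/eqP => /(congr1 (fun p : {poly rat} => size p)); rewrite size_polyXn size_poly1.
Qed.

Lemma qbr_q_neq0 (d : int) : 0 < d -> forall n : nat, qbr (q ^ d) n.+1 != 0.
Proof.
move=> d0 n; rewrite /qbr !exprz_exp subr_eq0.
have v0 := q_neq0; apply/negP => /eqP h.
have h2 : q ^ (d * n.+1 + d * n.+1) = 1.
  by rewrite expfzDr // {2}h -expfzDr // mulrN subrr expr0z.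
have : q ^ (d * n.+1 + d * n.+1) != 1 by apply: q_expz_neq1; lia.
by rewrite h2 eqxx.
Qed.

Lemma qdiffE d m : qdiff d m = qbr (q ^ d) m.
Proof. by rewrite /qdiff /qbr !exprz_exp mulrN. Qed.

Lemma qfactE d m : qfact d m = qfac (q ^ d) m.
Proof.
rewrite /qfact /qfac big_add1 big_mkord; apply: eq_bigr => s _.
by rewrite /qnum /qint !qdiffE.
Qed.

Lemma qbinomE d m t : qbinom d m t = qbin (q ^ d) m t.
Proof.
rewrite /qbinom /qbin big_add1 big_mkord; apply: eq_bigr => s _.
by rewrite !qdiffE; congr (qbr _ _ / _); rewrite /=; lia.
Qed.

Section LaurentEval.
Variables (F : fieldType) (x : F).
Hypothesis x0 : x != 0.

Local Notation ev P := (map_poly intr P).[x].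

Lemma evD (P Q : {poly int}) : ev (P + Q) = ev P + ev Q.
Proof. by rewrite rmorphD hornerD. Qed.
Lemma evM (P Q : {poly int}) : ev (P * Q) = ev P * ev Q.
Proof. by rewrite rmorphM hornerM. Qed.
Lemma evXn n : ev 'X^n = x ^+ n.
Proof. by rewrite map_polyXn hornerXn. Qed.

Lemma laurentD m P m' P' :
  laurent x m P + laurent x m' P' = laurent x (m + m') ('X^m' * P + 'X^m * P').
Proof.
rewrite /laurent evD !evM !evXn exprD.
by field; rewrite !expf_neq0.
Qed.

Lemma laurentM m P m' P' :
  laurent x m P * laurent x m' P' = laurent x (m + m') (P * P').
Proof. by rewrite /laurent evM exprD invfM mulrACA. Qed.

Lemma laurentN m P : - laurent x m P = laurent x m (- P).
Proof. by rewrite /laurent rmorphN hornerN mulrN. Qed.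

Lemma laurent_expz (m : int) : exists m' P, forall (F' : fieldType) (y : F'),
  y ^ m = laurent y m' P.
Proof.
case: m => m.
  exists 0%N, 'X^m => F' y.
  by rewrite /laurent expr0 invr1 mul1r map_polyXn hornerXn.
exists m.+1, 1 => F' y.
by rewrite /laurent rmorph1 hornerC mulr1 NegzE.
Qed.

Lemma laurent_int (c : int) : laurent x 0 c%:P = c%:~R.
Proof. by rewrite /laurent expr0 invr1 mul1r map_polyC hornerC. Qed.

End LaurentEval.

Lemma horner_q (P : {poly int}) :
  (map_poly intr P).[q] = FracField.tofrac (map_poly intr P).
Proof.
elim/poly_ind: P => [|P c IH]; first by rewrite !rmorph0 horner0.
rewrite evD evM -{1}['X]expr1 evXn expr1 map_polyC hornerC IH.
rewrite [X in _ = FracField.tofrac X](_ : _ = map_poly intr P * 'X + c%:~R); last first.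
  by rewrite rmorphD /= rmorphM /= map_polyX map_polyC /= rmorph_int.
by rewrite tofracD tofracM rmorph_int.
Qed.

Section Specialization.
Variables (k : fieldType) (zeta : k).
Hypothesis zeta0 : zeta != 0.

Local Notation spec := (specializes zeta).

(** If q^-m P = q^-m' P' then X^m' P = X^m P' as integral polynomials, an
    equality that can be evaluated at zeta. *)
Lemma spec_fun a c c' : spec a c -> spec a c' -> c = c'.
Proof.
move=> [m [P [-> ->]]] [m' [P' [eqa ->]]].
have : 'X^m' * P = 'X^m * P'.
  apply: (@map_inj_poly _ _ (intr : int -> rat)) => //; first exact: intr_inj.
  apply/eqP; rewrite -tofrac_eq -!horner_q !evM !evXn.
  move: eqa; rewrite /laurent.
  set x := _.[q]; set y := _.[q] => eqa.
  have z0 n : q ^+ n != 0 by rewrite expf_neq0 ?q_neq0.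
  apply/eqP/(mulfI (invr_neq0 (z0 m)))/(mulfI (invr_neq0 (z0 m'))).
  by rewrite mulKf // mulrCA mulKf // mulrCA mulKf // [RHS]mulrC mulrA mulrC.
move=> /(congr1 (fun R => (map_poly intr R).[zeta])).
rewrite !evM !evXn /laurent => h.
have z0 n : zeta ^+ n != 0 by rewrite expf_neq0.
apply: (mulfI (z0 m)); apply: (mulfI (z0 m')).
by rewrite mulVKf // mulrCA mulVKf // mulrC h mulrC.
Qed.

Lemma specD a b c d : spec a c -> spec b d -> spec (a + b) (c + d).
Proof.
move=> [m [P [-> ->]]] [m' [P' [-> ->]]].
exists (m + m')%N, ('X^m' * P + 'X^m * P').
by rewrite !laurentD ?q_neq0.
Qed.

Lemma specM a b c d : spec a c -> spec b d -> spec (a * b) (c * d).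
Proof.
move=> [m [P [-> ->]]] [m' [P' [-> ->]]].
by exists (m + m')%N, (P * P'); rewrite !laurentM.
Qed.

Lemma specN a c : spec a c -> spec (- a) (- c).
Proof. by move=> [m [P [-> ->]]]; exists m, (- P); rewrite !laurentN. Qed.

Lemma spec_expz m : spec (q ^ m) (zeta ^ m).
Proof. by have [m' [P h]] := laurent_expz m; exists m', P; rewrite !h. Qed.

Lemma spec_int (c : int) : spec c%:~R c%:~R.
Proof. by exists 0%N, c%:P; rewrite !laurent_int. Qed.

Lemma spec0 : spec 0 0. Proof. exact: (spec_int 0). Qed.
Lemma spec1 : spec 1 1. Proof. exact: (spec_int 1). Qed.
Lemma spec_sign s : spec ((-1) ^+ s) ((-1) ^+ s).
Proof.
elim: s => [|s IH]; first exact: spec1.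
by rewrite !exprS; apply: specM => //; apply/specN/spec1.
Qed.

Lemma spec_in_A a c : spec a c -> in_A a.
Proof. by move=> [m [P [-> _]]]; exists m, P. Qed.

Lemma in_A_spec a : in_A a -> exists c, spec a c.
Proof. by move=> [m [P ->]]; exists (laurent zeta m P), m, P. Qed.

End Specialization.

(** * Gaussian binomials at roots of unity *)
Section Gauss.
Variables (F : fieldType) (v : F).
Hypothesis v0 : v != 0.

(** Defined by the q-Pascal rule, hence meaningful at roots of unity, where the
    quotients of quantum integers are not. *)
Fixpoint gauss (n t : nat) : F :=
  match n, t with
  | _, 0 => 1
  | 0, _.+1 => 0
  | n'.+1, t'.+1 => v ^ (- t%:Z) * gauss n' t + v ^ (n'%:Z - t'%:Z) * gauss n' t'
  end.

Lemma gaussn0 n : gauss n 0 = 1. Proof. by case: n. Qed.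

Lemma gauss1 n : (v - v^-1) * gauss n 1 = v ^+ n - v ^- n.
Proof.
elim: n => [|n IH]; first by rewrite expr0 invr1 subrr mulr0.
rewrite /= mulrDr mulrCA IH gaussn0 subr0 exprS mulr1.
have -> : v ^ (- (1 : int)) = v^-1 by rewrite -invr_expz.
rewrite -exprnP.
by field; rewrite expf_neq0.
Qed.

(** The q-binomial theorem, for the balanced normalization. *)
Lemma gauss_poly n t :
  (\prod_(j < n) (1 + (v ^+ 2) ^+ j *: 'X))`_t = v ^ (t%:Z * (n%:Z - 1)) * gauss n t.
Proof.
elim: n t => [|n IH] t.
  rewrite big_ord0 coef1; case: t => [|t] /=; last by rewrite mulr0.
  by rewrite mul0r expr0z mulr1.
rewrite big_ord_recr /= mulrDr mulr1 coefD IH.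
rewrite -scalerAr coefZ coefMX; case: t => [|t] /=.
  by rewrite mulr0 addr0 !mul0r !expr0z gaussn0.
rewrite IH [RHS]mulrDr !mulrA -exprM [_ ^+ (2 * n)]exprnP -!expfzDr //.
by congr (v ^ _ * _ + v ^ _ * _); rewrite ?(intS n) ?(intS t) ?PoszM; ring.
Qed.

Hypothesis br_neq0 : forall n : nat, qbr v n.+1 != 0.

Lemma qbin_pascal (m : int) t :
  qbin v (m + 1) t.+1 =
  v ^ (- t.+1%:Z) * qbin v m t.+1 + v ^ (m - t%:Z) * qbin v m t.
Proof.
rewrite /qbin !prodf_div [\prod_(i < t.+1) qbr v (m + 1 - i%:Z)]big_ord_recl.
rewrite [\prod_(i < t.+1) qbr v (m - i%:Z)]big_ord_recr /= !subr0.
have -> : \prod_(i < t) qbr v (m + 1 - (bump 0 i)%:Z) = \prod_(i < t) qbr v (m - i%:Z).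
  by apply: eq_bigr => i _; congr qbr; rewrite /bump /=; lia.
have -> : m + 1 = (m - t%:Z) + t.+1%:Z by lia.
rewrite [X in X * _ / _]qbrD // big_ord_recr /=; field.
by apply/andP; split; rewrite ?br_neq0 // prodf_seq_neq0; apply/allP => i _ /=.
Qed.

Lemma qbin_pascal_bar (m : int) t :
  qbin v (m + 1) t.+1 = v ^ t.+1%:Z * qbin v m t.+1 + v ^ (t%:Z - m) * qbin v m t.
Proof.
rewrite /qbin !prodf_div [\prod_(i < t.+1) qbr v (m + 1 - i%:Z)]big_ord_recl.
rewrite [\prod_(i < t.+1) qbr v (m - i%:Z)]big_ord_recr /= !subr0.
have -> : \prod_(i < t) qbr v (m + 1 - (bump 0 i)%:Z) = \prod_(i < t) qbr v (m - i%:Z).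
  by apply: eq_bigr => i _; congr qbr; rewrite /bump /=; lia.
have -> : m + 1 = t.+1%:Z + (m - t%:Z) by lia.
rewrite [X in X * _ / _]qbrD // opprB big_ord_recr /=; field.
by apply/andP; split; rewrite ?br_neq0 // prodf_seq_neq0; apply/allP => i _ /=.
Qed.

Lemma qbin_gauss (n t : nat) : qbin v n t = gauss n t.
Proof.
elim: n t => [|n IH] [|t]; rewrite ?gaussn0 /=.
- by rewrite /qbin big_ord0.
- by rewrite qbin_small.
- by rewrite /qbin big_ord0.
by rewrite intS addrC qbin_pascal !IH.
Qed.
End Gauss.

Section RootOfUnity.
Variables (k : fieldType) (l : nat) (v : k).
Hypotheses (odd_l : odd l) (prim_v : l.-primitive_root v).

Let v0 : v != 0.
Proof. by rewrite (prim_root_eq0 prim_v) -lt0n (prim_order_gt0 prim_v). Qed.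

Let x := v ^+ 2.
Let prim_x : l.-primitive_root x.
Proof. by rewrite /x prim_root_exp_coprime // coprime2n. Qed.

Lemma gauss1_neq0 n : (0 < n < l)%N -> gauss v n 1 != 0.
Proof.
move=> /andP[n0 nl]; apply/eqP => g0; have := gauss1 v0 n.
rewrite g0 mulr0 => /esym/eqP; rewrite subr_eq0 => /eqP h.
have : x ^+ n = 1 by rewrite /x exprAC expr2 {2}h mulfV // expf_neq0.
by move/eqP; rewrite -(prim_order_dvd prim_x) => /(dvdn_leq n0); rewrite leqNgt nl.
Qed.

(** The elements - x^-j are the roots of 1 + X^l because l is odd. *)
Lemma prod_root_unity : \prod_(j < l) (1 + x ^+ j *: 'X) = 1 + 'X^l :> {poly k}.
Proof.
have l0 := prim_order_gt0 prim_x.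
have x0 : x != 0 by rewrite expf_neq0.
have xl : x ^+ l = 1 := prim_expr_order prim_x.
have prim_y : l.-primitive_root x^-1.
  have -> : x^-1 = x ^+ l.-1.
    by apply: (mulfI x0); rewrite mulfV // -exprS prednK.
  by rewrite prim_root_exp_coprime // coprimePn.
have := congr1 (fun P : {poly k} => P \Po (- 'X)) (factor_Xn_sub_1 prim_y).
rewrite rmorphB /= comp_Xn_poly exprNn -signr_odd odd_l expr1 mulN1r.
rewrite (big_morph (fun P : {poly k} => P \Po (- 'X)) (id1 := 1) (op1 := *%R));
  [|exact: rmorphM|exact: rmorph1].
move=> h.
have -> : 1 + 'X^l = - (- 'X^l - (1 \Po - 'X)) :> {poly k}.
  by rewrite rmorph1 opprB opprK addrC.
rewrite -h big_mkord.
transitivity (\prod_(j < l) (- (x ^+ j)%:P * (- 'X - (x^-1 ^+ j)%:P))).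
  apply: eq_bigr => j _; rewrite mulrBr mulNr mulrN opprK mul_polyC addrC.
  by rewrite mulNr opprK -rmorphM -exprMn mulfV // expr1n.
rewrite big_split /= prodrN card_ord -signr_odd odd_l expr1 mulN1r mulNr.
congr (- _); rewrite -[RHS]mul1r; congr (_ * _).
  rewrite -rmorph_prod -[RHS]polyC1; congr (_%:P).
  rewrite prodrXr -(big_mkord xpredT id) bin2_sum bin2odd //.
  by rewrite exprM xl expr1n.
by apply: eq_bigr => j _; rewrite rmorphB /= comp_polyX comp_polyC.
Qed.

Let P n : {poly k} := \prod_(j < n) (1 + x ^+ j *: 'X).

Let PD m n : (l %| m)%N -> P (m + n) = P m * P n.
Proof.
move=> /dvdnP[c ->]; rewrite /P big_split_ord /=; congr (_ * _).
by apply: eq_bigr => j _; rewrite exprD mulnC exprM (prim_expr_order prim_x) expr1n mul1r.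
Qed.

Let P_muln m c : (l %| m)%N -> P (c * m) = P m ^+ c.
Proof.
move=> lm; elim: c => [|c IH]; first by rewrite /P big_ord0 expr0.
by rewrite mulSn PD // IH exprS.
Qed.

Let P_expp p s : p \in [pchar k] -> P (p ^ s * l) = 1 + 'X^(p ^ s * l).
Proof.
move=> pk; elim: s => [|s IH]; first by rewrite mul1n /P prod_root_unity.
rewrite expnS -mulnA P_muln ?dvdn_mull // IH.
rewrite -(pFrobenius_autE (p := p)) ?pchar_poly // => pkx.
by rewrite rmorphD rmorph1 /= pFrobenius_autE -exprM mulnC.
Qed.

Let size_P n : (size (P n) <= n.+1)%N.
Proof.
elim: n => [|n IH]; first by rewrite /P big_ord0 size_poly1.
rewrite /P big_ord_recr /= -/(P n); apply: leq_trans (size_polyMleq _ _) _.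
have : (size (1 + x ^+ n *: 'X : {poly k})%R <= 2)%N.
  rewrite addrC (leq_trans (size_polyD _ _)) // geq_max size_poly1 andbT.
  by rewrite (leq_trans (size_scale_leq _ _)) ?size_polyX.
lia.
Qed.

(** Write n = c a + b with b < a. The polynomial P n, whose coefficients are the
    Gaussian binomials up to units, equals (1 + X^a)^c P b by the Frobenius
    morphism, with P b of degree less than a; the coefficient of X^a is thus c,
    and 0 < c < p. *)
Lemma gauss_lucas p s n (a := (p ^ s * l)%N) :
  p \in [pchar k] -> (a <= n < p * a)%N -> gauss v n a != 0.
Proof.
move=> pk /andP[le_an lt_n].
have l0 : (0 < l)%N := prim_order_gt0 prim_x.
have p0 : (0 < p)%N := prime_gt0 (pcharf_prime pk).
have a0 : (0 < a)%N by rewrite muln_gt0 expn_gt0 p0.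
suff : (P n)`_a != 0 by rewrite gauss_poly // mulf_eq0 => /norP[].
rewrite (divn_eq n a); set c := (n %/ a)%N; set b := (n %% a)%N.
have c0 : (0 < c)%N by rewrite divn_gt0.
have cp : (c < p)%N by rewrite ltn_divLR.
have lt_b : (b < a)%N by rewrite ltn_mod.
have la : (l %| a)%N by rewrite dvdn_mull.
rewrite PD ?dvdn_mull // P_muln // P_expp //.
have [r ->] : exists r : {poly k},
    (1 + 'X^a) ^+ c = 1 + c%:R%:P * 'X^a + 'X^(a.+1) * r.
  elim: c {c0 cp} => [|c [r IH]].
    by exists 0; rewrite expr0 mul0r mulr0 !addr0.
  exists (r + r * 'X^a + c%:R%:P * 'X^(a.-1)).
  have E : 'X^(a.+1) * 'X^(a.-1) = 'X^a * 'X^a :> {poly k}.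
    by rewrite -!exprD; congr 'X^_; lia.
  rewrite exprSr IH -natr1 rmorphD rmorph1.
  rewrite [in RHS]mulrDr [_ * (_ * 'X^(a.-1))]mulrCA E; ring.
rewrite !mulrDl !coefD mul1r -mulrA coefCM coefXnM ltnn subnn -mulrA coefXnM ltnSn addr0.
rewrite nth_default ?add0r; last by rewrite (leq_trans (size_P b)).
rewrite mulf_neq0 //; last first.
  by have := gauss_poly v0 b 0; rewrite -/x -/(P b) => ->; rewrite gaussn0 mulr1 mul0r expr0z oner_neq0.
by rewrite -(dvdn_pcharf pk); apply/negP => /(dvdn_leq c0); rewrite leqNgt cp.
Qed.

End RootOfUnity.

(** * Relations in the quantized enveloping algebra *)
Section FreeAlgebra.
Variables (F : fieldType) (X : choiceType).

Lemma free_scalar_is_zmod : zmod_morphism (@free_scalar F X).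
Proof. by move=> a b; rewrite /free_scalar monalgUB. Qed.

Lemma free_scalar_is_monoid : monoid_morphism (@free_scalar F X).
Proof. by split=> [|a b]; [exact: mpolyC1E | exact: mpolyCM]. Qed.

HB.instance Definition _ := GRing.isZmodMorphism.Build F (free_alg F X)
  (@free_scalar F X) free_scalar_is_zmod.
HB.instance Definition _ := GRing.isMonoidMorphism.Build F (free_alg F X)
  (@free_scalar F X) free_scalar_is_monoid.

Lemma free_scalarC (c : F) (g : free_alg F X) :
  g * free_scalar X c = free_scalar X c * g.
Proof.
rewrite /free_scalar (monalgE g) mulr_sumr mulr_suml; apply: eq_bigr => m _.
by rewrite !malgM_def !fgmulUU mulrC mul1m mulm1.
Qed.

Lemma free_alg_ind (P : free_alg F X -> Prop) :
  (forall c, P (free_scalar X c)) -> (forall x, P (free_gen F x)) ->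
  (forall g h, P g -> P h -> P (g + h)) -> (forall g h, P g -> P h -> P (g * h)) ->
  forall g, P g.
Proof.
move=> Pc Px PD PM g; rewrite (monalgE g); apply: big_ind => //.
  by have := Pc 0; rewrite rmorph0.
move=> m _.
have -> : mkmalgU m g@_m = free_scalar X g@_m * (mkmalgU m 1 : free_alg F X).
  by rewrite malgM_def fgmulUU mulr1 mul1m.
apply: (PM) => //; case: m => s; elim: s => [|x s IH].
  have := Pc 1; rewrite /free_scalar; congr (P (mkmalgU _ _)).
  by rewrite fmoneE.
have -> : mkmalgU (FMonom (x :: s)) 1 = free_gen F x * (mkmalgU (FMonom s) 1 : free_alg F X).
  rewrite malgM_def fgmulUU mulr1; congr mkmalgU.
  by apply/eqP; rewrite fmP fmM fmuE.
exact: PM.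
Qed.

End FreeAlgebra.

Section UqRelations.
Variables (n : nat) (B : 'M[int]_n).

Local Notation U := (Uq B).
Local Notation d i := (half_norm B i).
Local Notation c i j := (cartan B i j).
Local Notation vq i := (q ^ d i).

Lemma Uq_scalar_is_zmod : zmod_morphism (@Uq_scalar n B).
Proof. by move=> a b; rewrite /Uq_scalar /Uq_proj /fc !rmorphB. Qed.

Lemma Uq_scalar_is_monoid : monoid_morphism (@Uq_scalar n B).
Proof.
split=> [|a b].
  exact: (rmorph1 (quot_proj (@Uq_rel n B) \o @free_scalar Qq _)).
exact: (rmorphM (quot_proj (@Uq_rel n B) \o @free_scalar Qq _)).
Qed.

HB.instance Definition _ := GRing.isZmodMorphism.Build Qq U
  (@Uq_scalar n B) Uq_scalar_is_zmod.
HB.instance Definition _ := GRing.isMonoidMorphism.Build Qq U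
  (@Uq_scalar n B) Uq_scalar_is_monoid.

Lemma Uq_projM x y : Uq_proj B (x * y) = Uq_proj B x * Uq_proj B y.
Proof. exact: rmorphM. Qed.

Lemma Uq_projD x y : Uq_proj B (x + y) = Uq_proj B x + Uq_proj B y.
Proof. exact: raddfD. Qed.
Lemma Uq_projB x y : Uq_proj B (x - y) = Uq_proj B x - Uq_proj B y.
Proof. exact: raddfB. Qed.

Lemma Uq_projX x m : Uq_proj B (x ^+ m) = Uq_proj B x ^+ m.
Proof. exact: rmorphXn. Qed.
Lemma Uq_proj_sum m (f : 'I_m -> FreeUq n) :
  Uq_proj B (\sum_(s < m) f s) = \sum_(s < m) Uq_proj B (f s).
Proof. exact: raddf_sum. Qed.

Lemma Uq_scalarC a (x : U) : x * Uq_scalar B a = Uq_scalar B a * x.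
Proof.
rewrite -(quot_reprK x) -/(Uq_proj B _) /Uq_scalar -!Uq_projM.
by rewrite /fc free_scalarC.
Qed.

Lemma Uq_proj_eq x y : ideal_gen (@Uq_rel n B) (x - y) -> Uq_proj B x = Uq_proj B y.
Proof. by move=> h; apply/eqP/quot_projP. Qed.

Lemma Uq_proj1 : Uq_proj B 1 = 1.
Proof. exact: rmorph1. Qed.

Lemma Uq_rel_eq0 x : Uq_rel B x -> Uq_proj B x = 0.
Proof.
move=> h; apply: etrans (@Uq_proj_eq x 0 _) (rmorph0 _).
by rewrite subr0; apply: ideal_gen_base.
Qed.

Local Opaque fE fF fK fKV fc Uq_proj.

Lemma Uq_rel0 x y : Uq_rel B (x - y) -> Uq_proj B x = Uq_proj B y.
Proof. by move=> h; apply: Uq_proj_eq; apply: ideal_gen_base. Qed.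

Local Notation sc := (@Uq_scalar n B).
Local Notation "a ** x" := (scm sc a x) (at level 40, left associativity).

Definition gE i : U := Uq_proj B (fE i).
Definition gF i : U := Uq_proj B (fF i).

Lemma Uq_projM3 x y z :
  Uq_proj B (x * y * z) = Uq_proj B x * Uq_proj B y * Uq_proj B z.
Proof. exact: etrans (Uq_projM _ _) (congr1 (fun u => u * _) (Uq_projM _ _)). Qed.

Lemma qKKV i : qK B i * qKV B i = 1.
Proof. exact: etrans (esym (Uq_projM _ _)) (etrans (Uq_rel0 (rel_KKV B i)) Uq_proj1). Qed.
Lemma qKVK i : qKV B i * qK B i = 1.
Proof. exact: etrans (esym (Uq_projM _ _)) (etrans (Uq_rel0 (rel_KVK B i)) Uq_proj1). Qed.
Lemma qKK i : qK B i * qKV B i = qKV B i * qK B i.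
Proof. exact: etrans (qKKV i) (esym (qKVK i)). Qed.

Lemma conj_rel i (X : U) (m : int) :
  qK B i * X * qKV B i = q ^ m ** X ->
  qK B i * X = q ^ m ** (X * qK B i) /\ qKV B i * X = q ^ (- m) ** (X * qKV B i).
Proof.
move=> h.
by rewrite -invr_expz; apply: conj_shift;
  [exact: Uq_scalarC | exact: expfz_neq0 q_neq0 | exact: qKKV | exact: qKVK |].
Qed.

Hypothesis B_factor : forall i j, B i j = d i * c i j.

Lemma qKE i j : qK B i * gE j = vq i ^ c i j ** (gE j * qK B i) /\
  qKV B i * gE j = vq i ^ (- c i j) ** (gE j * qKV B i).
Proof.
rewrite !exprz_exp mulrN -B_factor; apply: conj_rel; rewrite scmE.
exact: etrans (esym (Uq_projM3 _ _ _)) (etrans (Uq_rel0 (rel_KE B i j)) (Uq_projM _ _)).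
Qed.

Lemma qKF i j : qK B i * gF j = vq i ^ (- c i j) ** (gF j * qK B i) /\
  qKV B i * gF j = vq i ^ (c i j) ** (gF j * qKV B i).
Proof.
rewrite -{2}[c i j]opprK !exprz_exp !mulrN -B_factor; apply: conj_rel; rewrite scmE.
exact: etrans (esym (Uq_projM3 _ _ _)) (etrans (Uq_rel0 (rel_KF B i j)) (Uq_projM _ _)).
Qed.

Lemma qEF i j : i != j -> gE i * gF j = gF j * gE i.
Proof.
move=> ij; have := rel_EF B i j; rewrite (negbTE ij) subr0 => /Uq_rel0 h.
exact: etrans (esym (Uq_projM _ _)) (etrans h (Uq_projM _ _)).
Qed.

Lemma qEFi i : gE i * gF i = gF i * gE i + (qbr (vq i) 1)^-1 ** (qK B i - qKV B i).
Proof.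
have := rel_EF B i i; rewrite eqxx -addrA -opprD => /Uq_rel0 h.
rewrite scmE -qdiffE.
apply: etrans (etrans (esym (Uq_projM _ _)) h) (etrans (Uq_projD _ _) _).
apply: f_equal2 (Uq_projM _ _) (etrans (Uq_projM _ _) _).
exact: (f_equal2 (fun x y => x * y) (erefl _) (Uq_projB _ _)).
Qed.

Lemma qE_divpow i m : qE B i m = divpow (vq i) sc (gE i) m.
Proof. by rewrite divpowE scmE -qfactE. Qed.
Lemma qF_divpow i m : qF B i m = divpow (vq i) sc (gF i) m.
Proof. by rewrite divpowE scmE -qfactE. Qed.

Hypothesis d_gt0 : forall i, 0 < d i.
Hypothesis cartan_le0 : forall i j, i != j -> c i j <= 0.

Lemma br_neq0 i : forall m : nat, qbr (vq i) m.+1 != 0.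
Proof. exact: qbr_q_neq0. Qed.

Lemma Uq_proj_serre (f : 'I_n -> FreeUq n) i j :
  c i j <= 0 -> Uq_proj B (serre B f i j) = 0 ->
  qadd (vq i) sc (Uq_proj B (f i)) (c i j) `|1 - c i j|%N (Uq_proj B (f j)) = 0.
Proof.
move=> ci h.
apply: qadd_serre; [exact: expfz_neq0 q_neq0 | exact: br_neq0 | exact: Uq_scalarC | by lia |].
rewrite -[RHS]h /serre big_mkord; apply: etrans (esym (Uq_proj_sum _)).
apply: eq_bigr => s _; rewrite scmE qbinomE; apply: etrans (esym (Uq_projM _ _)).
apply: (f_equal2 (fun x y => x * y) (erefl _)); apply: etrans (esym (Uq_projM3 _ _ _)).
by rewrite !Uq_projX.
Qed.

Lemma serreE i j : i != j ->
  qadd (vq i) sc (gE i) (c i j) `|1 - c i j|%N (gE j) = 0.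
Proof.
move=> ij; apply: (@Uq_proj_serre (@fE n) i j); first exact: cartan_le0.
exact: Uq_rel_eq0 (rel_serreE B ij).
Qed.

Lemma serreF i j : i != j ->
  qadd (vq i) sc (gF i) (c i j) `|1 - c i j|%N (gF j) = 0.
Proof.
move=> ij; apply: (@Uq_proj_serre (@fF n) i j); first exact: cartan_le0.
exact: Uq_rel_eq0 (rel_serreF B ij).
Qed.

End UqRelations.

(** * Transport of identities to the specialization *)
Section Lifts.
Variables (n : nat) (B : 'M[int]_n) (k : fieldType) (l : nat) (zeta : k).

Local Notation A := (UA B).
Local Notation U := (Uzeta B l zeta).
Local Notation uof := (@Uzeta_of n B k l zeta).
Local Notation scz := (@Uzeta_scalar n B k l zeta).
Local Notation val := (@UA_val n B).
Local Notation pk := (quot_proj (@tensor_rel n B k zeta)).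
Local Notation pz := (quot_proj (@Kl_rel n B k l zeta)).

Lemma Uzeta_scalar_is_zmod : zmod_morphism scz.
Proof. exact: (rmorphB (pz \o pk \o @free_scalar k _)). Qed.

Lemma Uzeta_scalar_is_monoid : monoid_morphism scz.
Proof.
split=> [|a b]; first exact: (rmorph1 (pz \o pk \o @free_scalar k _)).
exact: (rmorphM (pz \o pk \o @free_scalar k _)).
Qed.

HB.instance Definition _ := GRing.isZmodMorphism.Build k U scz Uzeta_scalar_is_zmod.
HB.instance Definition _ := GRing.isMonoidMorphism.Build k U scz Uzeta_scalar_is_monoid.

Lemma Uzeta_scalarC c (x : U) : x * scz c = scz c * x.
Proof.
rewrite -(quot_reprK x); set y := quot_repr x.
rewrite -(quot_reprK y); set z := quot_repr y.
have M a b : pz (pk (a * b)) = pz (pk a) * pz (pk b) by exact: (rmorphM (pz \o pk)).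
exact: etrans (esym (M _ _)) (etrans (congr1 (pz \o pk) (free_scalarC c z)) (M _ _)).
Qed.

Local Notation tens u := (free_gen k (u : A)).

Lemma tensor_eq x y : @tensor_rel n B k zeta (x - y) -> pz (pk x) = pz (pk y).
Proof. by move=> h; congr pz; apply/eqP/quot_projP/ideal_gen_base. Qed.

Lemma Uzeta_ofD u w : uof (u + w) = uof u + uof w.
Proof. exact: etrans (tensor_eq (tensor_add _ u w)) (rmorphD (pz \o pk) _ _). Qed.

Lemma Uzeta_ofM u w : uof (u * w) = uof u * uof w.
Proof. exact: etrans (tensor_eq (tensor_mul _ u w)) (rmorphM (pz \o pk) _ _). Qed.

Lemma Uzeta_of1 : uof 1 = 1.
Proof. exact: etrans (tensor_eq (tensor_one _ _)) (rmorph1 (pz \o pk)). Qed.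

Lemma Uzeta_ofZ a c u w : specializes zeta a c -> val w = Uq_scalar B a * val u ->
  uof w = scz c * uof u.
Proof.
by move=> s h; exact: etrans (tensor_eq (tensor_scale s h)) (rmorphM (pz \o pk) _ _).
Qed.

Lemma UA_val_inj : injective val. Proof. exact: val_inj. Qed.

(** An identity between integral elements of the generic algebra is carried to
    the specialization along this relation, which is functional in x and
    compatible with the ring operations. *)
Definition lifts (x : Uq B) (y : U) : Prop := exists u : A, val u = x /\ uof u = y.

Lemma lifts_fun x y y' : lifts x y -> lifts x y' -> y = y'.
Proof. by move=> [u [<- <-]] [w [/UA_val_inj -> <-]]. Qed.

Lemma lifts_eq x x' y : lifts x y -> x = x' -> lifts x' y.
Proof. by move=> h <-. Qed.

Lemma liftsD x y x' y' : lifts x y -> lifts x' y' -> lifts (x + x') (y + y').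
Proof. by move=> [u [<- <-]] [w [<- <-]]; exists (u + w); rewrite Uzeta_ofD. Qed.

Lemma liftsM x y x' y' : lifts x y -> lifts x' y' -> lifts (x * x') (y * y').
Proof. by move=> [u [<- <-]] [w [<- <-]]; exists (u * w); rewrite Uzeta_ofM. Qed.

Lemma lifts1 : lifts 1 1.
Proof. by exists 1; rewrite Uzeta_of1. Qed.

Lemma liftsZ a c x y : specializes zeta a c -> lifts x y ->
  lifts (Uq_scalar B a * x) (scz c * y).
Proof.
move=> s [u [<- <-]].
have g : UA_gen (Uq_scalar B a) by apply: UA_gen_scalar; apply: spec_in_A s.
by exists (subring_elt g * u); split=> //; apply: Uzeta_ofZ s _.
Qed.

Lemma lifts0 : lifts 0 0.
Proof.
apply: lifts_eq (_ : 0 * 1 = 0); last by rewrite mul0r.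
have := liftsZ (spec0 zeta) lifts1; rewrite !rmorph0.
by rewrite [in X in lifts _ X]mul0r.
Qed.

Lemma lifts_sum m (P : pred 'I_m) (f : 'I_m -> Uq B) (g : 'I_m -> U) :
  (forall i, lifts (f i) (g i)) ->
  lifts (\sum_(i < m | P i) f i) (\sum_(i < m | P i) g i).
Proof.
move=> h; elim/big_rec2: _ => [|i y1 y2 _]; first exact: lifts0.
exact: liftsD.
Qed.

Lemma lifts_E i m : lifts (qE B i m) (uE B l zeta i m).
Proof. by exists (aE B i m). Qed.
Lemma lifts_F i m : lifts (qF B i m) (uF B l zeta i m).
Proof. by exists (aF B i m). Qed.
Lemma lifts_K i : lifts (qK B i) (uK B l zeta i).
Proof. by exists (aK B i). Qed.

Definition uKV i : U := uof (subring_elt (UA_gen_KV B i)).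
Lemma lifts_KV i : lifts (qKV B i) (uKV i).
Proof. by exists (subring_elt (UA_gen_KV B i)). Qed.

Lemma liftsN x y : lifts x y -> lifts (- x) (- y).
Proof.
have s : specializes zeta (-1) (-1) := specN (spec1 zeta).
by move=> /(liftsZ s); rewrite !rmorphN !rmorph1 !mulN1r.
Qed.

Lemma Uzeta_ind (P : U -> Prop) :
  (forall c, P (scz c)) -> (forall i m, P (uE B l zeta i m)) ->
  (forall i m, P (uF B l zeta i m)) -> (forall i, P (uK B l zeta i)) ->
  (forall i, P (uKV i)) ->
  (forall x y, P x -> P y -> P (x + y)) -> (forall x y, P x -> P y -> P (x * y)) ->
  forall x, P x.
Proof.
move=> Pc PE PF PK PKV PD PM.
have Pof (u : A) : P (uof u).
  have h x : subring_gen (@UA_gen n B) x -> forall u : A, val u = x -> P (uof u).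
    elim=> {x}.
    - move=> x; case.
      + move=> a /(in_A_spec zeta)[c s] w vw.
        by rewrite (@Uzeta_ofZ a c 1 w s) ?Uzeta_of1 ?mulr1 // vw [RHS]mulr1.
      + by move=> i w vw; rewrite (UA_val_inj (vw : val w = val (aK B i))); exact: PK.
      + move=> i w vw.
        by rewrite (UA_val_inj (vw : val w = val (subring_elt (UA_gen_KV B i)))); exact: PKV.
      + by move=> i m w vw; rewrite (UA_val_inj (vw : val w = val (aE B i m))); exact: PE.
      + by move=> i m w vw; rewrite (UA_val_inj (vw : val w = val (aF B i m))); exact: PF.
    - by move=> w vw; rewrite (UA_val_inj (vw : val w = val 1)) Uzeta_of1 -(rmorph1 scz); exact: Pc.
    - move=> x y Sx IHx Sy IHy w vw.
      have [u1 v1] : exists u1, val u1 = x by exists (Subring (introT (asboolP _) Sx)).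
      have [u2 v2] : exists u2, val u2 = y by exists (Subring (introT (asboolP _) Sy)).
      have l1 : lifts x (uof u1) by exists u1.
      have l2 : lifts y (uof u2) by exists u2.
      have lw : lifts (x - y) (uof w) by exists w.
      rewrite (lifts_fun lw (liftsD l1 (liftsN l2))).
      apply: PD; first exact: IHx.
      rewrite -mulN1r -(rmorph1 scz) -rmorphN; apply: PM; [exact: Pc | exact: IHy].
    - move=> x y Sx IHx Sy IHy w vw.
      have [u1 v1] : exists u1, val u1 = x by exists (Subring (introT (asboolP _) Sx)).
      have [u2 v2] : exists u2, val u2 = y by exists (Subring (introT (asboolP _) Sy)).
      have l1 : lifts x (uof u1) by exists u1.
      have l2 : lifts y (uof u2) by exists u2.
      have lw : lifts (x * y) (uof w) by exists w.
      rewrite (lifts_fun lw (liftsM l1 l2)).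
      by apply: PM; [exact: IHx | exact: IHy].
  case: u => x Sx; apply: (h x) => //; exact: (elimT (asboolP _) Sx).
move=> x; rewrite -(quot_reprK x); set y := quot_repr x.
rewrite -(quot_reprK y); move: (quot_repr y) => z.
elim/free_alg_ind: z => [c|u|g h Pg Ph|g h Pg Ph].
- exact: Pc.
- exact: Pof.
- have -> : pz (pk (g + h)) = pz (pk g) + pz (pk h) := rmorphD (pz \o pk) _ _.
  exact: PD.
- have -> : pz (pk (g * h)) = pz (pk g) * pz (pk h) := rmorphM (pz \o pk) _ _.
  exact: PM.
Qed.

End Lifts.

Lemma spec_gauss (k : fieldType) (zeta : k) (zeta0 : zeta != 0) (d : int) m t :
  specializes zeta (gauss (q ^ d) m t) (gauss (zeta ^ d) m t).
Proof.
elim: m t => [|m IH] [|t] /=; try exact: spec1; first exact: spec0.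
rewrite !exprz_exp; apply: specD => //; apply: specM => //; exact: spec_expz.
Qed.

(** Integrality of all Gaussian binomials, with negative upper index included:
    the q-Pascal rule is used upwards and downwards from the index 0. *)
Lemma spec_qbin (k : fieldType) (zeta : k) (zeta0 : zeta != 0) (d : int) :
  0 < d -> forall (m : int) t, exists c, specializes zeta (qbin (q ^ d) m t) c.
Proof.
move=> d0 m t; elim: t m => [|t IH] m; first by exists 1; rewrite /qbin big_ord0; exact: spec1.
have v0 : q ^ d != 0 by rewrite expfz_neq0 ?q_neq0.
have pas := qbin_pascal v0 (qbr_q_neq0 d0).
elim: m => [|m [c IHm]|m [c IHm]].
- by rewrite (qbin_gauss v0 (qbr_q_neq0 d0) 0); exists (gauss (zeta ^ d) 0 t.+1); exact: spec_gauss.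
- have [c' h] := IH m; rewrite -addn1 PoszD pas !exprz_exp.
  by eexists; apply: (specD zeta0); apply: specM; [exact: spec_expz | exact: IHm | exact: spec_expz | exact: h].
have [c' h] := IH (- m.+1%:Z).
have e : qbin (q ^ d) (- m.+1%:Z) t.+1 = (q ^ d) ^ t.+1%:Z *
    (qbin (q ^ d) (- m%:Z) t.+1 - (q ^ d) ^ (- m.+1%:Z - t%:Z) * qbin (q ^ d) (- m.+1%:Z) t).
  have -> : - m%:Z = - m.+1%:Z + 1 by lia.
  by rewrite pas addrK mulrA -expfzDr // subrr expr0z mul1r.
rewrite !exprz_exp in e.
rewrite e; eexists; apply: specM; first exact: spec_expz.
apply: (specD zeta0); first exact: IHm.
by apply: specN; apply: specM; [exact: spec_expz | exact: h].
Qed.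

Section Uzeta_identities.
Variables (n : nat) (B : 'M[int]_n) (k : fieldType) (l : nat) (zeta : k).
Hypothesis zeta0 : zeta != 0.

Local Notation U := (Uzeta B l zeta).
Local Notation scz := (@Uzeta_scalar n B k l zeta).
Local Notation sc := (@Uq_scalar n B).
Local Notation d i := (half_norm B i).
Local Notation c i j := (cartan B i j).
Local Notation vq i := (q ^ d i).
Local Notation vz i := (zeta ^ d i).
Local Notation lifts := (@lifts n B k l zeta).
Local Notation uE := (uE B l zeta).
Local Notation uF := (uF B l zeta).
Local Notation "a ** x" := (scm sc a x) (at level 40, left associativity).

Hypothesis d_gt0 : forall i, 0 < d i.
Hypothesis cartan_le0 : forall i j, i != j -> c i j <= 0.

Let v0 i : vq i != 0. Proof. exact: expfz_neq0 q_neq0. Qed.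
Let br0 i := @qbr_q_neq0 (d i) (d_gt0 i).
Let scC := @Uq_scalarC n B.

Lemma lifts_sc a e x y : specializes zeta a e -> lifts x y -> lifts (a ** x) (scz e * y).
Proof. by move=> s h; rewrite scmE; exact: liftsZ. Qed.

Lemma uE0 i : uE i 0 = 1.
Proof.
apply: lifts_fun (lifts_E _ _ _ _ _) (lifts_eq (lifts1 _ _ _) _).
by rewrite qE_divpow divpow0.
Qed.

Lemma uF0 i : uF i 0 = 1.
Proof.
apply: lifts_fun (lifts_F _ _ _ _ _) (lifts_eq (lifts1 _ _ _) _).
by rewrite qF_divpow divpow0.
Qed.

Lemma spec_binom i a b :
  specializes zeta (qbin (vq i) (a + b)%N a) (gauss (vz i) (a + b) a).
Proof. rewrite qbin_gauss //; exact: spec_gauss. Qed.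

Lemma uEM i a b : uE i a * uE i b = scz (gauss (vz i) (a + b) a) * uE i (a + b).
Proof.
apply: lifts_fun (liftsM (lifts_E _ _ _ _ _) (lifts_E _ _ _ _ _)) _.
apply: lifts_eq (lifts_sc (spec_binom i a b) (lifts_E _ _ _ _ _)) _.
by rewrite !qE_divpow divpowD.
Qed.

Lemma uFM i a b : uF i a * uF i b = scz (gauss (vz i) (a + b) a) * uF i (a + b).
Proof.
apply: lifts_fun (liftsM (lifts_F _ _ _ _ _) (lifts_F _ _ _ _ _)) _.
apply: lifts_eq (lifts_sc (spec_binom i a b) (lifts_F _ _ _ _ _)) _.
by rewrite !qF_divpow divpowD.
Qed.

Definition ucoef (i j : 'I_n) (a t s : nat) : k :=
  (-1) ^+ s * zeta ^ (d i * (s%:Z * (c i j * a%:Z + t%:Z - 1))).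

(** The image of the bracket qadd of order t of the a-th divided power. *)
Definition ubracket (g : 'I_n -> nat -> U) (i j : 'I_n) (a t : nat) : U :=
  \sum_(s < t.+1) scz (ucoef i j a t s) * (g i (t - s)%N * g j a * g i s).

Section Commutation.
Variables (x : 'I_n -> Uq B) (g : 'I_n -> nat -> U).
Hypothesis lift_g : forall i m, lifts (divpow (vq i) sc (x i) m) (g i m).
Hypothesis serre_x : forall i j, i != j ->
  qadd (vq i) sc (x i) (c i j) `|1 - c i j|%N (x j) = 0.

Let serreS i j : i != j -> qadd (vq i) sc (x i) (c i j) (`|c i j|%N).+1 (x j) = 0.
Proof.
move=> ij; have := serre_x ij.
by have -> : `|1 - c i j|%N = (`|c i j|%N).+1 by have := cartan_le0 ij; lia.
Qed.

Let lifts_bracket i j a t :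
  lifts (qadd (vq i) sc (x i) (c i j * a%:Z) t (divpow (vq j) sc (x j) a))
        (ubracket g i j a t).
Proof.
apply: lifts_sum => s; apply: lifts_sc.
  by rewrite exprz_exp; apply: specM; [exact: spec_sign | exact: spec_expz].
exact: liftsM (liftsM (lift_g _ _) (lift_g _ _)) (lift_g _ _).
Qed.

(** The Serre relation kills the bracket of order 1 - c i j of a generator, whence
    the bound on t. *)
Lemma lifted_commute_left i j a m : i != j -> exists C : nat -> k,
  g i m * g j a = \sum_(t < m.+1 | (t <= a * `|c i j|)%N)
    scz (C t) * (ubracket g i j a t * g i (m - t)%N).
Proof.
move=> ij.
exists (fun t => zeta ^ (d i * ((c i j * a%:Z + t%:Z) * (m%:Z - t%:Z)))).
apply: lifts_fun (liftsM (lift_g _ _) (lift_g _ _)) _.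
have E := divpow_commute_left (v0 i) (br0 i) scC a (qfac (vq j) a)^-1 m (serreS ij).
rewrite /= -divpowE in E; apply: lifts_eq _ (esym E).
apply: lifts_sum => t; apply: lifts_sc (liftsM (lifts_bracket _ _ _ _) (lift_g _ _)).
by rewrite exprz_exp; exact: spec_expz.
Qed.

Lemma lifted_commute_right i j a m : i != j -> exists C : nat -> k,
  g j a * g i m = \sum_(t < m.+1 | (t <= a * `|c i j|)%N)
    scz (C t) * (g i (m - t)%N * ubracket g i j a t).
Proof.
move=> ij.
exists (fun t => (-1) ^+ t * zeta ^ (d i * (- (m%:Z * (c i j * a%:Z)) - t%:Z * (m%:Z - 1)))).
apply: lifts_fun (liftsM (lift_g _ _) (lift_g _ _)) _.
have E := divpow_commute_right (v0 i) (br0 i) scC a (qfac (vq j) a)^-1 m (serreS ij).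
rewrite /= -divpowE in E; apply: lifts_eq _ (esym E).
apply: lifts_sum => t; apply: lifts_sc (liftsM (lift_g _ _) (lifts_bracket _ _ _ _)).
by rewrite exprz_exp; apply: specM; [exact: spec_sign | exact: spec_expz].
Qed.

End Commutation.

Lemma uF_commute i j a m : i != j -> exists C : nat -> k, uF i m * uF j a =
  \sum_(t < m.+1 | (t <= a * `|c i j|)%N) scz (C t) * (ubracket uF i j a t * uF i (m - t)).
Proof.
apply: (@lifted_commute_left (@gF n B)) => [i' m'|].
  by rewrite -qF_divpow; exact: lifts_F.
exact: serreF.
Qed.

Lemma uE_commute i j a m : i != j -> exists C : nat -> k, uE j a * uE i m =
  \sum_(t < m.+1 | (t <= a * `|c i j|)%N) scz (C t) * (uE i (m - t) * ubracket uE i j a t).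
Proof.
apply: (@lifted_commute_right (@gE n B)) => [i' m'|].
  by rewrite -qE_divpow; exact: lifts_E.
exact: serreE.
Qed.

End Uzeta_identities.

(** * The torus part of the specialization *)
Section TorusPart.
Variables (n : nat) (B : 'M[int]_n) (k : fieldType) (l : nat) (zeta : k).
Hypothesis zeta0 : zeta != 0.

Local Notation U := (Uzeta B l zeta).
Local Notation scz := (@Uzeta_scalar n B k l zeta).
Local Notation sc := (@Uq_scalar n B).
Local Notation d i := (half_norm B i).
Local Notation c i j := (cartan B i j).
Local Notation vq i := (q ^ d i).
Local Notation vz i := (zeta ^ d i).
Local Notation lifts := (@lifts n B k l zeta).
Local Notation uE := (uE B l zeta).
Local Notation uF := (uF B l zeta).
Local Notation uK := (uK B l zeta).
Local Notation uKV := (uKV B l zeta).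
Local Notation "a ** x" := (scm sc a x) (at level 40, left associativity).

Hypothesis B_factor : forall i j, B i j = d i * c i j.
Hypothesis d_gt0 : forall i, 0 < d i.
Hypothesis cartan_ii : forall i, c i i = 2.

Let v0 i : vq i != 0. Proof. exact: expfz_neq0 q_neq0. Qed.
Let br0 i := @qbr_q_neq0 (d i) (d_gt0 i).
Let scC := @Uq_scalarC n B.

Lemma uEF_commute i j a b : i != j -> uE i a * uF j b = uF j b * uE i a.
Proof.
move=> ij; apply: lifts_fun (liftsM (lifts_E _ _ _ _ _) (lifts_F _ _ _ _ _)) _.
apply: lifts_eq (liftsM (lifts_F _ _ _ _ _) (lifts_E _ _ _ _ _)) _.
rewrite qE_divpow qF_divpow !divpowE.
exact: esym (scm_expr_comm scC _ _ _ _ (qEF B ij)).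
Qed.

Lemma uE_comm i a b : uE i a * uE i b = uE i b * uE i a.
Proof.
apply: lifts_fun (liftsM (lifts_E _ _ _ _ _) (lifts_E _ _ _ _ _)) _.
apply: lifts_eq (liftsM (lifts_E _ _ _ _ _) (lifts_E _ _ _ _ _)) _.
by rewrite !qE_divpow !divpowE; exact: (scm_expr_comm scC).
Qed.

Lemma uF_comm i a b : uF i a * uF i b = uF i b * uF i a.
Proof.
apply: lifts_fun (liftsM (lifts_F _ _ _ _ _) (lifts_F _ _ _ _ _)) _.
apply: lifts_eq (liftsM (lifts_F _ _ _ _ _) (lifts_F _ _ _ _ _)) _.
by rewrite !qF_divpow !divpowE; exact: (scm_expr_comm scC).
Qed.

Definition Kbin i (m : int) t : Uq B := kbin (vq i) sc (qK B i) (qKV B i) m t.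

Let KE i : qK B i * gE B i = vq i ^ 2 ** (gE B i * qK B i).
Proof. by have [h _] := qKE B_factor i i; rewrite cartan_ii in h. Qed.
Let KVE i : qKV B i * gE B i = vq i ^ (- 2) ** (gE B i * qKV B i).
Proof. by have [_ h] := qKE B_factor i i; rewrite cartan_ii in h. Qed.
Let KF i : qK B i * gF B i = vq i ^ (- 2) ** (gF B i * qK B i).
Proof. by have [h _] := qKF B_factor i i; rewrite cartan_ii in h. Qed.
Let KVF i : qKV B i * gF B i = vq i ^ 2 ** (gF B i * qKV B i).
Proof. by have [_ h] := qKF B_factor i i; rewrite cartan_ii in h. Qed.

Lemma qKbinomE i t : qKbinom B i t = Kbin i 0 t.
Proof.
rewrite /qKbinom /Kbin kbin_prod // big_add1 big_mkord; apply: eq_bigr => s _.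
rewrite scmE qdiffE /kq !scmE sub0r opprK.
apply: (f_equal2 (fun x y => x * y) (erefl _)).
apply: (f_equal2 (fun x y => x - y)); apply: etrans (scC _ _) _.
  apply: (f_equal (fun z => sc z * qK B i)).
  by rewrite exprz_exp; apply: (f_equal (fun z => q ^ (d i * z))); rewrite /=; lia.
apply: (f_equal (fun z => sc z * qKV B i)).
by rewrite exprz_exp; apply: (f_equal (fun z => q ^ (d i * z))); rewrite /=; lia.
Qed.

(** For the shift 0, integrality is read off from kbin0_kac, by induction on t; the
    other shifts follow by the q-Pascal rule. *)
Lemma lifts_Kbin i t m : exists h, lifts (Kbin i m t) h.
Proof.
elim/ltn_ind: t m => [] [|t] IH m; first by exists 1; rewrite /Kbin kbin0; exact: lifts1.
elim: m => [|m [h hh]|m [h hh]].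
- eexists; apply: lifts_eq (esym (kbin0_kac (v0 i) (br0 i) scC (qKK B i) (KE i) (KVE i) (KF i) (KVF i) (qEFi B i) _)).
  apply: liftsD.
    by rewrite -qE_divpow -qF_divpow; exact: liftsM (lifts_E _ _ _ _ _) (lifts_F _ _ _ _ _).
  apply: liftsN; apply: (@lifts_sum _ _ _ _ _ _ _ _
    (fun s => uF i (t.+1 - s)%N * projT1 (cid (IH s (ltn_ord s) (2 * s%:Z - t.+1%:Z - t.+1%:Z))) * uE i (t.+1 - s)%N)).
  move=> s; rewrite -qE_divpow -qF_divpow.
  apply: liftsM (lifts_E _ _ _ _ _); apply: liftsM (lifts_F _ _ _ _ _) _.
  exact: projT2 (cid _).
- have [h' hh'] := IH t (ltnSn t) m%:Z.
  rewrite -addn1 PoszD; eexists.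
  apply: lifts_eq (esym (kbin_pascal (v0 i) (br0 i) scC (qKK B i) _ _)).
  apply: liftsD; first by apply: lifts_sc hh; rewrite exprz_exp; exact: spec_expz.
  apply: lifts_sc (liftsM (lifts_KV _ _ _ _) hh').
  by rewrite exprz_exp; exact: spec_expz.
have [h' hh'] := IH t (ltnSn t) (- m.+1%:Z).
eexists; apply: lifts_eq (esym (kbin_pascal_down (v0 i) (br0 i) scC (qKK B i) _ _)).
apply: liftsD.
  have -> : - m.+1%:Z + 1 = - m%:Z by lia.
  by apply: lifts_sc hh; rewrite exprz_exp; exact: spec_expz.
apply: liftsN; apply: lifts_sc (liftsM (lifts_KV _ _ _ _) hh').
by rewrite !exprz_exp; apply: specM; exact: spec_expz.
Qed.

Let conj_divpow i (j : 'I_n) (X : Uq B) (e : int) a (Y := divpow (vq j) sc X a) :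
  qK B i * X = vq i ^ e ** (X * qK B i) /\ qKV B i * X = vq i ^ (- e) ** (X * qKV B i) ->
  qK B i * Y = vq i ^ (e * a%:Z) ** (Y * qK B i) /\
  qKV B i * Y = vq i ^ (- (e * a%:Z)) ** (Y * qKV B i).
Proof.
move=> [h1 h2]; rewrite /Y divpowE -mulNr.
by split; [exact: (scm_expr_shift (v0 i) scC _ _ h1) | exact: (scm_expr_shift (v0 i) scC _ _ h2)].
Qed.

Let lift_shift i j (X : Uq B) (x : U) (e : int) a m t h h' :
  qK B i * X = vq i ^ e ** (X * qK B i) /\ qKV B i * X = vq i ^ (- e) ** (X * qKV B i) ->
  lifts (divpow (vq j) sc X a) x ->
  lifts (Kbin i m t) h -> lifts (Kbin i (m + e * a%:Z) t) h' -> h * x = x * h'.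
Proof.
move=> /(@conj_divpow i j X e a)[h1 h2] lx lh lh'.
apply: lifts_fun (liftsM lh lx) (lifts_eq (liftsM lx lh') _).
exact: esym (kbin_shift (v0 i) scC m t h1 h2).
Qed.

Let lift_K_shift i j (X : Uq B) (x : U) (e : int) a :
  qK B i * X = vq i ^ e ** (X * qK B i) /\ qKV B i * X = vq i ^ (- e) ** (X * qKV B i) ->
  lifts (divpow (vq j) sc X a) x ->
  uK i * x = scz (zeta ^ (d i * (e * a%:Z))) * (x * uK i).
Proof.
move=> /(@conj_divpow i j X e a)[h1 _] lx.
apply: lifts_fun (liftsM (lifts_K _ _ _ _) lx) _.
apply: lifts_eq (esym h1); apply: lifts_sc (liftsM lx (lifts_K _ _ _ _)).
by rewrite exprz_exp; exact: spec_expz.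
Qed.

Let lifts_dpE j a : lifts (divpow (vq j) sc (gE B j) a) (uE j a).
Proof. by rewrite -qE_divpow; exact: lifts_E. Qed.
Let lifts_dpF j a : lifts (divpow (vq j) sc (gF B j) a) (uF j a).
Proof. by rewrite -qF_divpow; exact: lifts_F. Qed.
Let qKFN i j : qK B i * gF B j = vq i ^ (- c i j) ** (gF B j * qK B i) /\
  qKV B i * gF B j = vq i ^ (- - c i j) ** (gF B j * qKV B i).
Proof. by rewrite opprK; exact: qKF. Qed.

Lemma Kbin_uE i j a m t h h' : lifts (Kbin i m t) h ->
  lifts (Kbin i (m + c i j * a%:Z) t) h' -> h * uE j a = uE j a * h'.
Proof.
exact: lift_shift (qKE B_factor i j) (lifts_dpE j a).
Qed.

Lemma Kbin_uF i j a m t h h' : lifts (Kbin i m t) h ->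
  lifts (Kbin i (m - c i j * a%:Z) t) h' -> h * uF j a = uF j a * h'.
Proof.
rewrite -mulNr; exact: lift_shift (qKFN i j) (lifts_dpF j a).
Qed.

Lemma uK_uE i j a : uK i * uE j a = scz (zeta ^ (d i * (c i j * a%:Z))) * (uE j a * uK i).
Proof.
exact: lift_K_shift (qKE B_factor i j) (lifts_dpE j a).
Qed.

Lemma uK_uF i j a : uK i * uF j a = scz (zeta ^ (d i * (- c i j * a%:Z))) * (uF j a * uK i).
Proof.
exact: lift_K_shift (qKFN i j) (lifts_dpF j a).
Qed.

Lemma uKV_K i : uKV i * uK i = 1.
Proof.
apply: lifts_fun (liftsM (lifts_KV _ _ _ _) (lifts_K _ _ _ _)) _.
exact: lifts_eq (lifts1 _ _ _) (esym (qKVK B i)).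
Qed.

Definition uF_sub i b t : U := if (t <= b)%N then uF i (b - t) else 0.

Lemma uE_uF i a b : exists h : nat -> U,
  (forall t, lifts (Kbin i (2 * t%:Z - a%:Z - b%:Z) t) (h t)) /\
  uE i a * uF i b = \sum_(t < a.+1) uF_sub i b t * h t * uE i (a - t).
Proof.
pose h t := projT1 (cid (lifts_Kbin i t (2 * t%:Z - a%:Z - b%:Z))).
have hh t : lifts (Kbin i (2 * t%:Z - a%:Z - b%:Z) t) (h t) by exact: projT2 (cid _).
exists h; split=> //.
apply: lifts_fun (liftsM (lifts_E _ _ _ _ _) (lifts_F _ _ _ _ _)) _.
have E := kac_formula (v0 i) (br0 i) scC (qKK B i) (KE i) (KVE i) (KF i) (KVF i) (qEFi B i) a b.
rewrite -qE_divpow -qF_divpow in E; apply: lifts_eq _ (esym E).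
apply: lifts_sum => t; rewrite -qE_divpow; apply: liftsM (lifts_E _ _ _ _ _).
apply: liftsM (hh t); rewrite /divpow_sub /uF_sub; case: leqP => _; last exact: lifts0.
by rewrite -qF_divpow; exact: lifts_F.
Qed.

End TorusPart.

(** * Action on weight vectors *)
Section ScalarAction.
Variables (k : fieldType) (U : pzRingType) (s : {rmorphism k -> U}) (V : lmodType U).
Hypothesis sC : forall c x, x * s c = s c * x.
Local Notation ks e v := (s e *: v : V).

Lemma sact_act e (u : U) v : u *: ks e v = ks e (u *: v).
Proof. by rewrite !scalerA sC. Qed.
Lemma sact_sact e e' v : ks e (ks e' v) = ks (e * e') v.
Proof. by rewrite scalerA rmorphM. Qed.
Lemma sact1 v : ks 1 v = v. Proof. by rewrite rmorph1 scale1r. Qed.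
Lemma sact0 v : ks 0 v = 0. Proof. by rewrite rmorph0 scale0r. Qed.
Lemma sactD e e' v : ks (e + e') v = ks e v + ks e' v.
Proof. by rewrite rmorphD scalerDl. Qed.

Lemma torus_comb a b e1 e2 f (x y z : U) w :
  x *: w = ks e1 w -> z *: w = ks e2 w -> y *: w = ks f w ->
  (s a * x + s b * (y * z)) *: w = ks (a * e1 + b * (e2 * f)) w.
Proof.
move=> xw zw yw; rewrite scalerDl -!scalerA xw zw [y *: _]sact_act yw.
by rewrite !sact_sact -sactD mulrA.
Qed.

Lemma inv_act (x y : U) e w : e != 0 -> x * y = 1 -> y *: w = ks e w -> x *: w = ks e^-1 w.
Proof.
move=> e0 xy yw; rewrite -[LHS]sact1 -(mulVf e0) -sact_sact -(sact_act e) -yw.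
by rewrite [x *: _]scalerA xy scale1r.
Qed.

Lemma shift_act (x y z : U) a e w : x * y = s a * (y * z) -> z *: w = ks e w ->
  x *: (y *: w) = ks (a * e) (y *: w).
Proof.
by move=> xy zw; rewrite [LHS]scalerA xy -!scalerA zw [y *: (s e *: w)]sact_act sact_sact.
Qed.

Lemma shift_act1 (x y z : U) e w : x * y = y * z -> z *: w = ks e w ->
  x *: (y *: w) = ks e (y *: w).
Proof. by move=> xy zw; rewrite [LHS]scalerA xy -scalerA zw sact_act. Qed.

Lemma sum_act m (x y z : 'I_m -> U) (e : 'I_m -> k) u w :
  u = \sum_t x t * y t * z t -> (forall t, y t *: (z t *: w) = ks (e t) (z t *: w)) ->
  u *: w = \sum_t ks (e t) (x t *: (z t *: w)).
Proof.
move=> -> h; rewrite scaler_suml; apply: eq_bigr => t _.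
by rewrite -!scalerA h sact_act.
Qed.

End ScalarAction.

Section WeightVectors.
Variables (R : archiRealFieldType) (E : vectType R) (ip : E -> E -> R).
Variables (Phi : seq E) (n : nat) (Pi : n.-tuple E).
Variables (k : fieldType) (l : nat) (zeta : k).
Hypothesis zeta0 : zeta != 0.
Local Notation B := (gram ip Pi).
Local Notation U := (Uzeta B l zeta).
Local Notation scz := (@Uzeta_scalar n B k l zeta).
Local Notation d i := (half_norm B i).
Local Notation c i j := (cartan B i j).
Local Notation vq i := (q ^ d i).
Local Notation lifts := (@lifts n B k l zeta).
Local Notation uE := (uE B l zeta).
Local Notation uF := (uF B l zeta).
Local Notation uK := (uK B l zeta).
Local Notation uKV := (uKV B l zeta).
Local Notation Kbin := (Kbin B).
Local Notation alpha i := (tnth Pi i).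
Local Notation lattice := (weight_lattice ip Phi).
Local Notation cop mu i := (int_copairing ip mu (alpha i)).

Hypothesis B_factor : forall i j, B i j = d i * c i j.
Hypothesis d_gt0 : forall i, 0 < d i.
Hypothesis cartan_ii : forall i, c i i = 2.
Hypothesis lattice_shift : forall mu j (m : int),
  lattice mu -> lattice (mu + alpha j *~ m).
Hypothesis cop_shift : forall mu i j (m : int), lattice mu ->
  cop (mu + alpha j *~ m) i = cop mu i + c i j * m.
Hypothesis ip_cop : forall mu i, lattice mu -> int_ip ip mu (alpha i) = d i * cop mu i.

Variable V : lmodType U.
Local Notation wt := (@weight_vector R E ip Phi n Pi k l zeta V).
Local Notation ks := (@kscale _ _ ip n Pi k l zeta V).

Let v0 i : vq i != 0. Proof. exact: expfz_neq0 q_neq0. Qed.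
Let br0 i := @qbr_q_neq0 (d i) (d_gt0 i).

Let sC := @Uzeta_scalarC n B k l zeta.

Lemma uKV_act mu w i : wt mu w -> uKV i *: w = ks (zeta ^ (- int_ip ip mu (alpha i))) w.
Proof.
move=> [_ Kw _]; rewrite -invr_expz.
exact: (@inv_act _ _ _ _ sC _ _ _ w (expfz_neq0 _ zeta0) (uKV_K B l zeta i) (Kw i)).
Qed.

Let Kbin_lift i t m := lifts_Kbin l zeta0 B_factor d_gt0 cartan_ii i t m.

(** The notion of weight vector prescribes the action for the shift 0 only; the
    same q-Pascal rule holds for Kbin and for the Gaussian binomials, and
    propagates the formula to all shifts. *)
Lemma Kbin_act i t m h mu w e : lifts (Kbin i m t) h -> wt mu w ->
  specializes zeta (qbin (vq i) (cop mu i + m) t) e -> h *: w = ks e w.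
Proof.
move=> lh ww; have lmu : lattice mu by case: ww.
elim: t m h e lh => [|t IH] m h e.
  move=> lh se.
  have -> : h = 1 by apply: lifts_fun lh (lifts_eq (lifts1 _ _ _) _); rewrite /Kbin kbin0.
  have -> : e = 1.
    apply: (spec_fun zeta0 se); rewrite /qbin big_ord0; exact: spec1.
  exact: etrans (scale1r _) (esym (sact1 _ _)).
have VK : uKV i *: w = ks (zeta ^ (- (d i * cop mu i))) w.
  by rewrite (uKV_act _ ww) ip_cop.
elim: m h e => [|m IHm|m IHm] h e lh se.
- case: lh => u [uv <-]; case: ww => _ _; apply; first by rewrite uv -(qKbinomE B zeta0).
  by rewrite addr0 in se; rewrite qbinomE.
- have [h1 lh1] := Kbin_lift i t.+1 m%:Z.
  have [h2 lh2] := Kbin_lift i t m%:Z.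
  have [e1 se1] := spec_qbin zeta0 (d_gt0 i) (cop mu i + m%:Z) t.+1.
  have [e2 se2] := spec_qbin zeta0 (d_gt0 i) (cop mu i + m%:Z) t.
  have -> : h = scz (zeta ^ (d i * t.+1%:Z)) * h1 + scz (zeta ^ (d i * (t%:Z - m%:Z))) * (uKV i * h2).
    move: lh; rewrite -addn1 PoszD => lh; apply: lifts_fun lh _.
    apply: lifts_eq (esym (kbin_pascal (v0 i) (br0 i) (@Uq_scalarC n B) (qKK B i) _ _)).
    apply: liftsD; first by apply: lifts_sc lh1; rewrite exprz_exp; exact: spec_expz.
    apply: lifts_sc (liftsM (lifts_KV _ _ _ _) lh2).
    by rewrite exprz_exp; exact: spec_expz.
  apply: etrans (torus_comb sC _ _ (IHm _ _ lh1 se1) (IH _ _ _ lh2 se2) VK) _.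
  congr (ks _ w); apply: (spec_fun zeta0 _ se).
  have -> : cop mu i + m.+1%:Z = cop mu i + m%:Z + 1 by lia.
  rewrite (qbin_pascal_bar (v0 i) (br0 i)) !exprz_exp; apply: (specD zeta0).
    by apply: specM se1; exact: spec_expz.
  have -> : zeta ^ (d i * (t%:Z - m%:Z)) * (e2 * zeta ^ (- (d i * cop mu i))) =
      zeta ^ (d i * (t%:Z - (cop mu i + m%:Z))) * e2.
    by rewrite mulrCA mulrC -expfzDr //; congr (_ ^ _ * _); ring.
  by apply: specM se2; exact: spec_expz.
have [h1 lh1] := Kbin_lift i t.+1 (- m%:Z).
have [h2 lh2] := Kbin_lift i t (- m.+1%:Z).
have [e1 se1] := spec_qbin zeta0 (d_gt0 i) (cop mu i - m%:Z) t.+1.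
have [e2 se2] := spec_qbin zeta0 (d_gt0 i) (cop mu i - m.+1%:Z) t.
have zE : specializes zeta (- (vq i ^ (- t.+1%:Z) * vq i ^ (t%:Z - - m.+1%:Z)))
    (- (zeta ^ (d i * (- t.+1%:Z)) * zeta ^ (d i * (t%:Z - - m.+1%:Z)))).
  by apply: specN; rewrite !exprz_exp; apply: specM; exact: spec_expz.
have -> : h = scz (zeta ^ (d i * (- t.+1%:Z))) * h1 +
    scz (- (zeta ^ (d i * (- t.+1%:Z)) * zeta ^ (d i * (t%:Z - - m.+1%:Z)))) * (uKV i * h2).
  apply: lifts_fun lh _.
  apply: lifts_eq (esym (kbin_pascal_down (v0 i) (br0 i) (@Uq_scalarC n B) (qKK B i) _ _)).
  apply: liftsD.
    have -> : - m.+1%:Z + 1 = - m%:Z by lia.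
    by apply: lifts_sc lh1; rewrite exprz_exp; exact: spec_expz.
  apply: lifts_eq (lifts_sc zE (liftsM (lifts_KV _ _ _ _) lh2)) _.
  exact: scN.
apply: etrans (torus_comb sC _ _ (IHm _ _ lh1 se1) (IH _ _ _ lh2 se2) VK) _.
congr (ks _ w); apply: (spec_fun zeta0 _ se).
have -> : qbin (vq i) (cop mu i - m.+1%:Z) t.+1 =
    vq i ^ (- t.+1%:Z) * qbin (vq i) (cop mu i - m%:Z) t.+1 +
    - (vq i ^ (- t.+1%:Z) * vq i ^ (t%:Z - (cop mu i - m.+1%:Z))) * qbin (vq i) (cop mu i - m.+1%:Z) t.
  have -> : cop mu i - m%:Z = cop mu i - m.+1%:Z + 1 by lia.
  rewrite (qbin_pascal_bar (v0 i) (br0 i)) mulrDr !mulrA -expfzDr // addNr expr0z mul1r.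
  by rewrite mulNr addrK.
apply: (specD zeta0); rewrite !exprz_exp.
  by apply: specM se1; exact: spec_expz.
set a := zeta ^ (d i * - t.+1%:Z).
have -> : - (a * zeta ^ (d i * (t%:Z - - m.+1%:Z))) * (e2 * zeta ^ (- (d i * cop mu i))) =
    - (a * zeta ^ (d i * (t%:Z - (cop mu i - m.+1%:Z)))) * e2.
  rewrite mulrCA mulrC mulNr -mulrA -expfzDr //.
  by congr (- (_ * zeta ^ _) * _); ring.
apply: specM se2; apply: specN; apply: specM; exact: spec_expz.
Qed.

Lemma wt_uE mu w j (a : nat) : wt mu w -> wt (mu + alpha j *~ a) (uE j a *: w).
Proof.
move=> ww; have [lmu Kw _] := ww; split; first exact: lattice_shift.
  move=> i; have h := shift_act sC (uK_uE l zeta B_factor i j a) (Kw i : uK i *: w = scz _ *: w).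
  apply: etrans h _.
  apply: (f_equal (fun e => ks e (uE j a *: w))).
  rewrite -expfzDr // !ip_cop //; last exact: lattice_shift.
  by rewrite cop_shift //; congr (zeta ^ _); ring.
move=> i t u e uv se.
have [h lh] := Kbin_lift i t (0 + c i j * a%:Z).
have lu : lifts (Kbin i 0 t) (Uzeta_of l zeta u).
  by exists u; split=> //; rewrite uv (qKbinomE B zeta0).
apply: (shift_act1 sC (Kbin_uE B_factor lu lh)).
apply: (Kbin_act lh ww); rewrite add0r.
by rewrite cop_shift // qbinomE in se.
Qed.

Lemma wt_uF mu w j (a : nat) : wt mu w -> wt (mu + alpha j *~ (- a%:Z)) (uF j a *: w).
Proof.
move=> ww; have [lmu Kw _] := ww; split; first exact: lattice_shift.
  move=> i; have h := shift_act sC (uK_uF l zeta B_factor i j a) (Kw i : uK i *: w = scz _ *: w).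
  apply: etrans h _.
  apply: (f_equal (fun e => ks e (uF j a *: w))).
  rewrite -expfzDr // !ip_cop //; last exact: lattice_shift.
  by rewrite cop_shift //; congr (zeta ^ _); ring.
move=> i t u e uv se.
have [h lh] := Kbin_lift i t (0 - c i j * a%:Z).
have lu : lifts (Kbin i 0 t) (Uzeta_of l zeta u).
  by exists u; split=> //; rewrite uv (qKbinomE B zeta0).
apply: (shift_act1 sC (Kbin_uF B_factor lu lh)).
apply: (Kbin_act lh ww); rewrite sub0r -mulrN.
by rewrite cop_shift // qbinomE in se.
Qed.

(** On a weight vector the torus factors of the commutation formula are scalars,
    all of them Gaussian binomials with the same upper index. *)
Lemma uEF_act i (a b : nat) mu w : wt mu w -> exists e : nat -> k,
  (forall t, specializes zeta (qbin (vq i) (cop mu i + a%:Z - b%:Z) t) (e t)) /\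
  uE i a *: (uF i b *: w) =
    \sum_(t < a.+1) ks (e t) (uF_sub B l zeta i b t *: (uE i (a - t) *: w)).
Proof.
move=> ww; have [h [lh hE]] := uE_uF l zeta0 B_factor d_gt0 cartan_ii i a b.
have [lmu _ _] := ww.
pose e t := projT1 (cid (spec_qbin zeta0 (d_gt0 i) (cop mu i + a%:Z - b%:Z) t)).
have se t : specializes zeta (qbin (vq i) (cop mu i + a%:Z - b%:Z) t) (e t).
  exact: projT2 (cid _).
exists e; split=> //; apply: etrans (scalerA _ _ _) _.
apply: (sum_act sC hE) => t; apply: (Kbin_act (lh t) (wt_uE i (a - t) ww)).
rewrite cop_shift // cartan_ii.
have -> : cop mu i + 2 * (a - t)%N%:Z + (2 * t%:Z - a%:Z - b%:Z) = cop mu i + a%:Z - b%:Z.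
  have := ltn_ord t; lia.
exact: se.
Qed.

End WeightVectors.

(** * Squared lengths of roots and the triple bond *)
Section RootData.
Variables (R : archiRealFieldType) (E : vectType R) (ip : E -> E -> R).
Variables (Phi : seq E) (n : nat) (Pi : n.-tuple E).
Hypothesis ipP : inner_product ip.
Hypothesis rootP : root_system ip Phi.
Hypothesis indec : indecomposable ip Phi.
Hypothesis simpleP : simple_roots Phi Pi.
Hypothesis normP : normalized ip Phi.

Local Notation alpha i := (tnth Pi i).
Local Notation B := (gram ip Pi).
Local Notation d i := (half_norm B i).
Local Notation c i j := (cartan B i j).
Local Notation cop := (copairing ip).

Let ipC x y : ip x y = ip y x. Proof. by case: ipP. Qed.
Let ipl a x y z : ip (a *: x + y) z = a * ip x z + ip y z. Proof. by case: ipP. Qed.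
Let ip_gt0 x : x != 0 -> 0 < ip x x. Proof. by case: ipP => _ _; apply. Qed.

Let ipDl x y z : ip (x + y) z = ip x z + ip y z.
Proof. by rewrite -[x]scale1r ipl mul1r scale1r. Qed.
Let ip0l z : ip 0 z = 0.
Proof. by apply: (addrI (ip 0 z)); rewrite -ipDl !addr0. Qed.
Let ipZl a x z : ip (a *: x) z = a * ip x z.
Proof. by rewrite -[a *: x]addr0 ipl ip0l addr0. Qed.
Let ipNl x z : ip (- x) z = - ip x z.
Proof. by rewrite -scaleN1r ipZl mulN1r. Qed.
Let ipDr x y z : ip z (x + y) = ip z x + ip z y.
Proof. by rewrite !(ipC z) ipDl. Qed.
Let ipZr a x z : ip z (a *: x) = a * ip z x.
Proof. by rewrite !(ipC z) ipZl. Qed.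
Let ipNr x z : ip z (- x) = - ip z x.
Proof. by rewrite !(ipC z) ipNl. Qed.
Let ip_suml (J : finType) (F : J -> E) z : ip (\sum_j F j) z = \sum_j ip (F j) z.
Proof. by elim/big_rec2: _ => [|j y x _ <-]; rewrite ?ip0l ?ipDl. Qed.

Let Phi0 x : x \in Phi -> x != 0.
Proof. by move=> xP; apply/eqP => x0; case: rootP => /negP; rewrite -x0. Qed.
Let norm_gt0 x : x \in Phi -> 0 < ip x x.
Proof. by move=> /Phi0/ip_gt0. Qed.
Let refl_root a b : a \in Phi -> b \in Phi -> reflection ip a b \in Phi.
Proof. by case: rootP => _ _ h _ _; exact: h. Qed.
Let cop_int a b : a \in Phi -> b \in Phi -> exists z : int, cop b a = z%:~R.
Proof. by case: rootP => _ _ _ h _ aP bP; apply/intrP; exact: h. Qed.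
Let reduced a (x : R) : a \in Phi -> x *: a \in Phi -> x = 1 \/ x = -1.
Proof. by case: rootP => _ _ _ _ h; exact: h. Qed.

Let alphaP i : alpha i \in Phi.
Proof. by case: simpleP => _ h _ _; apply: h; exact: mem_tnth. Qed.
Let Pi_free : free Pi.
Proof. by case: simpleP => h _ _ _; exact: basis_free h. Qed.
Let coordE x : x = \sum_i coord Pi i x *: alpha i.
Proof.
case: simpleP => h _ _ _; rewrite [LHS](coord_basis h (memvf x)).
by apply: eq_bigr => i _; rewrite (tnth_nth 0).
Qed.
Let coord_alpha i j : coord Pi i (alpha j) = (i == j)%:R.
Proof. by rewrite (tnth_nth 0) coord_free // eq_sym. Qed.
Let ip_coord x y : ip x y = \sum_i coord Pi i x * ip (alpha i) y.
Proof. by rewrite {1}[x]coordE ip_suml; apply: eq_bigr => i _; rewrite ipZl. Qed.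
Let coord_int a i : a \in Phi -> exists z : int, coord Pi i a = z%:~R.
Proof. by case: simpleP => _ _ h _ aP; apply/intrP; exact: h. Qed.
Let coord_sign a : a \in Phi -> (forall i, 0 <= coord Pi i a) \/ (forall i, coord Pi i a <= 0).
Proof. by case: simpleP => _ _ _; apply. Qed.

Let short_exists : exists2 x, x \in Phi & ip x x = 2 /\ forall y, y \in Phi -> 2 <= ip y y.
Proof.
have [a aP] : exists a, a \in Phi.
  by case: indec => + _; case: (Phi) => // a s _; exists a; exact: mem_head.
have [x xP xmin] : exists2 x, x \in Phi & forall y, y \in Phi -> ip x x <= ip y y.
  elim: (Phi) a aP => // b s IH a _.
  case: s IH => [|b' s] IH.
    by exists b; rewrite ?mem_head // => y; rewrite inE => /eqP ->.
  have [x xs xmin] := IH b' (mem_head _ _).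
  case: (leP (ip b b) (ip x x)) => h.
    exists b; rewrite ?mem_head // => y; rewrite inE => /orP[/eqP -> //|/xmin].
    exact: le_trans.
  exists x; first by rewrite inE xs orbT.
  by move=> y; rewrite inE => /orP[/eqP ->|/xmin //]; exact: ltW.
have x2 : ip x x = 2 by apply: normP; split.
by exists x => //; split=> // y /xmin; rewrite x2.
Qed.

Let norm_refl a x : ip a a != 0 -> ip (reflection ip a x) (reflection ip a x) = ip x x.
Proof.
move=> a0; rewrite /reflection /copairing ipDl !ipDr !ipNl !ipNr !ipZl !ipZr (ipC a x).
by field.
Qed.

(* The reflection of a short root in a root not orthogonal to it is short again,
   so the roots orthogonal to all short roots form a separate component. *)
Let near_short b : b \in Phi -> exists2 x, x \in Phi & ip x x = 2 /\ ip b x != 0.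
Proof.
have [x0 x0P [x02 _]] := short_exists.
pose P := [pred y | has (fun x => (ip x x == 2) && (ip y x != 0)) Phi].
move=> bP; have [_ /(_ P)] := indec; case.
- move=> y z yP zP /hasP[x xP /andP[/eqP x2 yx]] /hasPn zn.
  have h w : w \in Phi -> ip w w = 2 -> ip z w = 0.
    by move=> wP w2; have := zn w wP; rewrite w2 eqxx negbK => /eqP.
  have ny : ip y y != 0 by rewrite gt_eqF // norm_gt0.
  have := h _ (refl_root yP xP); rewrite norm_refl // => /(_ x2).
  rewrite /reflection ipDr ipNr ipZr h // add0r => /eqP.
  rewrite oppr_eq0 mulf_eq0 => /orP[|/eqP]; last by rewrite ipC.
  rewrite /copairing !mulf_eq0 invr_eq0 (negbTE ny) (ipC x y) (negbTE yx).
  by rewrite pnatr_eq0 /=.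
- by move=> /allP/(_ b bP)/hasP[x xP /andP[/eqP x2 bx]]; exists x.
- move=> /allP/(_ x0 x0P) /= /hasPn/(_ x0 x0P).
  by rewrite x02 eqxx /= pnatr_eq0.
Qed.

Let cop_mul a b : a \in Phi -> b \in Phi -> ip b b * cop a b = 2 * ip a b.
Proof. by move=> aP bP; rewrite /copairing mulrC divfK // gt_eqF // norm_gt0. Qed.

Let cauchy_schwarz x y : y != 0 -> ip x y ^+ 2 <= ip x x * ip y y ?= iff (x == (ip x y / ip y y) *: y).
Proof.
move=> y0; have ny := ip_gt0 y0; set z := x - (ip x y / ip y y) *: y.
have zE : ip z z * ip y y = ip x x * ip y y - ip x y ^+ 2.
  rewrite /z ipDl !ipDr !ipNl !ipNr !ipZl !ipZr (ipC y x); field; exact: lt0r_neq0.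
split.
  rewrite -subr_ge0 -zE; apply: mulr_ge0; last exact: ltW.
  by have [->|/ip_gt0/ltW //] := eqVneq z 0; rewrite ip0l.
rewrite eq_sym -subr_eq0 -zE mulf_eq0 (gt_eqF ny) orbF -[RHS]subr_eq0 -/z.
have [->|z0] := eqVneq z 0; first by rewrite ip0l eqxx.
by rewrite gt_eqF // ip_gt0.
Qed.

(** Compare b with a short root x that is not orthogonal to it: the pairings
    (x, b^v) and (b, x^v) are nonzero integers with product less than 4, unless b
    and x are proportional, and their quotient is the ratio of the squared
    lengths. *)
Lemma root_norm b : b \in Phi -> exists2 m : int, ip b b = 2 * m%:~R & 1 <= m <= 3.
Proof.
move=> bP; have [x xP [x2 bx]] := near_short bP.
have [_ _ [_ nmin]] := short_exists.
have [za ea] := cop_int xP bP; have [zb eb] := cop_int bP xP.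
have Ea := cop_mul bP xP; have Eb := cop_mul xP bP.
rewrite x2 ea in Ea; rewrite eb ipC in Eb.
have {}Ea : ip b x = za%:~R by apply: (mulfI (_ : 2 != 0 :> R)); rewrite ?pnatr_eq0.
have nb := norm_gt0 bP; have nb2 := nmin _ bP.
have [cs csE] := cauchy_schwarz b (Phi0 xP).
rewrite x2 Ea in cs csE Eb.
have za0 : za != 0 by rewrite -(intr_eq0 R) -Ea.
have zb0 : zb != 0.
  apply: contra za0 => /eqP zb0; rewrite zb0 mulr0 in Eb.
  by move/esym/eqP: Eb; rewrite mulf_eq0 pnatr_eq0 /= intr_eq0.
have [E1|ne] := eqVneq (za%:~R ^+ 2) (ip b b * 2).
  move: csE; rewrite E1 eqxx => /esym/eqP bE.
  have := @reduced x (za%:~R / 2) xP; rewrite -bE => /(_ bP) z2.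
  exists 1 => //; rewrite mulr1.
  have zz : za%:~R = 2 :> R \/ za%:~R = - 2 :> R.
    by case: z2 => z2; [left | right]; lra.
  by case: zz => zz; rewrite zz in E1; lra.
have {cs ne} cs : za%:~R ^+ 2 < ip b b * 2 by rewrite lt_neqAle ne.
have p4 : (za * zb < 4)%R.
  rewrite -(ltr_int R) intrM -subr_gt0 -(pmulr_rgt0 _ nb) mulrBr mulrCA Eb.
  rewrite subr_gt0; move: cs; rewrite expr2; lra.
have p0 : (0 < za * zb)%R.
  rewrite -(ltr_int R) intrM -(pmulr_rgt0 _ nb) mulrCA Eb mulrCA.
  by rewrite pmulr_rgt0 // -expr2 exprn_even_gt0 //= intr_eq0.
have zz : (zb ^+ 2 <= za ^+ 2)%R.
  rewrite -(ler_int R) !rmorphXn /= -(ler_pM2l (_ : 0 < 4)) //.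
  have -> : 4 * za%:~R ^+ 2 = (ip b b * zb%:~R) ^+ 2 by rewrite Eb; ring.
  rewrite exprMn ler_wpM2r ?sqr_ge0 //; nra.
have zb1 : zb = 1 \/ zb = -1 by nia.
exists (za * zb); last by rewrite -gtz0_ge1 p0 -ltzD1.
rewrite intrM; move: Eb; case: zb1 => ->; rewrite ?rmorphN ?rmorph1; lra.
Qed.

Let floor_intr (z : int) : Num.floor (z%:~R : R) = z.
Proof. exact: intrKfloor. Qed.

Let alpha_norm i : ip (alpha i) (alpha i) = 2 * (d i)%:~R /\ 1 <= d i <= 3.
Proof.
have [m nm m3] := root_norm (alphaP i).
have Bii : B i i = 2 * m.
  by rewrite mxE /int_ip nm -[2 : R]/(2%:~R) -intrM floor_intr.
have dm : d i = m by rewrite /half_norm Bii mulKz.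
by rewrite dm.
Qed.

Lemma half_norm_gt0 i : 0 < d i.
Proof. have [_ h] := alpha_norm i; lia. Qed.

Let Bii i : B i i = 2 * d i.
Proof.
have [h _] := alpha_norm i.
by rewrite mxE /int_ip h -[2 : R]/(2%:~R) -intrM floor_intr.
Qed.

Let cartan_gram i j : [/\ ip (alpha i) (alpha j) = (B i j)%:~R,
  cop (alpha j) (alpha i) = (c i j)%:~R & B i j = d i * c i j].
Proof.
have [z hz] := cop_int (alphaP i) (alphaP j).
have := cop_mul (alphaP j) (alphaP i); rewrite hz; have [-> _] := alpha_norm i => h.
have h' : ip (alpha i) (alpha j) = (d i * z)%:~R.
  rewrite ipC intrM; apply: (mulfI (_ : 2 != 0 :> R)); first by rewrite pnatr_eq0.
  by rewrite -h mulrA.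
have Bz : B i j = d i * z by rewrite mxE /int_ip h' floor_intr.
have cz : c i j = z.
  rewrite /cartan Bz Bii mulrA mulrC mulzK //.
  by rewrite mulf_neq0 // gt_eqF // half_norm_gt0.
by split; rewrite ?cz // Bz.
Qed.

Lemma gram_factor i j : B i j = d i * c i j.
Proof. by have [] := cartan_gram i j. Qed.

Let gramC i j : B i j = B j i.
Proof.
apply/eqP; rewrite -(eqr_int R); have [<- _ _] := cartan_gram i j.
by have [<- _ _] := cartan_gram j i; rewrite ipC.
Qed.

Lemma cartan_diag i : c i i = 2.
Proof.
have h := gram_factor i i; rewrite Bii mulrC in h.
by apply: (mulfI (_ : d i != 0)); rewrite ?gt_eqF ?half_norm_gt0 // -h.
Qed.

Lemma cartan_offdiag i j : i != j -> c i j <= 0.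
Proof.
move=> ij; have := refl_root (alphaP i) (alphaP j); rewrite /reflection.
have [_ -> _] := cartan_gram i j => h.
have cj : coord Pi j (alpha j - (c i j)%:~R *: alpha i) = 1.
  by rewrite linearB linearZ /= !coord_alpha eqxx eq_sym (negbTE ij) mulr0 subr0.
have ci : coord Pi i (alpha j - (c i j)%:~R *: alpha i) = - (c i j)%:~R.
  by rewrite linearB linearZ /= !coord_alpha eqxx (negbTE ij) mulr1 sub0r.
case: (coord_sign h) => [/(_ i)|/(_ j)]; last by rewrite cj ler10.
by rewrite ci oppr_ge0 lerz0.
Qed.

Let cartan_sym i j : d i * c i j = d j * c j i.
Proof. by rewrite -!gram_factor gramC. Qed.

Let cartan_prod i j : i != j -> c i j * c j i <= 3.
Proof.
move=> ij; have aj := Phi0 (alphaP j).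
have := cauchy_schwarz (alpha i) aj; rewrite /Order.leif => -[le eqE].
have : ip (alpha i) (alpha j) ^+ 2 != ip (alpha i) (alpha i) * ip (alpha j) (alpha j).
  rewrite eqE; apply/eqP => h; have := congr1 (coord Pi i) h.
  by rewrite linearZ /= !coord_alpha eqxx (negbTE ij) mulr0 => /eqP; rewrite oner_eq0.
move=> ne; have lt : ip (alpha i) (alpha j) ^+ 2 < ip (alpha i) (alpha i) * ip (alpha j) (alpha j).
  by rewrite lt_neqAle ne.
have {}lt : B i j ^+ 2 < 4 * (d i * d j).
  rewrite -(ltr_int R) rmorphXn !intrM /=; move: lt.
  have [-> _ _] := cartan_gram i j; have [-> _] := alpha_norm i; have [-> _] := alpha_norm j.
  lra.
have h1 := gram_factor i j; have h2 := gram_factor j i; rewrite gramC in h2.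
have di := half_norm_gt0 i; have dj := half_norm_gt0 j.
have E2 : B i j ^+ 2 = d i * d j * (c i j * c j i) by rewrite expr2 {1}h1 h2; ring.
have dd : 0 < d i * d j by rewrite mulr_gt0.
by rewrite E2 in lt; nia.
Qed.

Let cartan_eq0 i j : (c i j == 0) = (c j i == 0).
Proof.
have h := cartan_sym i j; have di := half_norm_gt0 i; have dj := half_norm_gt0 j.
by apply/eqP/eqP => h0; nia.
Qed.

Section Support.
Variable J : pred 'I_n.
Hypothesis J_orth : forall i j, J i -> ~~ J j -> c i j = 0.

Let J_orth_ip i j : J i -> ~~ J j -> ip (alpha i) (alpha j) = 0.
Proof. by move=> Ji Jj; have [-> _ ->] := cartan_gram i j; rewrite J_orth ?mulr0. Qed.

Let cop_part i x : cop x (alpha i) = \sum_j coord Pi j x * (c i j)%:~R.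
Proof.
rewrite {1}[x]coordE /copairing ip_suml mulr_sumr mulr_suml; apply: eq_bigr => j _.
rewrite ipZl; have [_ <- _] := cartan_gram i j; rewrite /copairing; ring.
Qed.

(* A positive root supported on both sides could be lowered by simple
   reflections forever without leaving this situation. *)
Let no_mixed x i j : x \in Phi -> (forall k, 0 <= coord Pi k x) ->
  J i -> ~~ J j -> coord Pi i x != 0 -> coord Pi j x != 0 -> False.
Proof.
have [h hx] : exists h : nat, \sum_k coord Pi k x < h%:R.
  exists (Num.bound `|\sum_k coord Pi k x|); apply: le_lt_trans (ler_norm _) _.
  exact/archi_boundP/normr_ge0.
elim: h x hx i j => [|h IH] x hx i j xP pos Ji Jj xi xj.
  by have : 0 <= \sum_k coord Pi k x by [apply: sumr_ge0 => k _; exact: pos]; rewrite leNgt hx.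
have xx : 0 < ip x x by exact: norm_gt0.
have [m /andP[xm ipm]] : exists m, (0 < coord Pi m x) && (0 < ip (alpha m) x).
  apply/existsP; apply: contraLR xx; rewrite negb_exists => /forallP none.
  rewrite -leNgt {1}[x]coordE ip_suml; apply: sumr_le0 => m _; rewrite ipZl.
  have := none m; rewrite negb_and -!leNgt => /orP[le0|le0].
    have -> : coord Pi m x = 0 by apply/eqP; rewrite eq_le le0 pos.
    by rewrite mul0r.
  by rewrite mulr_ge0_le0.
have [z hz] := cop_int (alphaP m) xP.
have z0 : (0 < z)%R.
  rewrite -(ltr_int R) -hz /copairing ipC divr_gt0 ?norm_gt0 //.
  by rewrite mulr_gt0.
pose y := x - z%:~R *: alpha m.
have yP : y \in Phi by have := refl_root (alphaP m) xP; rewrite /reflection hz.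
have ycoord k : coord Pi k y = coord Pi k x - z%:~R * (k == m)%:R.
  by rewrite /y linearB linearZ /= coord_alpha.
have survivor (Q : pred 'I_n) : Q m -> (forall k, ~~ Q k -> c m k = 0) ->
    exists k, Q k && (coord Pi k y != 0).
  move=> Qm Q0; apply/existsP; apply: contraT; rewrite negb_exists => /forallP none.
  have zz : z%:~R = z%:~R * 2 :> R.
    rewrite -{1}hz cop_part (bigD1 m) //= cartan_diag big1 ?addr0 => [|k km].
      have := none m; rewrite Qm negbK ycoord eqxx mulr1 subr_eq0 => /eqP ->.
      by [].
    case: (boolP (Q k)) => [Qk|/Q0 ->]; last by rewrite mulr0.
    have := none k; rewrite Qk negbK ycoord (negbTE km) mulr0 subr0 => /eqP ->.
    by rewrite mul0r.
  have : (z%:~R : R) != 0 by rewrite intr_eq0 gt_eqF.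
  by move/eqP: zz; rewrite -subr_eq0 mulr_natr mulr2n opprD addNKr oppr_eq0 => ->.
have far k : k != m -> coord Pi k y = coord Pi k x.
  by move=> km; rewrite ycoord (negbTE km) mulr0 subr0.
have ij : i != j by apply: contraNneq Jj => <-.
have yheight : \sum_k coord Pi k y < h%:R.
  rewrite (eq_bigr _ (fun k _ => ycoord k)) big_split /= sumrN -mulr_sumr.
  have -> : \sum_k (k == m)%:R = 1 :> R.
    by rewrite (bigD1 m) //= eqxx big1 ?addr0 // => k /negbTE ->.
  rewrite mulr1.
  have : (1%:~R <= z%:~R :> R) by rewrite ler_int -gtz0_ge1.
  move: hx; rewrite -natr1; lra.
have ypos : forall k, 0 <= coord Pi k y.
  case: (coord_sign yP) => // neg; case: (eqVneq m i) => [mi|im].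
    have := neg j; rewrite far ?mi 1?eq_sym // => le0.
    by case/eqP: xj; apply/eqP; rewrite eq_le le0 pos.
  have := neg i; rewrite far 1?eq_sym // => le0.
  by case/eqP: xi; apply/eqP; rewrite eq_le le0 pos.
case: (boolP (J m)) => Jm.
  have [|k /andP[Jk yk]] := survivor J Jm; first by move=> k; exact: J_orth.
  apply: (IH y yheight k j) => //.
  by rewrite far //; apply: contraNneq Jj => ->.
have [|k /andP[Jk yk]] := survivor (predC J) Jm.
  by move=> k /negPn Jk; apply/eqP; rewrite cartan_eq0; apply/eqP/J_orth.
apply: (IH y yheight i k) => //.
by rewrite far //; apply: contraNneq Jm => <-.
Qed.

(** The roots supported on J and those supported off J are orthogonal, and by
    no_mixed there are no others, so indecomposability leaves one of the two
    classes empty. *)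
Lemma connected_simple_roots i j : J i -> J j.
Proof.
move=> Ji; apply: contraT => Jj.
pose P := [pred x | [forall k, J k || (coord Pi k x == 0)]].
have [_ /(_ P)] := indec; case.
- move=> x y xP yP /forallP Px; rewrite negb_forall => /existsP[k].
  rewrite negb_or => /andP[Jk yk].
  have y0 m : J m -> coord Pi m y = 0.
    move=> Jm; apply/eqP; apply: contraT => ym; exfalso.
    case: (coord_sign yP) => sgn; first exact: (@no_mixed y m k).
    have NyP : - y \in Phi.
      have := refl_root yP yP; rewrite /reflection /copairing mulfK ?gt_eqF ?norm_gt0 //.
      by rewrite -[X in X - _](scale1r y) -scalerBl (_ : 1 - 2 = -1) ?scaleN1r //; ring.
    apply: (@no_mixed (- y) m k) => //; rewrite ?linearN ?oppr_eq0 //.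
    by move=> l; rewrite linearN oppr_ge0; exact: sgn.
  rewrite [x]coordE ip_suml big1 // => m _; rewrite ipZl.
  case/orP: (Px m) => [Jm|/eqP ->]; last by rewrite mul0r.
  rewrite ipC [y]coordE ip_suml big1 ?mulr0 // => l _; rewrite ipZl.
  have [Jl|Jl] := boolP (J l); first by rewrite y0 ?mul0r.
  by rewrite (ipC (alpha l)) J_orth_ip ?mulr0.
- move=> /allP/(_ _ (alphaP j))/forallP/(_ j).
  by rewrite (negbTE Jj) coord_alpha eqxx oner_eq0.
- move=> /allP/(_ _ (alphaP i))/negP[]; apply/forallP => k.
  by rewrite coord_alpha; case: (eqVneq k i) => [->|_]; rewrite ?Ji ?eqxx ?orbT.
Qed.

End Support.

Lemma cartan_bound i j : i != j -> (`|c i j| <= 3)%N.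
Proof.
move=> ij; have p3 := cartan_prod ij; have c1 := cartan_offdiag ij.
have ji : j != i by rewrite eq_sym.
have c2 := cartan_offdiag ji; have z : c j i = 0 -> c i j = 0.
  by move=> h; apply/eqP; rewrite cartan_eq0 h.
move: p3 c1 c2 z; move: (c i j) (c j i); clear => x y p3 x0 y0 z.
have [/z -> //|y1] := eqVneq y 0; nia.
Qed.

(* In a system of rank at least 3, a third simple root attached to a triple
   bond would violate the positivity of the inner product. *)
Let triple_bond_isolated i j k : i != k -> j != k -> d i = 3 -> d j = 1 -> c i j = -1 ->
  c i k = 0 /\ c j k = 0.
Proof.
move=> ik jk di dj cij.
have [ipik _ Bik] := cartan_gram i k; have [ipjk _ Bjk] := cartan_gram j k.
have [ipij _ Bij] := cartan_gram i j.
have [nk dk] := alpha_norm k; have [ni _] := alpha_norm i; have [nj _] := alpha_norm j.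
have sik := cartan_sym i k; have sjk := cartan_sym j k.
have cik := cartan_offdiag ik; have cjk := cartan_offdiag jk.
have cki : c k i <= 0 by apply: cartan_offdiag; rewrite eq_sym.
have ckj : c k j <= 0 by apply: cartan_offdiag; rewrite eq_sym.
set u : R := (c j k)%:~R; set w : R := (c i k)%:~R.
(* The component of alpha k orthogonal to alpha i and alpha j *)
pose z := alpha k - (2 * u + 3 * w) *: alpha j - (u + 2 * w) *: alpha i.
have z0 : z != 0.
  apply/eqP => /(congr1 (coord Pi k)); rewrite /z !linearB !linearZ /= linear0 !coord_alpha.
  rewrite eqxx (eq_sym k) (negbTE jk) (eq_sym k) (negbTE ik) !mulr0 !subr0 => /eqP.
  by rewrite oner_eq0.
have := ip_gt0 z0.
have -> : ip z z = 2 * (d k)%:~R - 2 * u ^+ 2 - 6 * u * w - 6 * w ^+ 2.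
  rewrite /z !(ipDl, ipNl, ipZl) !(ipDr, ipNr, ipZr).
  rewrite (ipC (alpha k) (alpha j)) (ipC (alpha k) (alpha i)) (ipC (alpha j) (alpha i)).
  rewrite ipij ipik ipjk ni nj nk di dj Bij Bik Bjk di dj cij !intrM -/u -/w.
  ring.
have -> : 2 * (d k)%:~R - 2 * u ^+ 2 - 6 * u * w - 6 * w ^+ 2 =
    (2 * d k - 2 * c j k ^+ 2 - 6 * c j k * c i k - 6 * c i k ^+ 2)%:~R.
  by rewrite /u /w; ring.
rewrite ltr0z => pos; rewrite di in sik; rewrite dj in sjk.
move: pos sik sjk cik cjk cki ckj dk.
move: (d k) (c i k) (c j k) (c k i) (c k j); clear => D x y x' y' pos sx sy x0 y0 x'0 y'0 D3.
have y1 : y = 0.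
  have [//|yn] := eqVneq y 0; have y2 : y' <= -1 by nia.
  have : D * D <= y ^+ 2 by rewrite -[y]mul1r sy; nia.
  nia.
have [//|xn] := eqVneq x 0; have x2 : x' <= -1 by nia.
by nia.
Qed.

(** If all simple roots had squared length 6, then 6 would divide every squared
    length, but 2 occurs. So by connectedness some simple root of squared
    length 6 is joined to one of another length; the bond is triple, and as
    nothing else is attached to it the rank is 2. *)
Lemma long_type_G2 i : d i = 3 -> type_G2 ip Pi.
Proof.
move=> di; have [x xP [x2 _]] := short_exists.
have not_all : ~ forall j, d j = 3.
  move=> d3; have : exists z : int, ip x x = 3 * z%:~R.
    have int_sum (F : 'I_n -> R) : (forall j, exists z : int, F j = 3 * z%:~R) ->
        exists z : int, \sum_j F j = 3 * z%:~R.
      move=> h; apply: (big_ind (fun y : R => exists z : int, y = 3 * z%:~R)) => //.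
        by exists 0; rewrite mulr0.
      by move=> _ _ [z ->] [z' ->]; exists (z + z'); rewrite intrD mulrDr.
    rewrite ip_coord; apply: (int_sum) => j; have [m ->] := coord_int j xP.
    have [z ->] : exists z : int, ip (alpha j) x = 3 * z%:~R.
      rewrite ipC ip_coord; apply: int_sum => k; have [m' ->] := coord_int k xP.
      have [-> _ ->] := cartan_gram k j; rewrite d3.
      by exists (m' * c k j); rewrite !intrM; ring.
    by exists (m * z); rewrite intrM; ring.
  move=> [z]; rewrite x2 => h; have : (2 : int) = 3 * z by apply/eqP; rewrite -(eqr_int R) intrM -h.
  lia.
have [j [k [dj dk jk]]] : exists j k, [/\ d j = 3, d k != 3 & c j k != 0].
  apply: contrapT => none; apply: not_all => j; apply/eqP.
  apply: (@connected_simple_roots [pred m | d m == 3] _ i j) => /=; last by rewrite di.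
  move=> a b /eqP da db; apply/eqP; apply: contraT => ab; case: none.
  by exists a, b; split.
have kj : k != j by apply: contraNneq dk => ->; rewrite dj.
have jk' : j != k by rewrite eq_sym.
have [ckj cjk dk1] : [/\ c k j = -3, c j k = -1 & d k = 1].
  have := cartan_sym j k; have := cartan_prod jk'; have := cartan_offdiag jk'.
  have := cartan_offdiag kj; have [_ dk3] := alpha_norm k; rewrite dj.
  move: dk3 dk jk; move: (d k) (c j k) (c k j); clear => D x y D3 Dn xn y0 x0 p3 E.
  have [D1|D2] : D = 1 \/ D = 2 by lia.
    by subst D; have x1 : x = -1 by [nia]; split; lia.
  exfalso; subst D; have : x <= -2 by lia.
  by nia.
have out m : (m == j) || (m == k).
  pose Q := [pred m | (m == j) || (m == k)].
  apply: (@connected_simple_roots Q _ j) => /=; last by rewrite eqxx.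
  move=> a b Qa; rewrite negb_or => /andP[bj bk].
  have [h1 h2] : c j b = 0 /\ c k b = 0.
    by apply: triple_bond_isolated => //; rewrite eq_sym.
  by case/orP: Qa => /eqP ->.
split; last first.
  exists k, j; split.
    by have [_ -> _] := cartan_gram j k; rewrite cjk.
  by have [_ -> _] := cartan_gram k j; rewrite ckj.
have <- : #|[set j; k]| = n.
  rewrite -[RHS]card_ord -cardsT; congr #|pred_of_set _|.
  by apply/setP => m; rewrite !inE out.
by rewrite cards2 jk'.
Qed.

Lemma triple_type_G2 i j : i != j -> (2 < `|c i j|)%N -> type_G2 ip Pi.
Proof.
move=> ij c3; apply: (@long_type_G2 j).
have ji : j != i by rewrite eq_sym.
have := cartan_sym i j; have := cartan_prod ij; have := cartan_offdiag ij.
have := cartan_offdiag ji; have [_ +] := alpha_norm i; have [_ +] := alpha_norm j.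
move: c3; move: (d i) (d j) (c i j) (c j i); clear => D D' x y c3 D'3 D3 y0 x0 p3 E.
have y1 : y = -1 by nia.
by subst y; nia.
Qed.

Lemma copairingD x y a : cop (x + y) a = cop x a + cop y a.
Proof. by rewrite /copairing ipDl mulrDr mulrDl. Qed.
Lemma copairing_int x (m : int) a : cop (x *~ m) a = m%:~R * cop x a.
Proof. by rewrite /copairing -scaler_int ipZl; ring. Qed.

Lemma lattice_shift mu j (m : int) : weight_lattice ip Phi mu ->
  weight_lattice ip Phi (mu + alpha j *~ m).
Proof.
move=> h a aP; rewrite copairingD copairing_int rpredD ?h // rpredM ?intr_int //.
by have [z ->] := cop_int aP (alphaP j); rewrite intr_int.
Qed.

Lemma int_copairingE mu i : weight_lattice ip Phi mu ->
  (int_copairing ip mu (alpha i))%:~R = cop mu (alpha i).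
Proof. by rewrite /int_copairing => /(_ _ (alphaP i))/intrP[z ->]; rewrite floor_intr. Qed.

Lemma int_copairing_shift mu i j (m : int) : weight_lattice ip Phi mu ->
  int_copairing ip (mu + alpha j *~ m) (alpha i) = int_copairing ip mu (alpha i) + c i j * m.
Proof.
move=> h; apply/eqP; rewrite -(eqr_int R) int_copairingE; last exact: lattice_shift.
rewrite copairingD copairing_int intrD int_copairingE // intrM.
by have [_ -> _] := cartan_gram i j; rewrite mulrC.
Qed.

Lemma int_ip_copairing mu i : weight_lattice ip Phi mu ->
  int_ip ip mu (alpha i) = d i * int_copairing ip mu (alpha i).
Proof.
move=> h; rewrite /int_ip.
suff -> : ip mu (alpha i) = (d i * int_copairing ip mu (alpha i))%:~R by exact: floor_intr.
rewrite intrM int_copairingE // /copairing; have [-> _] := alpha_norm i.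
by field; rewrite intr_eq0 gt_eqF // half_norm_gt0.
Qed.

Lemma simple_root_wsum_inj (a b : 'I_n -> nat) :
  \sum_i alpha i *+ a i = \sum_i alpha i *+ b i -> a =1 b.
Proof.
move=> h i; have := congr1 (coord Pi i) h.
have coordF (f : 'I_n -> nat) : coord Pi i (\sum_j alpha j *+ f j) = (f i)%:R.
  rewrite linear_sum (bigD1 i) //= linearMn /= coord_alpha eqxx big1 ?addr0 // => j ji.
  by rewrite linearMn /= coord_alpha eq_sym (negbTE ji) mul0rn.
by rewrite !coordF => /eqP; rewrite eqr_nat => /eqP.
Qed.

Lemma half_norm_le3 i : d i <= 3.
Proof. by have [_ /andP[]] := alpha_norm i. Qed.

End RootData.

(** * Small generators act irreducibly *)
Section RestrictedSimple.
Variables (k : fieldType) (U : pzRingType) (s : {rmorphism k -> U}) (V : lmodType U).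
Hypothesis sC : forall c x, x * s c = s c * x.
Variables (I : finType) (e f : I -> nat -> U).
Variables (W : zmodType) (alpha : I -> W) (wt : W -> V -> Prop).

Hypothesis wtD : forall mu x y, wt mu x -> wt mu y -> wt mu (x + y).
Hypothesis wtZ : forall mu c x, wt mu x -> wt mu (s c *: x).
Hypothesis wt_e : forall mu x i a, wt mu x -> wt (mu + alpha i *+ a) (e i a *: x).
Hypothesis wt_f : forall mu x i a, wt mu x -> wt (mu - alpha i *+ a) (f i a *: x).
Hypothesis wt_sum : forall x : V, exists (r : seq W) (w : W -> V),
  (forall mu, mu \in r -> wt mu (w mu)) /\ x = \sum_(mu <- r) w mu.
Hypothesis wt_indep : forall (r : seq W) (w : W -> V), uniq r ->
  (forall mu, mu \in r -> wt mu (w mu)) ->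
  \sum_(mu <- r) w mu = 0 -> forall mu, mu \in r -> w mu = 0.

(** The graded submodules are those M contained in hspan M; simplicity is assumed
    with respect to them only. *)
Inductive hspan (M : V -> Prop) : V -> Prop :=
| hspan0 : hspan M 0
| hspanD x y : hspan M x -> hspan M y -> hspan M (x + y)
| hspanw mu x : wt mu x -> M x -> hspan M x.

Hypothesis simple_graded : forall M : V -> Prop, M 0 ->
  (forall x y, M x -> M y -> M (x + y)) -> (forall c x, M x -> M (s c *: x)) ->
  (forall i a x, M x -> M (e i a *: x)) -> (forall i a x, M x -> M (f i a *: x)) ->
  (forall x, M x -> hspan M x) ->
  (forall x, M x -> x = 0) \/ (forall x, M x).

Definition wsum (c : I -> nat) : W := \sum_i alpha i *+ c i.
Hypothesis wsum_inj : forall c c', wsum c = wsum c' -> c =1 c'.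

Hypothesis e0 : forall i, e i 0 = 1.
Hypothesis f0 : forall i, f i 0 = 1.
Hypothesis eC : forall i a b, e i a * e i b = e i b * e i a.
Hypothesis fC : forall i a b, f i a * f i b = f i b * f i a.
Hypothesis fM : forall i a b, exists c, f i a * f i b = s c * f i (a + b).
Hypothesis efC : forall i j a b, i != j -> e i a * f j b = f j b * e i a.

Definition fsub i b t : U := if (t <= b)%N then f i (b - t) else 0.
Hypothesis ef_act : forall i a b mu x, wt mu x -> exists c : nat -> k,
  e i a *: (f i b *: x) = \sum_(t < a.+1) s (c t) *: (fsub i b t *: (e i (a - t) *: x)).

Variables (lambda : W) (v : V).
Hypothesis v0 : v != 0.
Hypothesis wt_v : wt lambda v.
Hypothesis e_v : forall i a, (0 < a)%N -> e i a *: v = 0.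

(* G is the set of exponents of the generators of the small subring, N bounds the
   exponents of the divided powers that they generate, and D i j is the order in
   i of the Serre relation between i and j. *)
Variables (N : nat) (G : nat -> Prop) (D : I -> I -> nat).
Hypothesis v_restricted : forall i, exists m, (m < N)%N /\
  forall a b, (m < b <= m + a)%N -> e i a *: (f i b *: v) = 0.
Hypothesis G_gt0 : forall a, G a -> (0 < a)%N.
Hypothesis e_gen : forall i n, (0 < n < N)%N -> exists a c,
  [/\ G a, (a <= n)%N & e i n = s c * (e i a * e i (n - a))].
Hypothesis f_gen : forall i n, (0 < n < N)%N -> exists a c,
  [/\ G a, (a <= n)%N & f i n = s c * (f i a * f i (n - a))].
Hypothesis G_small : forall i j a, i != j -> G a -> (a * D i j < N)%N.
Hypothesis f_serre : forall i j a n, i != j -> exists (C : nat -> k) (b : nat -> nat -> k),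
  f i n * f j a = \sum_(t < n.+1 | (t <= a * D i j)%N)
    s (C t) * ((\sum_(r < t.+1) s (b t r) * (f i (t - r) * f j a * f i r)) * f i (n - t)).
Hypothesis e_serre : forall i j a n, i != j -> exists (C : nat -> k) (b : nat -> nat -> k),
  e j a * e i n = \sum_(t < n.+1 | (t <= a * D i j)%N)
    s (C t) * (e i (n - t) * (\sum_(r < t.+1) s (b t r) * (e i (t - r) * e j a * e i r))).

Let sA c (u : U) (x : V) : u *: (s c *: x) = s c *: (u *: x).
Proof. by rewrite !scalerA sC. Qed.
Let sN (x : V) : - x = s (-1) *: x.
Proof. by rewrite rmorphN rmorph1 scaleN1r. Qed.

Lemma wsum0 : wsum (fun=> 0%N) = 0.
Proof. by rewrite /wsum big1. Qed.

Definition cadd (c : I -> nat) (i : I) (a : nat) : I -> nat :=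
  fun j => (c j + (if j == i then a else 0))%N.

Lemma wsum_add c i a : wsum (cadd c i a) = wsum c + alpha i *+ a.
Proof.
rewrite /wsum (eq_bigr (fun j => alpha j *+ c j + if j == i then alpha i *+ a else 0)).
  by rewrite big_split /= -big_mkcond big_pred1_eq.
by move=> j _; rewrite /cadd mulrnDr; case: eqP => [->|].
Qed.

(** A complement of the line of v: an element outside low has a nonzero component
    along v (top_component). *)
Definition low : V -> Prop := hspan (fun x => exists2 mu, mu != lambda & wt mu x).

Lemma hspan_sum M (J : Type) (r : seq J) (P : pred J) (F : J -> V) :
  (forall j, P j -> hspan M (F j)) -> hspan M (\sum_(j <- r | P j) F j).
Proof.
by move=> h; elim/big_ind: _ => //; [exact: hspan0 | exact: hspanD].
Qed.

Lemma lowZ c x : low x -> low (s c *: x).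
Proof.
elim=> {x} [|x y _ IHx _ IHy|mu x wx [nu ne wnu]].
- by rewrite scaler0; exact: hspan0.
- by rewrite scalerDr; exact: hspanD.
by apply: (hspanw (wtZ c wx)); exists nu => //; exact: wtZ.
Qed.

Lemma lowN x : low x -> low (- x).
Proof. by rewrite sN; exact: lowZ. Qed.

Lemma low_wt mu x : mu != lambda -> wt mu x -> low x.
Proof. by move=> ne wx; apply: hspanw (wx) _; exists mu. Qed.

Lemma wt_sum_uniq x : exists (r : seq W) (w : W -> V), [/\ uniq r,
  forall mu, mu \in r -> wt mu (w mu) & x = \sum_(mu <- r) w mu].
Proof.
have [r [w [wr ->]]] := wt_sum x.
exists (undup r), (fun mu => w mu *+ count_mem mu r); split; first exact: undup_uniq.
  move=> mu; rewrite mem_undup => /wr wmu.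
  have <- : s (count_mem mu r)%:R *: w mu = w mu *+ count_mem mu r.
    by rewrite rmorph_nat scaler_nat.
  exact: wtZ.
by rewrite -big_undup_iterop_count.
Qed.

Lemma low_seq x : low x -> exists (r : seq W) (w : W -> V), [/\ uniq r,
  forall mu, mu \in r -> mu != lambda /\ wt mu (w mu) & x = \sum_(mu <- r) w mu].
Proof.
elim=> {x} [|x y _ [r [w [ur wr ->]]] _ [r' [w' [ur' wr' ->]]]|mu x _ [nu ne wx]].
- by exists [::], (fun=> 0); split=> //; rewrite big_nil.
- pose R := undup (r ++ r').
  have ext (t : seq W) (u : W -> V) : uniq t -> {subset t <= R} ->
      \sum_(mu <- t) u mu = \sum_(mu <- R) if mu \in t then u mu else 0.
    move=> ut tR; rewrite -big_mkcond -big_filter; apply: perm_big; apply: uniq_perm => //.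
      by rewrite filter_uniq // undup_uniq.
    move=> mu; rewrite mem_filter; case: (boolP (mu \in t)) => //= mt.
    by rewrite tR.
  exists R, (fun mu => (if mu \in r then w mu else 0) + (if mu \in r' then w' mu else 0)).
  split; first exact: undup_uniq.
    move=> mu; rewrite mem_undup mem_cat.
    case: ifP => [/wr[ne wmu]|_]; case: ifP => [/wr'[ne' wmu']|_] //= _.
    - by split=> //; exact: wtD.
    - by rewrite addr0.
    - by rewrite add0r.
  rewrite big_split /= -!ext // => mu mr; rewrite mem_undup mem_cat mr ?orbT //.
- exists [:: nu], (fun=> x); split=> //; last by rewrite big_seq1.
  by move=> eta; rewrite inE => /eqP ->.
Qed.

Lemma v_notin_low : ~ low v.
Proof.
move=> /low_seq[r [w [ur wr vE]]].
have lr : lambda \notin r by apply/negP => /wr[]; rewrite eqxx.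
pose w' mu := if mu == lambda then - v else w mu.
have /= := @wt_indep (lambda :: r) w' _ _ _ lambda (mem_head _ _).
rewrite /w' eqxx => /(_ _ _ _)/eqP; rewrite oppr_eq0 (negbTE v0) => h.
suff : false by []; apply: h.
- by rewrite lr.
- move=> mu; rewrite inE; case: eqP => [->|_] /= h.
    by rewrite sN; exact: wtZ.
  by have [] := wr _ h.
rewrite big_cons eqxx (eq_big_seq w) -?vE ?addNr // => mu mr.
by case: eqP => // lm; rewrite -lm mr in lr.
Qed.

(** In eword H m c x, the word x has m letters, with exponents in H, and c i is the
    sum of the exponents of its letters of index i; likewise in fword. *)
Inductive eword (H : nat -> Prop) : nat -> (I -> nat) -> U -> Prop :=
| eword1 : eword H 0 (fun=> 0%N) 1
| ewordM m c x i a : H a -> eword H m c x -> eword H m.+1 (cadd c i a) (x * e i a).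

Lemma eword_wt H m c x mu y : eword H m c x -> wt mu y -> wt (mu + wsum c) (x *: y).
Proof.
move=> h; elim: h mu y => {m c x} [|m c x i a _ _ IH] mu y wy.
  by rewrite wsum0 addr0 scale1r.
rewrite wsum_add -scalerA [wsum c + _]addrC addrA; apply: IH; exact: wt_e.
Qed.

Lemma eword_mul H m c x m' c' x' : eword H m c x -> eword H m' c' x' ->
  exists c'', eword H (m + m') c'' (x * x').
Proof.
move=> hx; elim=> {m' c' x'} [|m' c' x' i a Ha _ [c'' IH]].
  by exists c; rewrite addn0 mulr1.
by exists (cadd c'' i a); rewrite addnS mulrA; exact: ewordM.
Qed.

Lemma cadd_sum c i a : (\sum_j cadd c i a j = \sum_j c j + a)%N.
Proof. by rewrite big_split /= -big_mkcond big_pred1_eq. Qed.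

Lemma eword_size H m c x : (forall a, H a -> (0 < a)%N) -> eword H m c x ->
  (m <= \sum_j c j)%N.
Proof.
move=> H0; elim=> {m c x} // m c x i a Ha _ IH.
by rewrite cadd_sum -addn1 leq_add // H0.
Qed.

Inductive fword (H : nat -> Prop) : (I -> nat) -> V -> Prop :=
| fword_v : fword H (fun=> 0%N) v
| fwordM c i a x : H a -> fword H c x -> fword H (cadd c i a) (f i a *: x).

Inductive fspan (H : nat -> Prop) : V -> Prop :=
| fspan0 : fspan H 0
| fspanD x y : fspan H x -> fspan H y -> fspan H (x + y)
| fspanw b c x : fword H c x -> fspan H (s b *: x).

Lemma fword_closed H c x (M : V -> Prop) : fword H c x -> M v ->
  (forall i a y, H a -> M y -> M (f i a *: y)) -> M x.
Proof. by move=> hx Mv Mf; elim: hx => // {c x} c i a x Ha _; exact: Mf. Qed.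

Lemma fspan_word H c x : fword H c x -> fspan H x.
Proof. by move=> h; rewrite -[x]scale1r -(rmorph1 s); exact: fspanw h. Qed.

Lemma fspanZ H b x : fspan H x -> fspan H (s b *: x).
Proof.
elim=> {x} [|x y _ IHx _ IHy|b' c x hx].
- by rewrite scaler0; exact: fspan0.
- by rewrite scalerDr; exact: fspanD.
by rewrite scalerA -rmorphM; exact: fspanw hx.
Qed.

Lemma fspanf (H : nat -> Prop) i a x : H a -> fspan H x -> fspan H (f i a *: x).
Proof.
move=> Ha; elim=> {x} [|x y _ IHx _ IHy|b c x hx].
- by rewrite scaler0; exact: fspan0.
- by rewrite scalerDr; exact: fspanD.
by rewrite sA; apply: fspanw (fwordM i Ha hx).
Qed.

Lemma fspan_sum H (J : Type) (r : seq J) (P : pred J) (F : J -> V) :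
  (forall j, P j -> fspan H (F j)) -> fspan H (\sum_(j <- r | P j) F j).
Proof.
by move=> h; elim/big_ind: _ => //; [exact: fspan0 | exact: fspanD].
Qed.

Lemma fspan_op H (P : V -> Prop) (u : U) : P 0 -> (forall x y, P x -> P y -> P (x + y)) ->
  (forall b x, P x -> P (s b *: x)) -> (forall c x, fword H c x -> P (u *: x)) ->
  forall x, fspan H x -> P (u *: x).
Proof.
move=> P0 PD PZ Pw x; elim=> {x} [|x y _ IHx _ IHy|b c x hx].
- by rewrite scaler0.
- by rewrite scalerDr; exact: PD.
by rewrite sA; apply: PZ; exact: Pw hx.
Qed.

Lemma fword_wt H c x : fword H c x -> wt (lambda - wsum c) x.
Proof.
elim=> {c x} [|c i a x _ _ IH]; first by rewrite wsum0 subr0.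
by rewrite wsum_add opprD addrA; exact: wt_f.
Qed.

Let anyN : nat -> Prop := fun=> True.

Lemma fspan_e i a x : fspan anyN x -> fspan anyN (e i a *: x).
Proof.
apply: fspan_op; [exact: fspan0 | exact: fspanD | exact: fspanZ |] => c {}x hx.
elim: hx i a => {c x} [|c j b x _ hx IH] i a.
  case: (posnP a) => [->|a0]; last by rewrite e_v //; exact: fspan0.
  by rewrite e0 scale1r; apply: fspan_word (fword_v _).
case: (eqVneq i j) => [<-|ij]; last first.
  by rewrite scalerA efC // -scalerA; apply: fspanf.
have [b' ->] := ef_act i a b (fword_wt hx).
apply: fspan_sum => t _; apply: fspanZ; rewrite /fsub; case: leqP => _.
  exact: fspanf.
by rewrite scale0r; exact: fspan0.
Qed.

(** The span of the words is a nonzero graded submodule: the e i a preserve it by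
    the commutation formula. *)
Lemma fspan_all x : fspan anyN x.
Proof.
have graded y : fspan anyN y -> hspan (fspan anyN) y.
  elim=> {y} [|y z _ IHy _ IHz|b c y hy]; [exact: hspan0 | exact: hspanD |].
  by apply: (hspanw (wtZ b (fword_wt hy))); exact: fspanw hy.
have fspanf' i a y := @fspanf anyN i a y Logic.I.
have [h|//] := simple_graded (fspan0 _) (@fspanD _) (@fspanZ _) fspan_e fspanf' graded.
by case/eqP: v0; apply: h; apply: fspan_word (fword_v _).
Qed.

Lemma low_shift c c' x : wt (lambda - wsum c + wsum c') x -> ~ (c =1 c') -> low x.
Proof.
move=> wx ne; apply: low_wt wx; apply/eqP => E; apply: ne; apply: wsum_inj.
by apply/esym/(addrI (lambda - wsum c)); rewrite E addrNK.
Qed.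

Lemma f_low i a x : (0 < a)%N -> low (f i a *: x).
Proof.
move=> a0; apply: (fspan_op (H := anyN)) (fspan_all x); [exact: hspan0 | exact: hspanD | exact: lowZ |].
move=> c {}x hx; have wx := fword_wt (fwordM (H := anyN) i (a := a) Logic.I hx).
apply: (@low_shift (cadd c i a) (fun=> 0%N)); first by rewrite wsum0 addr0.
by move=> /(_ i); rewrite /cadd eqxx; lia.
Qed.

Lemma top_component x : exists c y, x = s c *: v + y /\ low y.
Proof.
elim: (fspan_all x) => {x} [|x y _ [c [x' [-> lx]]] _ [c' [y' [-> ly]]]|b c x hx].
- by exists 0, 0; rewrite rmorph0 scale0r addr0; split=> //; exact: hspan0.
- exists (c + c'), (x' + y'); rewrite rmorphD scalerDl addrACA; split=> //.
  exact: hspanD.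
elim: hx b => {c x} [|c i a x _ hx IH] b.
  by exists b, 0; rewrite addr0; split=> //; exact: hspan0.
case: (posnP a) => [->|a0]; first by rewrite f0 scale1r.
exists 0, (s b *: (f i a *: x)); rewrite rmorph0 scale0r add0r; split=> //.
exact/lowZ/f_low.
Qed.

Let posN : nat -> Prop := fun a => (0 < a)%N.

(* The largest graded submodule that misses the top weight; it is zero by
   simplicity. *)
Let T x := forall m c y, eword posN m c y -> low (y *: x).

Let T_low x : T x -> low x.
Proof. by move=> /(_ _ _ _ (eword1 _)); rewrite scale1r. Qed.
Let T0 : T 0. Proof. by move=> m c y _; rewrite scaler0; exact: hspan0. Qed.
Let TD x y : T x -> T y -> T (x + y).
Proof. by move=> Tx Ty m c z hz; rewrite scalerDr; apply: hspanD; [exact: Tx hz | exact: Ty hz]. Qed.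
Let TZ b x : T x -> T (s b *: x).
Proof. by move=> Tx m c z hz; rewrite sA; apply: lowZ; exact: Tx hz. Qed.
Let Te i a x : T x -> T (e i a *: x).
Proof.
case: (posnP a) => [->|a0 Tx]; first by rewrite e0 scale1r.
by move=> m c z hz; rewrite scalerA; apply: Tx (ewordM i _ hz).
Qed.

Let T_graded x : T x -> hspan T x.
Proof.
have [r [w [ur wr ->]]] := wt_sum_uniq x; move=> Tx.
rewrite big_seq; apply: hspan_sum => mu mr; apply: hspanw (wr _ mr) _.
move=> m c y hy; have [E|ne] := eqVneq (mu + wsum c) lambda; last first.
  by apply: low_wt ne _; apply: eword_wt hy _; exact: wr.
have := Tx _ _ _ hy; rewrite (bigD1_seq mu) //= scalerDr => lx.
rewrite -[y *: _](addrK (y *: \sum_(i <- r | i != mu) w i)); apply: hspanD => //.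
apply: lowN; rewrite scaler_sumr big_seq_cond; apply: hspan_sum => nu /andP[nr ne].
apply: (@low_wt (nu + wsum c)); last by apply: eword_wt hy _; exact: wr.
by rewrite -E (inj_eq (addIr _)).
Qed.

Let Tf i b x : T x -> T (f i b *: x).
Proof.
case: (posnP b) => [->|b0]; first by rewrite f0 scale1r.
move=> Tx m c y hy.
elim: hy i b b0 x Tx => {m c y} [|m c y j a a0 hy IH] i b b0 x Tx.
  by rewrite scale1r; exact: f_low.
elim: (T_graded Tx) => {x Tx} [|x x' _ IHx _ IHx'|mu x wx Tx].
- by rewrite !scaler0; exact: hspan0.
- by rewrite !scalerDr; exact: hspanD.
rewrite -scalerA; case: (eqVneq j i) => [->|ji]; last first.
  rewrite [e j a *: _]scalerA efC // -scalerA; apply: IH => //; exact: Te.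
have [b' ->] := ef_act i a b wx.
rewrite scaler_sumr; apply: hspan_sum => t _; rewrite sA; apply: lowZ.
rewrite /fsub; case: ltngtP => [lt_tb|_|->].
- by apply: IH; [rewrite subn_gt0 | exact: Te].
- by rewrite scale0r scaler0; exact: hspan0.
by rewrite subnn f0 scale1r; exact: (Te _ _ Tx) hy.
Qed.

Let T_eq0 x : T x -> x = 0.
Proof.
have [//|Tall] := simple_graded T0 TD TZ Te Tf T_graded; first exact.
by case: v_notin_low; exact: T_low.
Qed.

(** Every e j a with a > 0 kills f i b v, or sends it to a vector of the same
    form that is zero by induction on b; so f i b v generates a submodule that
    misses the top weight. *)
Lemma f_v_big i : exists m, (m < N)%N /\ forall b, (m < b)%N -> f i b *: v = 0.
Proof.
have [m [mN hm]] := v_restricted i; exists m; split=> //.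
elim/ltn_ind => b IH mb; apply: T_eq0 => m' c y hy.
have b0 : (0 < b)%N by case: (b) mb.
elim: hy => {m' c y} [|m' c y j a a0 _ _]; first by rewrite scale1r; exact: f_low.
rewrite -scalerA [X in y *: X](_ : _ = 0); first by rewrite scaler0; exact: hspan0.
case: (eqVneq j i) => [->|ji]; last by rewrite scalerA efC // -scalerA e_v // scaler0.
have [le_b|lt_b] := leqP b (m + a); first by apply: hm; rewrite mb.
have [b' ->] := ef_act i a b wt_v.
rewrite big_ord_recr /= big1 ?add0r => [|t _]; last first.
  by rewrite e_v ?subn_gt0 // !scaler0.
rewrite subnn e0 scale1r /fsub; case: leqP => _; last by rewrite scale0r scaler0.
by have a0' : (0 < a)%N := a0; rewrite IH ?scaler0 //; lia.
Qed.

Lemma fword_cases c i x : fword anyN c x ->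
  (exists2 j, j != i & (0 < c j)%N) \/ exists b, x = s b *: (f i (c i) *: v).
Proof.
elim=> {c x} [|c j a x _ _ IH].
  by right; exists 1; rewrite f0 rmorph1 !scale1r.
case: (posnP a) => [->|a0].
  rewrite f0 scale1r; case: IH => [[j' ne c0]|[b xE]]; [left | right].
    by exists j' => //; rewrite /cadd; case: eqP => _; rewrite addn0.
  by exists b; rewrite /cadd; case: eqP => _; rewrite addn0.
case: (eqVneq j i) => [->|ji]; last first.
  by left; exists j => //; rewrite /cadd eqxx; lia.
case: IH => [[j' ne c0]|[b ->]]; [left | right].
  by exists j' => //; rewrite /cadd (negbTE ne) addn0.
have [b' E] := fM i a (c i).
exists (b * b'); rewrite /cadd eqxx sA [f i a *: _]scalerA E rmorphM -!scalerA.
by rewrite addnC.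
Qed.

(** Only a multiple of f i n v can be raised to the top weight by e i n, and it is
    zero for n >= N by f_v_big. *)
Lemma e_low i n x : (0 < n)%N -> (N <= n)%N -> low (e i n *: x).
Proof.
move=> n0 Nn; apply: (fspan_op (H := anyN)) (fspan_all x); [exact: hspan0 | exact: hspanD | exact: lowZ |].
move=> c {}x hx; have [E|ne] := pselect (c =1 cadd (fun=> 0%N) i n); last first.
  apply: (@low_shift c (cadd (fun=> 0%N) i n)) => //.
  by rewrite wsum_add wsum0 add0r; exact/wt_e/(fword_wt hx).
have ci : c i = n by rewrite E /cadd eqxx.
case: (fword_cases i hx) => [[j ne]|[b ->]].
  by rewrite E /cadd (negbTE ne).
have [m [mN fv]] := f_v_big i.
rewrite ci fv ?scaler0; [exact: hspan0 | exact: leq_trans mN Nn].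
Qed.

(* Like T, but tested on the words in the small generators only. The point is
   that K is stable under all e i n, so that it is contained in T. *)
Let K x := forall m c y, eword G m c y -> low (y *: x).

Let KD x y : K x -> K y -> K (x + y).
Proof. by move=> Tx Ty m c z hz; rewrite scalerDr; apply: hspanD; [exact: Tx hz | exact: Ty hz]. Qed.
Let K0 : K 0. Proof. by move=> m c y _; rewrite scaler0; exact: hspan0. Qed.
Let KZ b x : K x -> K (s b *: x).
Proof. by move=> Tx m c z hz; rewrite sA; apply: lowZ; exact: Tx hz. Qed.
Let K_low x : K x -> low x.
Proof. by move=> /(_ _ _ _ (eword1 _)); rewrite scale1r. Qed.
Let K_gen i a x : G a -> K x -> K (e i a *: x).
Proof. by move=> Ga Kx m c z hz; rewrite scalerA; apply: Kx (ewordM i Ga hz). Qed.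

Let K_small i n x : (n < N)%N -> K x -> K (e i n *: x).
Proof.
elim/ltn_ind: n x => n IH x nN Kx.
case: (posnP n) => [->|n0]; first by rewrite e0 scale1r.
have [|a [c [Ga an ->]]] := @e_gen i n; first by rewrite n0.
rewrite -!scalerA; apply/KZ/K_gen => //; have := G_gt0 Ga.
by move=> a0; apply: IH; lia || exact: Kx.
Qed.

Let K_sum (J : Type) (r : seq J) (P : pred J) (F : J -> V) :
  (forall j, P j -> K (F j)) -> K (\sum_(j <- r | P j) F j).
Proof. by move=> h; elim/big_ind: _ => //. Qed.

(* Move e i n to the left through a small word: for a letter of another index the
   Serre relation leaves brackets of order less than N, which are made of small
   generators; once e i n stands in front, it is small or e_low applies. *)
Let K_e i n x : K x -> K (e i n *: x).
Proof.
move=> Kx m c y hy.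
elim: hy i n x Kx => {m c y} [|m c y j a Ga hy IH] i n x Kx.
  rewrite scale1r; case: (ltnP n N) => nN; first exact/K_low/K_small.
  case: (posnP n) => [->|n0]; first by rewrite e0 scale1r; exact: K_low.
  exact: e_low.
rewrite -scalerA [e j a *: _]scalerA; case: (eqVneq j i) => [->|ji].
  by rewrite eC -scalerA; apply: IH; exact: K_gen.
have ij : i != j by rewrite eq_sym.
have [C [b ->]] := e_serre a n ij.
rewrite scaler_suml scaler_sumr; apply: hspan_sum => t le_t.
rewrite -scalerA sA; apply: lowZ; rewrite -scalerA; apply: IH.
rewrite scaler_suml; apply: K_sum => r _; rewrite -!scalerA; apply: KZ.
have tN : (t < N)%N by apply: leq_ltn_trans le_t (G_small ij Ga).
apply: K_small; first by lia.
apply: K_gen => //; apply: K_small => //.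
by apply: leq_ltn_trans tN; rewrite -ltnS.
Qed.

Let K_eq0 x : K x -> x = 0.
Proof.
move=> Kx; apply: T_eq0 => m c y hy.
elim: hy x Kx => {m c y} [|m c y i a a0 _ IH] x Kx; first by rewrite scale1r; exact: K_low.
by rewrite -scalerA; apply: IH; exact: K_e.
Qed.

Lemma fspan_small i n x : (n < N)%N -> fspan G x -> fspan G (f i n *: x).
Proof.
elim/ltn_ind: n x => n IH x nN Kx.
case: (posnP n) => [->|n0]; first by rewrite f0 scale1r.
have [|a [c [Ga an ->]]] := @f_gen i n; first by rewrite n0.
rewrite -!scalerA; apply/fspanZ/fspanf => //; have := G_gt0 Ga.
by move=> a0; apply: IH; lia || exact: Kx.
Qed.

(** The mirror image of K_e, with f_v_big in place of e_low. *)
Lemma fspan_f i n x : fspan G x -> fspan G (f i n *: x).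
Proof.
apply: fspan_op; [exact: fspan0 | exact: fspanD | exact: fspanZ |] => c {}x hx.
elim: hx i n => {c x} [|c j a x Ga hx IH] i n.
  have [lt_n|le_n] := ltnP n N; first by apply: fspan_small => //; exact: fspan_word (fword_v _).
  have [m [mN fv]] := f_v_big i.
  by rewrite fv; [exact: fspan0 | exact: leq_trans mN le_n].
rewrite scalerA; case: (eqVneq i j) => [<-|ij].
  by rewrite fC -scalerA; apply: fspanf.
have [C [b ->]] := f_serre a n ij.
rewrite scaler_suml; apply: fspan_sum => t le_t.
rewrite -scalerA; apply: fspanZ; rewrite -scalerA scaler_suml.
apply: fspan_sum => r _; rewrite -!scalerA; apply: fspanZ.
have tN : (t < N)%N by apply: leq_ltn_trans le_t (G_small ij Ga).
apply: fspan_small; first by lia.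
apply: fspanf => //; apply: fspan_small => //.
by apply: leq_ltn_trans tN; rewrite -ltnS.
Qed.

Lemma fspan_small_all x : fspan G x.
Proof.
elim: (fspan_all x) => {x} [|x y _ IHx _ IHy|b c x hx].
- exact: fspan0.
- exact: fspanD.
apply: fspanZ; elim: hx => {c x} [|c i a x _ _ IH].
  exact: fspan_word (fword_v _).
exact: fspan_f.
Qed.

Lemma ewords_bounded x : exists b, forall m c y, eword G m c y -> (b < m)%N -> low (y *: x).
Proof.
elim: (fspan_all x) => {x} [|x y _ [b hb] _ [b' hb']|b c x hx].
- by exists 0%N => m c y _ _; rewrite scaler0; exact: hspan0.
- exists (b + b')%N => m c z hz lt_m; rewrite scalerDr; apply: hspanD.
    by apply: hb hz _; lia.
  by apply: hb' hz _; lia.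
exists (\sum_j c j)%N => m c' y hy lt_m; rewrite sA; apply: lowZ.
have wx := fword_wt hx; apply: (low_shift (eword_wt hy wx)) => E.
have := eword_size G_gt0 hy; rewrite -(eq_bigr _ (fun j _ => E j)); lia.
Qed.

(** Let w be a nonzero element of a submodule M for the small subring. Take a
    longest small word y in the e i a for which y w is not in low. Then y w - d v
    lies in K for its component d v, hence is zero, and v lies in M; the small
    words in the f i a applied to v span everything. *)
Theorem restricted_simple (S : U -> Prop) :
  (forall c, S (s c)) -> (forall i a, G a -> S (e i a)) -> (forall i a, G a -> S (f i a)) ->
  simple_over S V.
Proof.
move=> Ss Se Sf; split; first by exists v; apply/eqP.
move=> M M0 MD MS; have [allM0|] := pselect (forall x, M x -> x = 0); first by left.
move=> /existsNP[w /not_implyP[Mw w0]]; right.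
have Mv : M v; last first.
  move=> x; elim: (fspan_small_all x) => {x} [//|x y _ IHx _ IHy|b c x hx]; first exact: MD.
  apply: (MS); first exact: Ss.
  by apply: (fword_closed hx) => // i a y Ga IH; apply: (MS) => //; exact: Sf.
have [b hb] := ewords_bounded w.
pose Q m := `[< exists c y, eword G m c y /\ ~ low (y *: w) >].
have exQ : exists m, Q m.
  apply: contrapT => nQ; apply: w0; apply: K_eq0 => m c y hy.
  by apply: contrapT => nl; apply: nQ; exists m; apply/asboolP; exists c, y.
have boundQ m : Q m -> (m <= b)%N.
  move=> /asboolP[c [y [hy nl]]]; rewrite leqNgt; apply/negP => lt_m.
  by apply: nl; exact: hb hy lt_m.
case: (ex_maxnP exQ boundQ) => m /asboolP[c [y [hy nl]]] maxm.
have My : M (y *: w).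
  elim: hy w Mw {w0 hb exQ boundQ Q nl maxm} => {m c y} [|m c y i a Ga _ IH] w Mw.
    by rewrite scale1r.
  by rewrite -scalerA; apply: IH; apply: (MS) => //; exact: Se.
have [d [z [yE lz]]] := top_component (y *: w).
have z0 : z = 0.
  apply: K_eq0 => m' c' y' hy'; case: hy' => {m' c' y'} [|m' c' y' i a Ga hy'].
    by rewrite scale1r.
  have zE : z = y *: w - s d *: v by rewrite yE addrC addKr.
  rewrite zE scalerBr [_ *: (s d *: v)]sA -[_ * _ *: v]scalerA e_v ?G_gt0 // !scaler0 subr0.
  apply: contrapT => nl'.
  have [c'' h''] := eword_mul (ewordM i Ga hy') hy.
  have : Q (m'.+1 + m)%N by apply/asboolP; exists c'', (y' * e i a * y); rewrite -scalerA.
  by move=> /maxm; lia.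
move: yE nl My; rewrite z0 addr0 => -> nl My.
have d0 : d != 0 by apply/eqP => d0; apply: nl; rewrite d0 rmorph0 scale0r; exact: hspan0.
have -> : v = s d^-1 *: (s d *: v) by rewrite scalerA -rmorphM mulVf // rmorph1 scale1r.
exact: MS.
Qed.

End RestrictedSimple.

(** * The exponents of the generators *)
Section Degrees.
Variables (k : fieldType) (p l r : nat).
Hypothesis charP : has_char k p.
Hypothesis r_char : (1 <= r)%N -> (0 < p)%N.

(** If p^r l = 1 there are no exponents at all: the bound of gen_degree_small
    would fail for a = 1, and the module is then a line. *)
Definition gen_degree (a : nat) : Prop :=
  (1 < p ^ r * l)%N /\ (a = 1%N \/ exists2 s, (s < r)%N & a = (p ^ s * l)%N).

Let pchar_p : (0 < r)%N -> p \in [pchar k].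
Proof. by move=> /r_char; move: charP; case: (p). Qed.

(** The product of the divided powers of exponents a and n - a is the one of
    exponent n up to a Gaussian binomial. It is invertible for a = 1 if n < l, and
    otherwise for the largest a = p^s l that is at most n. *)
Lemma gen_degree_exists v n : odd l -> l.-primitive_root v ->
  (0 < n < p ^ r * l)%N ->
  exists a, [/\ gen_degree a, (a <= n)%N & gauss v n a != 0 :> k].
Proof.
move=> ol pv /andP[n0 nN]; have N1 : (1 < p ^ r * l)%N by lia.
case: (ltnP n l) => [nl|ln].
  exists 1%N; split=> //; first by split=> //; left.
  by apply: (gauss1_neq0 ol pv); rewrite n0.
have [s sr /andP[h1 h2]] : exists2 s, (s < r)%N & (p ^ s * l <= n < p ^ s.+1 * l)%N.
  elim: (r) nN => [|m IH]; first by rewrite expn0; lia.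
  case: (ltnP n (p ^ m * l)) => [/IH[s sm h] _|h h']; first by exists s => //; exact: leqW.
  by exists m; rewrite ?h.
exists (p ^ s * l)%N; split=> //; first by split=> //; right; exists s.
apply: gauss_lucas => //; first by apply: pchar_p; case: (r) sr.
by rewrite h1 mulnA -expnS.
Qed.

Let below c M : (c <= 3)%N -> odd M -> (1 < M)%N -> ((2 < c)%N -> coprime M 3) -> (c < M)%N.
Proof.
move=> c3 oM M1 cop; rewrite ltnNge; apply/negP => Mc.
have M3 : M = 3 by case: M oM M1 Mc {cop} => [|[|[|[|M]]]] //; lia.
by move: cop Mc; rewrite M3 => cop /cop.
Qed.

(** An odd number greater than 1 exceeds 2, and it exceeds 3 if it is prime to 3;
    apply this to p^r l if a = 1, and to p if a = p^s l. *)
Lemma gen_degree_small a c : odd l -> p <> 2%N ->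
  ((2 < c)%N -> p <> 3%N /\ coprime l 3) -> (c <= 3)%N ->
  gen_degree a -> (a * c < p ^ r * l)%N.
Proof.
move=> ol p2 g2 c3 [N1].
have pP : (0 < r)%N -> [/\ prime p, odd p & (2 < c)%N -> coprime p 3].
  move=> /pchar_p pk; have pp := pcharf_prime pk; split=> //.
    by case/even_prime: pp.
  by move=> /g2[p3 _]; rewrite prime_coprime // dvdn_prime2 //; apply/eqP.
case=> [->|[s sr ->]].
  rewrite mul1n; apply: below => //.
    by rewrite oddM ol andbT oddX; case: (posnP r) => [//|/pP[_ -> _]]; rewrite orbT.
  move=> /[dup] /g2[_ l3] h; rewrite coprimeMl l3 andbT.
  case: (posnP r) => [->|/pP[_ _ /(_ h) p3]]; first by rewrite expn0.
  exact: coprimeXl.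
have [pp op cp] := pP (leq_ltn_trans (leq0n s) sr).
have cltp : (c < p)%N by apply: below => //; exact: prime_gt1.
have l0 : (0 < l)%N by case: (l) ol.
have a0 : (0 < p ^ s * l)%N by rewrite muln_gt0 expn_gt0 prime_gt0.
apply: (@leq_trans (p ^ s.+1 * l)).
  by rewrite expnS -(mulnA p) mulnC ltn_pmul2r.
by rewrite leq_pmul2r // leq_exp2l // prime_gt1.
Qed.

End Degrees.

(** Half the squared lengths are 1, 2 or 3, hence prime to l. *)
Lemma primitive_root_exp (k : fieldType) (l : nat) (zeta : k) (d : int) :
  l.-primitive_root zeta -> odd l -> 0 < d -> d <= 3 -> (d = 3 -> coprime l 3) ->
  l.-primitive_root (zeta ^ d).
Proof.
move=> pz ol d0 d3 cop; have -> : d = `|d|%N by lia.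
rewrite -exprnP (prim_root_exp_coprime _ pz).
have : d = 1 \/ d = 2 \/ d = 3 by lia.
case=> [->|[->|dE]]; first by rewrite /= coprime1n.
  by rewrite coprime2n.
by rewrite coprime_sym dE cop.
Qed.

(** * Simplicity over the Frobenius-Lusztig kernels *)
Section GradedSubmodules.
Variables (R : archiRealFieldType) (E : vectType R) (ip : E -> E -> R).
Variables (Phi : seq E) (n : nat) (Pi : n.-tuple E).
Variables (k : fieldType) (l : nat) (zeta : k).
Hypothesis zeta0 : zeta != 0.
Local Notation B := (gram ip Pi).
Local Notation U := (Uzeta B l zeta).
Local Notation scz := (@Uzeta_scalar n B k l zeta).
Variable V : lmodType U.
Local Notation wt := (@weight_vector R E ip Phi n Pi k l zeta V).
Local Notation uE := (uE B l zeta).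
Local Notation uF := (uF B l zeta).
Local Notation uK := (uK B l zeta).
Local Notation uKV := (uKV B l zeta).

Lemma weight_vectorD mu x y : wt mu x -> wt mu y -> wt mu (x + y).
Proof.
move=> [lmu Kx bx] [_ Ky b_y]; split=> // [i|i t u c hu hc]; rewrite /kscale !scalerDr.
  by congr (_ + _); [exact: Kx | exact: Ky].
by congr (_ + _); [exact: bx hu hc | exact: b_y hu hc].
Qed.

Lemma weight_vectorZ mu c x : wt mu x -> wt mu (scz c *: x).
Proof.
move=> [lmu Kx bx]; have sC := @Uzeta_scalarC n B k l zeta.
have sA e (u : U) : u *: (scz c *: x) = kscale e (scz c *: x) <->
    scz c *: (u *: x) = scz c *: kscale e x.
  have h1 : u *: (scz c *: x) = scz c *: (u *: x) by exact: (sact_act sC).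
  have h2 : kscale e (scz c *: x) = scz c *: kscale e x by exact: (sact_act sC).
  by rewrite h1 h2.
split=> // [i|i t u e hu he]; apply/sA; congr (_ *: _); first exact: Kx.
exact: bx hu he.
Qed.

(** The specialization is generated by the divided powers and the torus, which
    acts by scalars on weight vectors; a graded subspace is thus stable under the
    torus for free. *)
Lemma graded_submodule (M : V -> Prop) : simple_module V ->
  M 0 -> (forall x y, M x -> M y -> M (x + y)) -> (forall c x, M x -> M (scz c *: x)) ->
  (forall i a x, M x -> M (uE i a *: x)) -> (forall i a x, M x -> M (uF i a *: x)) ->
  (forall x, M x -> hspan wt M x) ->
  (forall x, M x -> x = 0) \/ (forall x, M x).
Proof.
move=> [_ simp] M0 MD MZ Me Mf Mh; apply: simp => // u x _.
have torus (t : U) (a : E -> k) :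
    (forall mu w, wt mu w -> t *: w = scz (a mu) *: w) -> forall x, M x -> M (t *: x).
  move=> act y /Mh; elim=> {y} [|y z _ IHy _ IHz|mu w ww Mw].
  - by rewrite scaler0.
  - by rewrite scalerDr; exact: MD.
  by rewrite (act mu w ww); exact: MZ.
elim/Uzeta_ind: u x => [c|i a|i a|i|i|y z IHy IHz|y z IHy IHz] x Mx.
- exact: MZ.
- exact: Me.
- exact: Mf.
- by apply: torus Mx => mu w [_ Kw _]; exact: Kw.
- by apply: torus Mx => mu w ww; exact: (uKV_act zeta0 i ww).
- by rewrite scalerDl; apply: MD; [exact: IHy | exact: IHz].
- by rewrite -scalerA; apply: IHy; exact: IHz.
Qed.

End GradedSubmodules.

Theorem theorem3p4p3
  (R : archiRealFieldType) (E : vectType R) (ip : E -> E -> R)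
  (Phi : seq E) (n : nat) (Pi : n.-tuple E)
  (k : fieldType) (p l : nat) (zeta : k) (r : nat) (lambda : E)
  (V : lmodType (Uzeta (gram ip Pi) l zeta)) :
  inner_product ip ->
  root_system ip Phi ->
  indecomposable ip Phi ->
  simple_roots Phi Pi ->
  normalized ip Phi ->
  has_char k p ->
  p <> 2%N ->
  (type_G2 ip Pi -> p <> 3%N) ->
  odd l ->
  ((0 < p)%N -> coprime l p) ->
  (type_G2 ip Pi -> coprime l 3) ->
  l.-primitive_root zeta ->
  ((1 <= r)%N -> (0 < p)%N) ->
  restricted ip Phi Pi (p ^ r * l) lambda ->
  is_simple_highest_weight Phi V lambda ->
  simple_over (FL_kernel (B := gram ip Pi) (l := l) (zeta := zeta) p r) V.
Proof.
move=> ipP rootP indec simpleP normP charP p2 pG2 odd_l _ lG2 prim_zeta r_char.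
move=> [[lat_lambda _] lambda_N] [simpleV [wt_sum wt_indep _] [v [v0 wt_v e_v]]].
have zeta0 : zeta != 0 by rewrite (prim_root_eq0 prim_zeta) -lt0n (prim_order_gt0 prim_zeta).
pose B := gram ip Pi.
have Bf : forall i j, B i j = half_norm B i * cartan B i j := gram_factor ipP rootP indec simpleP normP.
have d0 : forall i, 0 < half_norm B i := half_norm_gt0 ipP rootP indec simpleP normP.
have cii : forall i, cartan B i i = 2 := cartan_diag ipP rootP indec simpleP normP.
have cle : forall i j, i != j -> cartan B i j <= 0 := cartan_offdiag ipP rootP indec simpleP normP.
have lsh := lattice_shift ipP rootP simpleP.
have csh := int_copairing_shift ipP rootP indec simpleP normP.
have ipcop := int_ip_copairing ipP rootP indec simpleP normP.
have prim_i i : l.-primitive_root (zeta ^ half_norm B i).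
  apply: primitive_root_exp => //; first exact: (half_norm_le3 ipP rootP indec simpleP normP).
  by move=> /(long_type_G2 ipP rootP indec simpleP normP)/lG2.
pose wt := @weight_vector R E ip Phi n Pi k l zeta V.
pose sc : {rmorphism k -> Uzeta B l zeta} := @Uzeta_scalar n B k l zeta.
have sC : forall c x, x * sc c = sc c * x := @Uzeta_scalarC n B k l zeta.
have gen g (i : 'I_n) m : (forall a b, g a * g b = sc (gauss (zeta ^ half_norm B i) (a + b) a) * g (a + b)%N) ->
    (0 < m < p ^ r * l)%N -> exists a c,
    [/\ gen_degree p l r a, (a <= m)%N & g m = sc c * (g a * g (m - a)%N)].
  move=> gM hm; have [a [Ga am ne]] := gen_degree_exists charP r_char odd_l (prim_i i) hm.
  exists a, (gauss (zeta ^ half_norm B i) m a)^-1; split=> //.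
  by rewrite gM subnKC // mulrA -rmorphM mulVf // rmorph1 mul1r.
have wtE mu x i a : wt mu x -> wt (mu + tnth Pi i *+ a) (uE B l zeta i a *: x).
  by move=> wx; exact: (wt_uE zeta0 Bf d0 cii lsh csh ipcop i a wx).
have wtF mu x i a : wt mu x -> wt (mu - tnth Pi i *+ a) (uF B l zeta i a *: x).
  move=> wx; have := wt_uF zeta0 Bf d0 cii lsh csh ipcop i a wx.
  by rewrite mulrNz.
have v_restricted (i : 'I_n) : exists m, (m < p ^ r * l)%N /\
    forall a b, (m < b <= m + a)%N -> uE B l zeta i a *: (uF B l zeta i b *: v) = 0.
  have [m mE] : exists m : nat, int_copairing ip lambda (tnth Pi i) = m.
    have : 0 <= int_copairing ip lambda (tnth Pi i).
      rewrite -(ler_int R) (int_copairingE simpleP i lat_lambda).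
      by case/andP: (lambda_N i).
    by case: (int_copairing _ _ _) => // m _; exists m.
  (* The last coefficient of the commutation formula is the Gaussian binomial of
     m + a - b over a, with 0 <= m + a - b < a; the others multiply E^(a - t) v. *)
  exists m; split.
    have /andP[_] := lambda_N i; rewrite -(int_copairingE simpleP i lat_lambda) mE.
    by rewrite -pmulrn ltr_nat.
  move=> a b /andP[mb bma].
  have [e [se ->]] := uEF_act zeta0 Bf d0 cii lsh csh ipcop i a b wt_v.
  rewrite big1 // => -[t /= ta] _; have [at_|ne] := eqVneq t a.
    have -> : e t = 0.
      apply: (spec_fun zeta0 (se t)); rewrite mE at_.
      have -> : m%:Z + a%:Z - b%:Z = (m + a - b)%N by lia.
      rewrite qbin_small; last by lia.
      exact: spec0.
    exact: sact0.
  by rewrite e_v ?scaler0 ?subn_gt0 1?ltn_neqAle ?ne //; exact: scaler0.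
have serre_F i j a m : i != j -> exists (C : nat -> k) (b : nat -> nat -> k),
    uF B l zeta i m * uF B l zeta j a = \sum_(t < m.+1 | (t <= a * `|cartan B i j|)%N)
    sc (C t) * ((\sum_(s < t.+1) sc (b t s) *
      (uF B l zeta i (t - s) * uF B l zeta j a * uF B l zeta i s)) * uF B l zeta i (m - t)).
  move=> ij; have [C CE] := uF_commute l zeta0 d0 cle a m ij.
  by exists C, (ucoef B zeta i j a).
have serre_E i j a m : i != j -> exists (C : nat -> k) (b : nat -> nat -> k),
    uE B l zeta j a * uE B l zeta i m = \sum_(t < m.+1 | (t <= a * `|cartan B i j|)%N)
    sc (C t) * (uE B l zeta i (m - t) * (\sum_(s < t.+1) sc (b t s) *
      (uE B l zeta i (t - s) * uE B l zeta j a * uE B l zeta i s))).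
  move=> ij; have [C CE] := uE_commute l zeta0 d0 cle a m ij.
  by exists C, (ucoef B zeta i j a).
have UEM := uEM l zeta0 d0; have UFM := uFM l zeta0 d0.
have small i j a : i != j -> gen_degree p l r a -> (a * `|cartan B i j| < p ^ r * l)%N.
  move=> ij; apply: (gen_degree_small charP r_char odd_l p2).
    by move=> /(triple_type_G2 ipP rootP indec simpleP normP ij) G2; split; [exact: pG2 | exact: lG2].
  exact: (cartan_bound ipP rootP indec simpleP normP ij).
have l0 : (0 < l)%N := prim_order_gt0 prim_zeta.
have deg_gt0 a : gen_degree p l r a -> (0 < a)%N.
  move=> [_ [->|[s sr ->]]] //; rewrite muln_gt0 l0 andbT expn_gt0 r_char //.
  exact: leq_ltn_trans (leq0n s) sr.
have EF i a b mu x : wt mu x -> exists c : nat -> k, uE B l zeta i a *: (uF B l zeta i b *: x) =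
    \sum_(t < a.+1) sc (c t) *: (fsub (uF B l zeta) i b t *: (uE B l zeta i (a - t) *: x)).
  by move=> wx; have [e [_ h]] := uEF_act zeta0 Bf d0 cii lsh csh ipcop i a b wx; exists e.
have v0' : v != 0 by apply/eqP.
apply: (@restricted_simple k (Uzeta B l zeta) sc V sC _ (uE B l zeta) (uF B l zeta) E (tnth Pi)
  wt _ _ wtE wtF wt_sum wt_indep _ (simple_root_wsum_inj simpleP) (uE0 B l zeta) (uF0 B l zeta)
  (uE_comm B l zeta) (uF_comm B l zeta) _ (fun i j a b ij => uEF_commute B l zeta a b ij) EF
  lambda v v0' wt_v e_v (p ^ r * l)%N (gen_degree p l r) (fun i j => `|cartan B i j|%N)
  v_restricted deg_gt0 _ _ small serre_F serre_E).
- exact: weight_vectorD.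
- exact: weight_vectorZ.
- move=> M M0 MD MZ ME MF Mh; exact: (graded_submodule zeta0 simpleV M0 MD MZ ME MF Mh).
- move=> i a b; eexists; exact: UFM.
- move=> i m; apply: (gen (uE B l zeta i) i m) => a b; exact: UEM.
- move=> i m; apply: (gen (uF B l zeta i) i m) => a b; exact: UFM.
- by move=> c; apply: subring_gen_base; exact: FL_gen_scalar.
- move=> i a [_ [->|[s sr ->]]]; apply: subring_gen_base; first exact: FL_gen_E.
  exact: FL_gen_Ep.
move=> i a [_ [->|[s sr ->]]]; apply: subring_gen_base; first exact: FL_gen_F.
exact: FL_gen_Fp.
Qed.
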